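(* Fix $r>d/2$ and let $0<\delta\le2$. Assume that for some $\varepsilon>0$ $$\Vert z(0)\Vert_{r+2\delta+\varepsilon}+\Vert c^{-1}\langle\nabla\rangle_c^{-1}z'(0)\Vert_{r+2\delta+\varepsilon}\le M_{2\delta+\varepsilon}$$ uniformly in $c$, and that there exist functions $\varphi,\gamma$ (independent of $c$) such that $$\Vert z(0)-\varphi\Vert_r+\Vert c^{-1}\langle\nabla\rangle_c^{-1}z'(0)-\gamma\Vert_r\le k_rc^{-\delta}$$ for some constant $k_r$ independent of $c$. Let $(u_\ast^n,v_\ast^n)$ be the first-order exponential-type scheme and $(u_{\ast,\infty}^n,v_{\ast,\infty}^n)$ the Lie splitting scheme for the limit nonlinear Schr\''odinger system, both with step size $\tau$, as given in the context. Then there exist $T>0$ and $\tau_0>0$ such that for all $\tau\le\tau_0$, all $t_n=n\tau\le T$ and all $c>0$ with $$\tau c^{2-\delta}\ge1$$ it holds that $$\Vert u_\ast^n-u_{\ast,\infty}^n\Vert_r+\Vert v_\ast^n-v_{\ast,\infty}^n\Vert_r\le c^{-\delta}k_r(M_{2\delta+\varepsilon},T)$$ for some constant $k_r(M_{2\delta+\varepsilon},T)$ that depends on $M_{2\delta+\varepsilon}$ and $T$, but is independent of $c$.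
   Context: Setting: for $c>0$, the cubic Klein--Gordon equation $c^{-2}\partial_{tt}z-\Delta z+c^2z=|z|^2z$ on $\mathbb{T}^d$ (periodic boundary conditions, $z$ complex-valued) with initial data $z(0)$, $z'(0):=\partial_tz(0)$, which may depend on $c$. Norm: $\Vert u\Vert_r^2=\sum_{k\in\mathbb{Z}^d}(1+|k|^2)^r|\hat u_k|^2$, with $\hat u_k$ the Fourier coefficients normalized by $(2\pi)^{-d}$. Operators: $\langle\nabla\rangle_c=\sqrt{-\Delta+c^2}$ and $\mathcal{A}_c=c\langle\nabla\rangle_c-c^2$ (Fourier multipliers). $\varphi_1(\zeta)=\frac{\mathrm{e}^\zeta-1}{\zeta}$, $\varphi_1(0)=1$ (not to be confused with the function $\varphi$). First-order scheme with step size $\tau>0$, $t_n=n\tau$: $$\begin{aligned}u_\ast^{n+1}&=\mathrm{e}^{i\tau\mathcal{A}_c}\mathrm{e}^{-\tau\frac i8(|u_\ast^n|^2+2|v_\ast^n|^2)}u_\ast^n-\tau\tfrac i8\left(c\langle\nabla\rangle_c^{-1}-1\right)\mathrm{e}^{i\tau\mathcal{A}_c}\left(|u_\ast^n|^2+2|v_\ast^n|^2\right)u_\ast^n\\&\quad-\tau\tfrac i8c\langle\nabla\rangle_c^{-1}\mathrm{e}^{i\tau\mathcal{A}_c}\Big\{\mathrm{e}^{2ic^2t_n}\varphi_1(2ic^2\tau)(u_\ast^n)^2v_\ast^n+\mathrm{e}^{-2ic^2t_n}\varphi_1(-2ic^2\tau)\left(2|u_\ast^n|^2+|v_\ast^n|^2\right)\overline{v_\ast^n}\\&\qquad\qquad+\mathrm{e}^{-4ic^2t_n}\varphi_1(-4ic^2\tau)(\overline{v_\ast^n})^2\overline{u_\ast^n}\Big\},\end{aligned}$$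 with $u_\ast^0=z(0)-ic^{-1}\langle\nabla\rangle_c^{-1}z'(0)$; the formula for $v_\ast^{n+1}$ is obtained by exchanging $u_\ast^n\leftrightarrow v_\ast^n$ on the right-hand side, with $v_\ast^0=\overline{z(0)}-ic^{-1}\langle\nabla\rangle_c^{-1}\overline{z'(0)}$. Lie splitting for the limit system $i\partial_tu_{\ast,\infty}=\frac12\Delta u_{\ast,\infty}+\frac18(|u_{\ast,\infty}|^2+2|v_{\ast,\infty}|^2)u_{\ast,\infty}$, $i\partial_tv_{\ast,\infty}=\frac12\Delta v_{\ast,\infty}+\frac18(|v_{\ast,\infty}|^2+2|u_{\ast,\infty}|^2)v_{\ast,\infty}$: $$u_{\ast,\infty}^{n+1}=\mathrm{e}^{-i\tau\frac\Delta2}\mathrm{e}^{-i\tau\frac18(|u_{\ast,\infty}^n|^2+2|v_{\ast,\infty}^n|^2)}u_{\ast,\infty}^n,\quad u_{\ast,\infty}^0=\varphi-i\gamma,$$ $$v_{\ast,\infty}^{n+1}=\mathrm{e}^{-i\tau\frac\Delta2}\mathrm{e}^{-i\tau\frac18(|v_{\ast,\infty}^n|^2+2|u_{\ast,\infty}^n|^2)}v_{\ast,\infty}^n,\quad v_{\ast,\infty}^0=\overline\varphi-i\overline\gamma.$$ *)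

(* Defs.v *)
From HB Require Import structures.
From mathcomp Require Import all_boot all_order all_algebra.
From mathcomp Require Import complex.
From mathcomp Require Import all_classical all_reals all_analysis.
Set Implicit Arguments.
Unset Strict Implicit.
Unset Printing Implicit Defensive.
Import Order.TTheory GRing.Theory Num.Theory numFieldNormedType.Exports.
Local Open Scope classical_set_scope.
Local Open Scope complex_scope.
Local Open Scope ring_scope.

Section lebesgue_tuple.
Context (R : realType).
Local Notation X := (measurableTypeR R).

Let leb1 : {sigma_finite_measure set X -> \bar R} := lebesgue_measure.

Definition tuple_cons n (p : X * n.-tuple X) : n.+1.-tuple X :=
  [tuple of p.1 :: p.2].

Definition tuple_uncons n (x : n.+1.-tuple X) : X * n.-tuple X :=
  (thead x, [tuple of behead x]).

Lemma tuple_consK n : cancel (@tuple_cons n) (@tuple_uncons n).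
Proof. by move=> [a t]; congr pair; apply: val_inj. Qed.

Lemma tuple_unconsK n : cancel (@tuple_uncons n) (@tuple_cons n).
Proof. by move=> x; rewrite [RHS]tuple_eta. Qed.

Lemma measurable_tuple_cons n : measurable_fun setT (@tuple_cons n).
Proof. exact: measurable_cons. Qed.

Lemma measurable_tuple_uncons n : measurable_fun setT (@tuple_uncons n).
Proof.
by apply: measurable_fun_pair; [exact: measurable_tnth|exact: measurable_behead].
Qed.

Section step.
Variables (n : nat) (mu : {sigma_finite_measure set n.-tuple X -> \bar R}).

Definition lebesgue_cons : set (n.+1.-tuple X) -> \bar R :=
  pushforward (leb1 \x mu)%E (@tuple_cons n).

HB.instance Definition _ := Measure.copy lebesgue_cons
  (measure_function_pushforward__canonical__measure_function_Measure
    (leb1 \x mu)%E (@measurable_tuple_cons n)).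

(* For \x, canonical inference of sigma-finiteness only finds the instance for
   subprobabilities, hence this direct proof. *)
Let lebesgue_cons_sigma_finite : sigma_finite setT lebesgue_cons.
Proof.
have /sigma_finiteP[F [TF ndF Foo]] := sigma_finiteT leb1.
have /sigma_finiteP[G [TG ndG Goo]] := sigma_finiteT mu.
exists (fun i => @tuple_uncons n @^-1` (F i `*` G i)).
  rewrite -preimage_bigcup (_ : \bigcup_i _ = setT) ?preimage_setT//.
  rewrite -subTset => -[x y] _.
  have [i _ Fix] : (\bigcup_i F i) x by rewrite -TF.
  have [j _ Gjy] : (\bigcup_i G i) y by rewrite -TG.
  exists (maxn i j) => //; split.
  - by move: x Fix; exact/subsetPset/ndF/leq_maxl.
  - by move: y Gjy; exact/subsetPset/ndG/leq_maxr.
move=> i; have [mF ltF] := Foo i; have [mG ltG] := Goo i; split.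
  rewrite -[X in measurable X]setTI.
  by apply: measurable_tuple_uncons => //; exact: measurableX.
rewrite /lebesgue_cons /pushforward -comp_preimage.
rewrite (_ : _ \o _ = id) ?preimage_id; last exact/funext/tuple_consK.
by rewrite product_measure1E// lte_mul_pinfty// ge0_fin_numE.
Qed.

HB.instance Definition _ :=
  Measure_isSigmaFinite.Build _ _ _ lebesgue_cons lebesgue_cons_sigma_finite.

End step.

(* Lebesgue measure on R^n, as the n-fold product of the one-dimensional one. *)
Fixpoint lebesgue_tuple n : {sigma_finite_measure set n.-tuple X -> \bar R} :=
  if n is m.+1 then lebesgue_cons (lebesgue_tuple m) else dirac [tuple].

End lebesgue_tuple.

Section torus.
Context (R : realType) (d : nat).
Local Notation C := R[i].

(* A function on the torus R^d / (2 pi Z)^d is given by its values on the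
   fundamental cube [-pi, pi]^d; its values elsewhere play no role. *)
Definition torus_fun := d.-tuple (measurableTypeR R) -> C.

(* A periodic distribution is given by its Fourier coefficients; the Sobolev
   norms below are finite only for coefficients of polynomial growth. *)
Definition torus_distr := 'rV[int]_d -> C.

Definition cube : set (d.-tuple (measurableTypeR R)) :=
  [set x | forall i : 'I_d, - pi <= tnth x i <= pi].

Definition Cintegral (f : torus_fun) : C :=
  Rintegral (lebesgue_tuple R d) cube (fun x => complex.Re (f x)) +i*
  Rintegral (lebesgue_tuple R d) cube (fun x => complex.Im (f x)).

Definition torus_L2 (f : torus_fun) : Prop :=
  [/\ measurable_fun cube (fun x => complex.Re (f x)),
      measurable_fun cube (fun x => complex.Im (f x)) &
      (\int[lebesgue_tuple R d]_(x in cube)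
        ((Normc.normc (f x)) ^+ 2)%:E < +oo)%E].

Definition cexp (z : C) : C :=
  (expR (complex.Re z))%:C * (cos (complex.Im z) +i* sin (complex.Im z)).

Definition dotk (k : 'rV[int]_d) (x : d.-tuple (measurableTypeR R)) : R :=
  \sum_(i < d) (k 0 i)%:~R * tnth x i.

Definition sqk (k : 'rV[int]_d) : R := \sum_(i < d) (k 0 i)%:~R ^+ 2.

Definition fourier (f : torus_fun) : torus_distr := fun k =>
  ((2 * pi) ^+ d)^-1%:C * Cintegral (fun x => f x * cexp (- ('i * (dotk k x)%:C))).

(* Unordered sum over Z^d; meaningful for absolutely summable families. *)
Definition Rsum (a : 'rV[int]_d -> R) : R :=
  fine (\esum_(k in setT) (Num.max (a k) 0)%:E) -
  fine (\esum_(k in setT) (Num.max (- a k) 0)%:E).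

Definition Csum (a : 'rV[int]_d -> C) : C :=
  Rsum (fun k => complex.Re (a k)) +i* Rsum (fun k => complex.Im (a k)).

(* The function sum_k a_k exp(i k.x) *)
Definition synth (a : torus_distr) : torus_fun := fun x =>
  Csum (fun k => a k * cexp ('i * (dotk k x)%:C)).

Definition sobolev_norm (s : R) (a : torus_distr) : \bar R :=
  sqrte (\esum_(k in setT) ((1 + sqk k) `^ s * (Normc.normc (a k)) ^+ 2)%:E).

Definition multiplier (m : 'rV[int]_d -> C) (a : torus_distr) : torus_distr :=
  fun k => m k * a k.

(* Fourier multiplier with symbol m acting on functions *)
Definition fmult (m : 'rV[int]_d -> C) (f : torus_fun) : torus_fun :=
  synth (multiplier m (fourier f)).

(* Complex conjugate of a distribution: the k-th Fourier coefficient of conj z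
   is the conjugate of the (-k)-th one of z. *)
Definition conj_distr (a : torus_distr) : torus_distr :=
  fun k => (a (- k))^*.

(* Symbols: -Delta has symbol |k|^2. *)
Definition jap (c : R) (k : 'rV[int]_d) : R := Num.sqrt (sqk k + c ^+ 2).

Definition Acal (c : R) (k : 'rV[int]_d) : R := c * jap c k - c ^+ 2.

Definition inv_cjap (c : R) (k : 'rV[int]_d) : C := (c^-1 * (jap c k)^-1)%:C.

Definition phi1 (z : C) : C := if z == 0 then 1 else (cexp z - 1) / z.

Definition cubic (u v : torus_fun) : torus_fun :=
  fun x => (`|u x| ^+ 2 + 2 * `|v x| ^+ 2) * u x.

(* exp(-tau i/8 (|u|^2 + 2|v|^2)) u *)
Definition nl_flow (tau : R) (u v : torus_fun) : torus_fun :=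
  fun x => cexp (- (tau%:C * ('i / 8) * (`|u x| ^+ 2 + 2 * `|v x| ^+ 2))) * u x.

Definition oscillatory (c tau t : R) (u v : torus_fun) : torus_fun := fun x =>
  let w : C := 'i * (c ^+ 2)%:C in
    cexp (2 * w * t%:C) * phi1 (2 * w * tau%:C) * (u x ^+ 2 * v x)
  + cexp (- 2 * w * t%:C) * phi1 (- 2 * w * tau%:C) *
      ((2 * `|u x| ^+ 2 + `|v x| ^+ 2) * (v x)^*)
  + cexp (- 4 * w * t%:C) * phi1 (- 4 * w * tau%:C) *
      ((v x)^* ^+ 2 * (u x)^*).

Definition kg_step (c tau t : R) (u v : torus_fun) : torus_fun :=
  let eA k := cexp ('i * (tau * Acal c k)%:C) in
  fun x =>
    fmult eA (nl_flow tau u v) x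
  - tau%:C * ('i / 8) *
      fmult (fun k => (c / jap c k - 1)%:C * eA k) (cubic u v) x
  - tau%:C * ('i / 8) *
      fmult (fun k => (c / jap c k)%:C * eA k) (oscillatory c tau t u v) x.

(* The pair (u_*^n, v_*^n), with z0 = z(0) and z1 = z'(0). *)
Fixpoint kg_scheme (c tau : R) (z0 : torus_fun) (z1 : torus_distr) (n : nat)
    : torus_fun * torus_fun :=
  if n is m.+1 then
    let: (u, v) := kg_scheme c tau z0 z1 m in
    (kg_step c tau (m%:R * tau) u v, kg_step c tau (m%:R * tau) v u)
  else
    (fun x => z0 x - 'i * synth (multiplier (inv_cjap c) z1) x,
     fun x => (z0 x)^* - 'i * synth (multiplier (inv_cjap c) (conj_distr z1)) x).

(* exp(-i tau Delta/2) exp(-tau i/8 (|u|^2 + 2|v|^2)) u *)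
Definition nls_step (tau : R) (u v : torus_fun) : torus_fun :=
  fmult (fun k => cexp ('i * (tau * (sqk k / 2))%:C)) (nl_flow tau u v).

Fixpoint nls_splitting (tau : R) (phi gamma : torus_fun) (n : nat)
    : torus_fun * torus_fun :=
  if n is m.+1 then
    let: (u, v) := nls_splitting tau phi gamma m in
    (nls_step tau u v, nls_step tau v u)
  else
    (fun x => phi x - 'i * gamma x,
     fun x => (phi x)^* - 'i * (gamma x)^*).

End torus.

Arguments torus_fun : clear implicits.
Arguments torus_distr : clear implicits.

(* Main.v *)
Require Import Defs.
From mathcomp Require Import all_boot all_order all_algebra.
From mathcomp Require Import complex.
From mathcomp Require Import all_classical all_reals all_analysis.
From mathcomp Require Import measurable_realfun ring lra.
Set Implicit Arguments.
Unset Strict Implicit.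
Unset Printing Implicit Defensive.
Import Order.TTheory GRing.Theory Num.Theory numFieldNormedType.Exports.
Local Open Scope classical_set_scope.
Local Open Scope complex_scope.
Local Open Scope ring_scope.

(* For s > d/2 the Sobolev balls of order s form an algebra, so each step of
   either scheme is the linear flow applied to u plus O(tau), with constants
   governed by the H^s norm of u.

   Write X_n, Y_n for the Fourier coefficients of u_*^n, u_{*,oo}^n and q_n for
   the symbol exp(i t_n (A_c - |k|^2/2)) comparing the two linear flows.  A
   term-by-term comparison of the linear steps would lose a factor 1/tau;
   instead one estimates X_n - q_n Y_n, for which both schemes are driven by the
   same linear flow.  One step then contributes tau c^-delta: the defect q_n - 1
   is of size c^-delta |k|^(2 delta) since t_n <= 1 and is only applied to the
   O(tau) increment of the smooth limit scheme, c/<nabla>_c - 1 is of size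
   c^-delta |k|^delta, and the oscillatory terms are O(1/(c^2 tau)), hence
   O(c^-delta) by the step size restriction.  Summing over n tau <= T and
   comparing q_n Y_n with Y_n once at the end gives the claim; smallness of T
   absorbs the Lipschitz constants.

   Functions are only given almost everywhere, so the nonlinearities can be
   computed on Fourier series only once an integrable function with absolutely
   summable coefficients is known to coincide a.e. with its Fourier series.
   This uniqueness is proved by showing that the functions with vanishing
   coefficients are stable under multiplication by trigonometric polynomials,
   by dominated convergence under restriction to half-spaces, and hence to all
   measurable sets. *)

(** * Complex numbers on the unit circle *)

Section complex_norm.
Context (R : realType).
Local Notation C := R[i].
Local Notation normc := (@Normc.normc R).
Implicit Types (x y z : C) (s t : R).

Lemma normc_ge0 z : 0 <= normc z.
Proof. by case: z => a b; exact: sqrtr_ge0. Qed.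

Lemma normc_normr z : (normc z)%:C = `|z|.
Proof. by case: z. Qed.

Lemma normc_sq z : normc z ^+ 2 = complex.Re z ^+ 2 + complex.Im z ^+ 2.
Proof. by case: z => a b; rewrite sqr_sqrtr ?addr_ge0 ?sqr_ge0. Qed.

Lemma le_Re_normc z : `|complex.Re z| <= normc z.
Proof.
by case: z => a b /=; rewrite -sqrtr_sqr ler_wsqrtr// lerDl sqr_ge0.
Qed.

Lemma le_Im_normc z : `|complex.Im z| <= normc z.
Proof.
by case: z => a b /=; rewrite -sqrtr_sqr ler_wsqrtr// lerDr sqr_ge0.
Qed.

Lemma normc_real t : normc t%:C = `|t|.
Proof. by rewrite /= expr0n/= addr0 sqrtr_sqr. Qed.

Lemma normc_conj z : normc z^* = normc z.
Proof. by rewrite -[z^*]/(conjc z); case: z => a b /=; rewrite sqrrN. Qed.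

Lemma normcB_sym x y : normc (x - y) = normc (y - x).
Proof. by rewrite -normcN opprB. Qed.

Lemma normcX z n : normc (z ^+ n) = normc z ^+ n.
Proof.
by elim: n => [|n ih]; rewrite ?expr0 ?Normc.normc1// !exprS Normc.normcM ih.
Qed.

Lemma normc_sum I (s : seq I) (P : pred I) (F : I -> C) :
  normc (\sum_(i <- s | P i) F i) <= \sum_(i <- s | P i) normc (F i).
Proof.
elim/big_ind2 : _ => [|x1 x2 y1 y2 h1 h2|//]; first by rewrite Normc.normc0.
by rewrite (le_trans (le_normcD _ _))// lerD.
Qed.

Lemma normc_le_ReIm z : normc z <= `|complex.Re z| + `|complex.Im z|.
Proof.
case: z => a b /=; rewrite -(ger0_norm (addr_ge0 (normr_ge0 a) (normr_ge0 b))).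
rewrite -sqrtr_sqr ler_wsqrtr// sqrrD !real_normK ?num_real//.
by rewrite lerD2r lerDl mulrn_wge0// mulr_ge0.
Qed.

Definition expi t : C := cos t +i* sin t.

Lemma cexp_imag t : cexp (0 +i* t) = expi t.
Proof. by rewrite /cexp /= expR0 mul1r. Qed.

Lemma cexp_i t : cexp ('i * t%:C) = expi t.
Proof. by rewrite -cexp_imag; congr cexp; simpc. Qed.

Lemma expi0 : expi 0 = 1.
Proof. by rewrite /expi cos0 sin0. Qed.

Lemma expiD s t : expi (s + t) = expi s * expi t.
Proof. by rewrite /expi cosD sinD; simpc; rewrite addrC (addrC (cos s * sin t)). Qed.

Lemma expiN t : expi (- t) = (expi t)^*.
Proof. by rewrite /expi cosN sinN. Qed.

Lemma normc_expi t : normc (expi t) = 1.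
Proof. by rewrite /= cos2Dsin2 sqrtr1. Qed.

Lemma abs_sin_le t : `|sin t| <= `|t|.
Proof.
have pos (x : R) : 0 <= x -> `|sin x| <= x.
  move=> x0.
  have dsin (y : R) : y \in `]0, x[ -> is_derive y 1 sin (cos y).
    by move=> _; exact: is_derive_sin.
  have csin : {within `[0, x], continuous (@sin R)}.
    by apply: continuous_subspaceT => y; exact: continuous_sin.
  have [c _] := MVT_segment x0 dsin csin.
  rewrite sin0 !subr0 => ->; rewrite normrM (ger0_norm x0) ler_piMl//.
  by rewrite ler_norml cos_geN1 cos_le1.
have [t0|t0] := leP 0 t; first by rewrite (ger0_norm t0) pos.
by rewrite (ltr0_norm t0) -normrN -sinN pos// oppr_ge0 ltW.
Qed.

Lemma normc_expiB1 t : normc (expi t - 1) = 2 * `|sin (t / 2)|.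
Proof.
apply/eqP; rewrite -(@eqrXn2 _ 2%N) ?normc_ge0 ?mulr_ge0//.
rewrite exprMn real_normK ?num_real// normc_sq /= subr0.
have := cos2Dsin2 t; have := cos2Dsin2 (t / 2).
have -> : cos t = cos (t / 2 + t / 2) by congr cos; field.
rewrite cosD => h1 h2; apply/eqP; lra.
Qed.

Lemma normc_expiB1_le t : normc (expi t - 1) <= `|t|.
Proof.
rewrite normc_expiB1; have := abs_sin_le (t / 2).
rewrite normrM (ger0_norm (_ : 0 <= 2^-1))//; lra.
Qed.

Lemma normc_expiB1_le2 t : normc (expi t - 1) <= 2.
Proof.
rewrite (le_trans (le_normcD _ _))// normcN Normc.normc1 normc_expi; lra.
Qed.

End complex_norm.

(** * Lebesgue measure on the cube *)

Lemma le_bounded_integrable d (T : measurableType d) (R : realType)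
    (mu : {measure set T -> \bar R}) (D : set T) (f : T -> R) (M : R) :
  measurable D -> (mu D < +oo)%E -> measurable_fun D f ->
  (forall x, D x -> `|f x| <= M) -> mu.-integrable D (EFin \o f).
Proof.
move=> mD Doo mf fM; apply/integrableP; split; first exact/measurable_EFinP.
apply: (@le_lt_trans _ _ (\int[mu]_(x in D) (cst (`|M|)%:E x))%E).
  apply: ge0_le_integral => //.
  - by do 2 apply: measurableT_comp => //; exact/measurable_EFinP.
  - by move=> x Dx; rewrite lee_fin (le_trans (fM x Dx))// ler_norm.
by rewrite integral_cst// lte_mul_pinfty.
Qed.

Section torus_measure.
Context (R : realType).
Local Notation X := (measurableTypeR R).

Lemma measurable_cube n : measurable (@cube R n).
Proof.
rewrite (_ : @cube R n =
    \bigcap_(i : 'I_n) (fun x => @tnth n X x i) @^-1` `[- pi, pi]%classic).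
  apply: fin_bigcap_measurable => // i _.
  by rewrite -[X in measurable X]setTI; apply: (measurable_tnth i).
apply/seteqP; split => x /= xD i; first by move=> _; rewrite /= in_itv/= xD.
by have := xD i I; rewrite /= in_itv.
Qed.

Arguments measurable_cube : clear implicits.

Lemma preimage_cube n :
  @tuple_cons R n @^-1` (@cube R n.+1) = `[- pi, pi] `*` @cube R n.
Proof.
apply/seteqP; split => -[x y] /=.
  move=> h; split => [|i]; first by have := h ord0; rewrite in_itv.
  by have := h (lift ord0 i); rewrite tnthS.
move=> [+ h] i; rewrite in_itv /= => hx.
by case: (unliftP ord0 i) => [j|] ->; rewrite ?tnthS ?tnth0.
Qed.

Lemma lebesgue_cube n : lebesgue_tuple R n (@cube R n) = ((2 * pi) ^+ n)%:E.
Proof.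
elim: n => [|n ih] /=.
  by rewrite diracE mem_set// => -[].
rewrite /lebesgue_cons/= /pushforward preimage_cube product_measure1E//; last first.
  exact: measurable_cube.
transitivity ((2 * pi)%:E * ((2 * pi) ^+ n)%:E : \bar R)%E.
  congr (_ * _)%E; last exact: ih.
  apply: etrans (@lebesgue_measure_itv R `[- pi, pi]) _.
  rewrite /= lte_fin gtrN ?pi_gt0// opprK -EFinD; congr EFin; ring.
by rewrite exprS EFinM.
Qed.


Lemma lebesgue_cube_lty n : (lebesgue_tuple R n (@cube R n) < +oo)%E.
Proof. by rewrite lebesgue_cube ltry. Qed.

Lemma integrable_cube_bounded n (f : n.-tuple X -> R) (M : R) :
  measurable_fun (@cube R n) f -> (forall x, cube x -> `|f x| <= M) ->
  (lebesgue_tuple R n).-integrable (@cube R n) (EFin \o f).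
Proof.
move=> mf fM; apply: le_bounded_integrable fM => //; first exact: measurable_cube.
exact: lebesgue_cube_lty.
Qed.

Lemma lebesgue_hyperplane n (i : 'I_n) (t : R) :
  lebesgue_tuple R n [set x | tnth x i = t] = 0%E.
Proof.
have mH m (j : 'I_m) : measurable [set x : m.-tuple X | tnth x j = t].
  rewrite -[X in measurable X]setTI.
  exact: (measurable_tnth j measurableT (measurable_set1 t)).
elim: n i => [[]//|n ih] i /=.
rewrite /lebesgue_cons/= /pushforward.
case: (unliftP ord0 i) => [j|] ->.
  rewrite (_ : _ @^-1` _ = setT `*` [set x : n.-tuple X | tnth x j = t]).
    rewrite product_measure1E//; last exact: mH.
    by apply: etrans (mule0 _); congr (_ * _)%E; exact: ih.
  by apply/seteqP; split => -[x y] /=; rewrite tnthS// => -[].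
rewrite (_ : _ @^-1` _ = [set t] `*` setT).
  rewrite product_measure1E//.
  apply: etrans (mul0e _); congr (_ * _)%E; exact: lebesgue_measure_set1.
by apply/seteqP; split => -[x y] /=; rewrite tnth0// => -[].
Qed.

Lemma Rintegral_cube_cons n (f : n.+1.-tuple X -> R) (M : R) :
  measurable_fun setT f -> (forall x, `|f x| <= M) ->
  Rintegral (lebesgue_tuple R n.+1) (@cube R n.+1) f =
  Rintegral (lebesgue_tuple R n) (@cube R n) (fun y =>
    Rintegral lebesgue_measure `[- pi, pi] (fun x => f (tuple_cons (x, y)))).
Proof.
move=> mf fM; rewrite /Rintegral; congr fine.
have mI : measurable (`[- pi, pi]%classic : set X) by [].
pose P := (`[- pi, pi]%classic : set X) `*` @cube R n.
have mP : measurable P.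
  by apply: measurableX => //; exact: measurable_cube.
pose m1 : {sigma_finite_measure set X -> \bar R} := lebesgue_measure.
pose m2 := lebesgue_tuple R n.
have mfc : measurable_fun setT (f \o @tuple_cons R n).
  by apply: measurableT_comp => //; exact: measurable_tuple_cons.
have Poo : ((m1 \x m2) P < +oo)%E.
  by rewrite /P -preimage_cube; exact: lebesgue_cube_lty n.+1.
have intP : (m1 \x m2)%E.-integrable (@tuple_cons R n @^-1` @cube R n.+1)
   ((EFin \o f) \o @tuple_cons R n).
  rewrite preimage_cube.
  apply: (@le_bounded_integrable _ _ _ _ _ (f \o @tuple_cons R n) M mP Poo).
    exact: measurable_funTS.
  by move=> x _; exact: fM.
have mfE : measurable_fun setT (EFin \o f) by exact/measurable_EFinP.
have H := integral_pushforward (@measurable_tuple_cons R n) mfE intP (measurable_cube n.+1).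
transitivity (\int[m1 \x m2]_(x in @tuple_cons R n @^-1` @cube R n.+1)
   ((EFin \o f) \o @tuple_cons R n) x)%E.
  refine (eq_trans _ H). reflexivity.
rewrite preimage_cube [LHS]integral_mkcond.
have intP' : (m1 \x m2)%E.-integrable setT
    (((EFin \o f) \o @tuple_cons R n) \_ P).
  by rewrite -integrable_mkcond// /P -preimage_cube.
apply: (eq_trans (esym (integral21_prod_meas1 intP'))).
rewrite /fubini_G.
rewrite [RHS]integral_mkcond; apply: eq_integral => y _.
rewrite [RHS]patchE; case: ifPn => yD.
  rewrite fineK; last first.
    apply: integrable_fin_num => //.
    apply: (@le_bounded_integrable _ _ _ _ _ _ M) => //.
      apply: (@le_lt_trans _ _ ((pi + pi)%:E : \bar R)); last exact: ltry.
      rewrite le_eqVlt; apply/orP; left; apply/eqP.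
      apply: etrans (@lebesgue_measure_itv R `[- pi, pi]) _.
      by rewrite /= lte_fin gtrN ?pi_gt0// opprK.
    apply/measurable_funTS.
    by apply: (measurableT_comp mfc); exact: measurable_pair2.
  rewrite [RHS]integral_mkcond; apply: eq_integral => x _.
  by rewrite !patchE in_setX yD andbT.
rewrite integral0_eq// => x _.
by rewrite patchE in_setX (negbTE yD) andbF.
Qed.

End torus_measure.

Section cos_integral.
Context (R : realType).
Local Notation X := (measurableTypeR R).

Lemma sin_intpi (m : int) : sin (m%:~R * pi) = 0 :> R.
Proof.
have sin_natpi (n : nat) : sin (n%:R * pi) = 0 :> R.
  rewrite mulr_natl -[pi *+ n]add0r (alternatingn (@sinDpi R)) sin0 mulr0//.
by case: m => n; rewrite ?NegzE ?mulrNz ?mulNr ?sinN; rewrite sin_natpi ?oppr0.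
Qed.

Lemma is_derive_sin_affine (m th x : R) : m != 0 ->
  is_derive x 1 (fun y : R => sin (m * y + th) / m) (cos (m * x + th)).
Proof.
move=> m0.
have h1 : is_derive x 1 (fun y : R => m * y + th) m.
  by apply: is_derive_eq; rewrite addr0 -[LHS]/(m * 1) mulr1.
have h2 := @is_derive1_comp R sin (fun y : R => m * y + th) x _ _
  (is_derive_sin _) h1.
have h3 := @is_deriveZ R R R (sin \o (fun y : R => m * y + th)) m^-1 x 1 _ h2.
rewrite (_ : (fun y => _) = m^-1 \*: (sin \o (fun y : R => m * y + th))).
  by apply: is_derive_eq; rewrite -[LHS]/(m^-1 * (cos (m * x + th) * m)) mulrC mulfK.
by apply/funext => y /=; rewrite mulrC.
Qed.

Lemma Rintegral_cos_affine (m : int) (th : R) :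
  Rintegral lebesgue_measure `[- pi, pi] (fun x : R => cos (m%:~R * x + th)) =
  (2 * pi) * (m == 0)%:R * cos th.
Proof.
have pp : - pi < pi :> R by rewrite gtrN ?pi_gt0.
have [->|m0] := eqVneq m 0.
  under eq_Rintegral do rewrite mul0r add0r.
  rewrite Rintegral_cst//.
  rewrite [X in fine X](_ : _ = (pi + pi)%:E)/=; first by ring.
  apply: etrans (@lebesgue_measure_itv R `[- pi, pi]) _.
  by rewrite /= lte_fin pp opprK.
rewrite mulr0 mul0r.
have mR0 : m%:~R != 0 :> R by rewrite intr_eq0.
pose F (x : R) := sin (m%:~R * x + th) / m%:~R.
have dF (x : R) : is_derive x 1 F (cos (m%:~R * x + th)) by exact: is_derive_sin_affine.
have cF : continuous F.
  move=> x; apply: differentiable_continuous; apply/derivable1_diffP.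
  by have := dF x; case.
rewrite /Rintegral (@continuous_FTC2 _ _ F)//.
- rewrite /F !sinD mulrN sinN cosN !sin_intpi; rewrite oppr0 !mul0r !add0r.
  by rewrite subee.
- apply: continuous_subspaceT => x.
  apply: continuous_comp; last exact: continuous_cos.
  apply: cvgD; last exact: cvg_cst.
  by apply: cvgM; [exact: cvg_cst|exact: cvg_id].
- split.
  + by move=> x _; case: (dF x).
  + by apply: cvg_at_right_filter; exact: cF.
  + by apply: cvg_at_left_filter; exact: cF.
- by move=> x _; rewrite derive1E; case: (dF x).
Qed.

Lemma measurable_phase n (k : 'I_n -> int) (th : R) :
  measurable_fun setT (fun x : n.-tuple X =>
    cos (\sum_(i < n) (k i)%:~R * tnth x i + th)).
Proof.
apply: measurableT_comp; first by apply: continuous_measurable_fun; exact: continuous_cos.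
apply: measurable_funD => //.
apply: measurable_sum => i.
by apply: measurable_funM => //; exact: measurable_tnth.
Qed.

Lemma Rintegral_cos_phase n (k : 'I_n -> int) (th : R) :
  Rintegral (lebesgue_tuple R n) (@cube R n) (fun x =>
    cos (\sum_(i < n) (k i)%:~R * tnth x i + th)) =
  (2 * pi) ^+ n * [forall i, k i == 0]%:R * cos th.
Proof.
elim: n k th => [|n ih] k th.
  rewrite expr0 mul1r (_ : [forall i, _] = true) ?mul1r; last first.
    by apply/forallP => -[].
  under eq_Rintegral do rewrite big_ord0 add0r.
  rewrite Rintegral_cst; last exact: measurable_cube.
  by rewrite [X in fine X](_ : _ = 1%:E) ?mulr1//; exact: (lebesgue_cube R 0).
rewrite (@Rintegral_cube_cons _ _ _ 1); first last.
- by move=> x; rewrite ler_norml cos_geN1 cos_le1.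
- exact: measurable_phase.
transitivity (Rintegral (lebesgue_tuple R n) (@cube R n) (fun y =>
    (2 * pi) * (k ord0 == 0)%:R *
    cos (\sum_(i < n) (k (lift ord0 i))%:~R * tnth y i + th))).
  apply: eq_Rintegral => y _; apply: etrans (Rintegral_cos_affine (k ord0) _).
  apply: eq_Rintegral => x _; rewrite big_ord_recl tnth0 -addrA.
  by under eq_bigr do rewrite tnthS.
rewrite RintegralZl; first last.
- apply: (@integrable_cube_bounded _ _ _ 1).
    by apply: measurable_funTS; exact: measurable_phase.
  by move=> x _; rewrite ler_norml cos_geN1 cos_le1.
- exact: measurable_cube.
rewrite ih exprS.
have -> : [forall i, k i == 0] = (k ord0 == 0) && [forall i, k (lift ord0 i) == 0].
  apply/forallP/andP => [h|[k0 /forallP kS] i].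
    by split; [exact: h|apply/forallP => j; exact: h].
  by case: (unliftP ord0 i) => [j|] ->.
by rewrite -mulnb natrM; ring.
Qed.

End cos_integral.

(** * Complex-valued integrals on the torus *)

Section complex_limit.
Context (R : realType).
Local Notation C := R[i].
Local Notation normc := (@Normc.normc R).
Implicit Types (u v : nat -> C) (l m : C).

Definition ccvg u l := normc (u n - l) @[n --> \oo] --> (0 : R).

Lemma squeeze_to0 (a b : nat -> R) : (forall n, 0 <= a n <= b n) ->
  b n @[n --> \oo] --> (0 : R) -> a n @[n --> \oo] --> (0 : R).
Proof.
move=> ab b0; apply: (squeeze_cvgr (f := cst 0) (h := b)) => //.
- by apply: nearW => n; exact: ab.
- exact: cvg_cst.
Qed.

Lemma cvg_norm_sub (a : nat -> R) (b : R) :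
  a n @[n --> \oo] --> b <-> `|a n - b| @[n --> \oo] --> (0 : R).
Proof.
split=> [h|/norm_cvg0P h]; last exact: cvg_sub0 h (cvg_cst _).
by apply/norm_cvg0P; rewrite -(subrr b); apply: cvgB h (cvg_cst _).
Qed.

Lemma ccvg_cst l : ccvg (fun=> l) l.
Proof. by rewrite /ccvg subrr Normc.normc0; exact: cvg_cst. Qed.

Lemma ccvgP u l : ccvg u l <->
  complex.Re (u n) @[n --> \oo] --> complex.Re l /\
  complex.Im (u n) @[n --> \oo] --> complex.Im l.
Proof.
split=> [ul|[rl il]].
  have cv (p : C -> R) : (forall x y, p (x - y) = p x - p y) ->
      (forall x, `|p x| <= normc x) -> p (u n) @[n --> \oo] --> p l.
    move=> pB pn; apply: (cvg_norm_sub _ _).2.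
    by apply: squeeze_to0 ul => n; rewrite normr_ge0/= -pB pn.
  split; apply: cv.
  - by move=> [? ?] [? ?].
  - exact: le_Re_normc.
  - by move=> [? ?] [? ?].
  - exact: le_Im_normc.
have r0 : `|complex.Re (u n) - complex.Re l| + `|complex.Im (u n) - complex.Im l|
    @[n --> \oo] --> (0 : R).
  by rewrite -[X in _ --> X]addr0; apply: cvgD; apply: (cvg_norm_sub _ _).1.
apply: squeeze_to0 r0 => n; rewrite normc_ge0/=.
rewrite (le_trans (normc_le_ReIm _))//.
by move: (u n) => [a b]; case: (l) => [c e].
Qed.

Lemma ccvg_unique u l m : ccvg u l -> ccvg u m -> l = m.
Proof.
move=> /ccvgP[r1 i1] /ccvgP[r2 i2]; move: l m r1 r2 i1 i2 => [a b] [c e] /= r1 r2 i1 i2.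
by congr Complex; [exact: (cvg_unique _ r1 r2)|exact: (cvg_unique _ i1 i2)].
Qed.

Lemma ccvgZ z u l : ccvg u l -> ccvg (fun n => z * u n) (z * l).
Proof.
move=> ul; rewrite /ccvg.
rewrite (_ : (fun n => _) = fun n => normc z * normc (u n - l)).
  by rewrite -(mulr0 (normc z)); apply: cvgM ul; exact: cvg_cst.
by apply/funext => n; rewrite -mulrBr Normc.normcM.
Qed.

Lemma ccvg_normc u l : ccvg u l -> normc (u n) @[n --> \oo] --> normc l.
Proof.
move=> ul; apply: (cvg_norm_sub _ _).2; apply: squeeze_to0 ul => n; rewrite normr_ge0/=.
rewrite ler_norml; apply/andP; split.
  rewrite lerNl opprB lerBlDr normcB_sym (le_trans _ (le_normcD _ _))//.
  by rewrite subrK.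
by rewrite lerBlDr (le_trans _ (le_normcD _ _))// subrK.
Qed.

End complex_limit.

Section torus_integral.
Context (R : realType) (d : nat).
Local Notation C := R[i].
Local Notation normc := (@Normc.normc R).
Local Notation mu := (lebesgue_tuple R d).
Local Notation D := (@cube R d).
Implicit Types (f g : torus_fun R d) (z : C).

Definition Cmeasurable f := measurable_fun D (fun x => complex.Re (f x)) /\
  measurable_fun D (fun x => complex.Im (f x)).

Definition Cintegrable f := mu.-integrable D (fun x => (complex.Re (f x))%:E) /\
  mu.-integrable D (fun x => (complex.Im (f x))%:E).

Lemma Cintegrable_measurable f : Cintegrable f -> Cmeasurable f.
Proof.
by move=> [/integrableP[/measurable_EFinP ? _] /integrableP[/measurable_EFinP ? _]].
Qed.

Lemma Cmeasurable_cst z : Cmeasurable (fun=> z).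
Proof. by split. Qed.

Lemma CmeasurableD f g : Cmeasurable f -> Cmeasurable g ->
  Cmeasurable (fun x => f x + g x).
Proof.
move=> [rf mf] [rg mg]; split.
  apply: (eq_measurable_fun (fun x => complex.Re (f x) + complex.Re (g x))).
    by move=> x _; case: (f x) (g x) => [? ?] [? ?].
  exact: measurable_funD.
apply: (eq_measurable_fun (fun x => complex.Im (f x) + complex.Im (g x))).
  by move=> x _; case: (f x) (g x) => [? ?] [? ?].
exact: measurable_funD.
Qed.

Lemma CmeasurableM f g : Cmeasurable f -> Cmeasurable g ->
  Cmeasurable (fun x => f x * g x).
Proof.
move=> [rf mf] [rg mg]; split.
  apply: (eq_measurable_fun (fun x => complex.Re (f x) * complex.Re (g x) -
      complex.Im (f x) * complex.Im (g x))).
    by move=> x _; case: (f x) (g x) => [? ?] [? ?].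
  by apply: measurable_funB; exact: measurable_funM.
apply: (eq_measurable_fun (fun x => complex.Re (f x) * complex.Im (g x) +
    complex.Im (f x) * complex.Re (g x))).
  by move=> x _; case: (f x) (g x) => [? ?] [? ?].
by apply: measurable_funD; exact: measurable_funM.
Qed.

Lemma Cintegrable_le f (h : _ -> R) : Cmeasurable f ->
  mu.-integrable D (EFin \o h) -> (forall x, D x -> normc (f x) <= h x) ->
  Cintegrable f.
Proof.
move=> [rf mf] ih fh; have mD := @measurable_cube R d.
split; apply: (le_integrable mD _ _ ih) => //; try exact/measurable_EFinP.
  move=> x Dx; rewrite lee_fin (le_trans (le_Re_normc _))//.
  by rewrite (le_trans (fh x Dx))// ler_norm.
move=> x Dx; rewrite lee_fin (le_trans (le_Im_normc _))//.
by rewrite (le_trans (fh x Dx))// ler_norm.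
Qed.

Lemma Cintegrable_bounded f (M : R) : Cmeasurable f ->
  (forall x, D x -> normc (f x) <= M) -> Cintegrable f.
Proof.
move=> mf fM; apply: (Cintegrable_le (h := cst M) mf) => //.
by apply: (@integrable_cube_bounded _ _ _ `|M|).
Qed.

Lemma integrable_ReIm f : Cintegrable f -> mu.-integrable D
  (EFin \o (fun x => `|complex.Re (f x)| + `|complex.Im (f x)|)).
Proof.
move=> [rf mf]; have mD := @measurable_cube R d.
exact: (integrableD mD (integrable_norm rf) (integrable_norm mf)).
Qed.

Lemma CintegrableMr f g (M : R) : Cmeasurable f ->
  (forall x, D x -> normc (f x) <= M) -> Cintegrable g ->
  Cintegrable (fun x => f x * g x).
Proof.
move=> mf fM ig; have mD := @measurable_cube R d.
apply: (Cintegrable_le (h := fun x => `|M| * (`|complex.Re (g x)| + `|complex.Im (g x)|))).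
- exact: CmeasurableM (Cintegrable_measurable ig).
- exact: (integrableZl mD `|M| (integrable_ReIm ig)).
- move=> x Dx; rewrite Normc.normcM ler_pM ?normc_ge0//.
    by rewrite (le_trans (fM x Dx))// ler_norm.
  exact: normc_le_ReIm.
Qed.

Lemma CintegrableD f g : Cintegrable f -> Cintegrable g ->
  Cintegrable (fun x => f x + g x).
Proof.
move=> [rf mf] [rg mg]; have mD := @measurable_cube R d; split.
  apply: eq_integrable (integrableD mD rf rg) => // x _.
  by rewrite -EFinD; case: (f x) (g x) => [? ?] [? ?].
apply: eq_integrable (integrableD mD mf mg) => // x _.
by rewrite -EFinD; case: (f x) (g x) => [? ?] [? ?].
Qed.

Lemma CintegrableZ z f : Cintegrable f -> Cintegrable (fun x => z * f x).
Proof. by apply: (@CintegrableMr _ _ (normc z)); [exact: Cmeasurable_cst|]. Qed.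

Lemma CintegrableJ f : Cintegrable f -> Cintegrable (fun x => (f x)^*).
Proof.
move=> [rf mf]; have mD := @measurable_cube R d; split.
  by apply: eq_integrable rf => // x _; case: (f x).
apply: eq_integrable (integrableN mf) => // x _ /=.
by case: (f x).
Qed.

Lemma Cintegrable_ae f g : Cmeasurable f -> Cintegrable g ->
  {ae mu, forall x, D x -> f x = g x} -> Cintegrable f.
Proof.
move=> [rf mf] [rg mg] fg; have mD := @measurable_cube R d.
have key (p : C -> R) : measurable_fun D (fun x => p (f x)) ->
    mu.-integrable D (fun x => (p (g x))%:E) ->
    mu.-integrable D (fun x => (p (f x))%:E).
  move=> mp /integrableP[mpg ipg]; apply/integrableP.
  split; first exact/measurable_EFinP.
  rewrite (ae_eq_integral (fun x => `|(p (g x))%:E|)%E)//.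
  - by apply: measurableT_comp => //; exact/measurable_EFinP.
  - exact: measurableT_comp.
  - by move: fg; apply: filterS => x h Dx; rewrite h.
by split; exact: key.
Qed.

Lemma CintegralD f g : Cintegrable f -> Cintegrable g ->
  Cintegral (fun x => f x + g x) = Cintegral f + Cintegral g.
Proof.
move=> [rf mf] [rg mg]; have mD := @measurable_cube R d.
rewrite /Cintegral; simpc; congr Complex.
  rewrite -RintegralD//; apply: eq_Rintegral => x _.
  by case: (f x) (g x) => [? ?] [? ?].
rewrite -RintegralD//; apply: eq_Rintegral => x _.
by case: (f x) (g x) => [? ?] [? ?].
Qed.

Lemma CintegralZ z f : Cintegrable f ->
  Cintegral (fun x => z * f x) = z * Cintegral f.
Proof.
move=> [rf mf]; have mD := @measurable_cube R d.
rewrite /Cintegral; case: z => a b; simpc.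
have iZ (t : R) (h : d.-tuple (measurableTypeR R) -> R) :
    mu.-integrable D (fun x => (h x)%:E) ->
    mu.-integrable D (EFin \o (fun x => t * h x)).
  by move=> ih; apply: eq_integrable (integrableZl mD t ih).
congr Complex.
  rewrite -!RintegralZl// -RintegralB//; try exact: iZ.
  by apply: eq_Rintegral => x _; case: (f x).
rewrite -!RintegralZl// -RintegralD//; try exact: iZ.
by apply: eq_Rintegral => x _; case: (f x).
Qed.

Lemma CintegralJ f : Cintegrable f -> Cintegral (fun x => (f x)^*) = (Cintegral f)^*.
Proof.
move=> [rf mf]; have mD := @measurable_cube R d.
rewrite /Cintegral; simpc; congr Complex.
  by apply: eq_Rintegral => x _; case: (f x).
rewrite -mulN1r -RintegralZl//; apply: eq_Rintegral => x _.
by rewrite mulN1r; case: (f x).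
Qed.

Lemma eq_Cintegral f g : (forall x, D x -> f x = g x) -> Cintegral f = Cintegral g.
Proof.
move=> fg; rewrite /Cintegral; congr Complex.
  by apply: eq_Rintegral => x /set_mem Dx; rewrite fg.
by apply: eq_Rintegral => x /set_mem Dx; rewrite fg.
Qed.

Lemma Cintegral_ae f g : Cmeasurable f -> Cmeasurable g ->
  {ae mu, forall x, D x -> f x = g x} -> Cintegral f = Cintegral g.
Proof.
move=> [rf mf] [rg mg] fg; have mD := @measurable_cube R d.
rewrite /Cintegral /Rintegral; congr Complex; congr fine.
  apply: ae_eq_integral => //; try exact/measurable_EFinP.
  by move: fg; apply: filterS => x h Dx; rewrite h.
apply: ae_eq_integral => //; try exact/measurable_EFinP.
by move: fg; apply: filterS => x h Dx; rewrite h.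
Qed.

Lemma Cdominated_convergence (f_ : nat -> torus_fun R d) f (h : _ -> R) :
  (forall n, Cmeasurable (f_ n)) -> Cmeasurable f ->
  {ae mu, forall x, D x -> ccvg (f_ ^~ x) (f x)} ->
  mu.-integrable D (EFin \o h) ->
  {ae mu, forall x n, D x -> normc (f_ n x) <= h x} ->
  Cintegrable f /\ ccvg (fun n => Cintegral (f_ n)) (Cintegral f).
Proof.
move=> mf_ mf ff ih fh; have mD := @measurable_cube R d.
have key (p : C -> R) : (forall z, `|p z| <= normc z) ->
    (forall u l, ccvg u l -> p (u n) @[n --> \oo] --> p l) ->
    (forall n, measurable_fun D (fun x => p (f_ n x))) ->
    measurable_fun D (fun x => p (f x)) ->
    mu.-integrable D (fun x => (p (f x))%:E) /\
    Rintegral mu D (fun x => p (f_ n x)) @[n --> \oo] --> Rintegral mu D (fun x => p (f x)).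
  move=> pn pc mpf_ mpf.
  have [] := @dominated_convergence _ _ _ mu D mD
    (fun n x => (p (f_ n x))%:E) (fun x => (p (f x))%:E) (EFin \o h).
  - by move=> n; exact/measurable_EFinP.
  - exact/measurable_EFinP.
  - move: ff; apply: filterS => x hx Dx.
    by apply: cvg_EFin; [exact: nearW|apply: pc; exact: hx].
  - exact: ih.
  - move: fh; apply: filterS => x hx n Dx.
    by rewrite lee_fin (le_trans (pn _))// hx.
  move=> ipf _ cpf; split=> //; apply: fine_cvg.
  by rewrite fineK//; exact: integrable_fin_num.
have [ir cr] := key (@complex.Re R) (@le_Re_normc R)
  (fun u l => fun h => (iffLR (ccvgP u l) h).1) (fun n => (mf_ n).1) mf.1.
have [ii ci] := key (@complex.Im R) (@le_Im_normc R)
  (fun u l => fun h => (iffLR (ccvgP u l) h).2) (fun n => (mf_ n).2) mf.2.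
by split=> //; apply/ccvgP; split.
Qed.

End torus_integral.

Section fourier_coefficients.
Context (R : realType) (d : nat).
Local Notation C := R[i].
Local Notation normc := (@Normc.normc R).
Local Notation mu := (lebesgue_tuple R d).
Local Notation D := (@cube R d).
Implicit Types (f g : torus_fun R d) (z : C) (j k : 'rV[int]_d).
Implicit Types x : d.-tuple (measurableTypeR R).

Definition ek k : torus_fun R d := fun x => expi (dotk k x).

Lemma dotkD j k x : dotk (j + k) x = dotk j x + dotk k x :> R.
Proof.
rewrite /dotk -big_split/=; apply: eq_bigr => i _.
by rewrite mxE intrD mulrDl.
Qed.

Lemma dotkN k x : dotk (- k) x = - dotk k x :> R.
Proof.
by rewrite /dotk -sumrN; apply: eq_bigr => i _; rewrite mxE intrN mulNr.
Qed.

Lemma ekD j k x : ek (j + k) x = ek j x * ek k x.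
Proof. by rewrite /ek dotkD expiD. Qed.

Lemma ek0 x : ek 0 x = 1.
Proof.
rewrite /ek (_ : dotk 0 x = 0) ?expi0//.
by rewrite /dotk big1// => i _; rewrite mxE mul0r.
Qed.

Lemma ekN k x : ek (- k) x = (ek k x)^*.
Proof. by rewrite /ek dotkN expiN. Qed.

Lemma normc_ek k x : normc (ek k x) = 1.
Proof. exact: normc_expi. Qed.

Lemma Cmeasurable_ek k : Cmeasurable (ek k).
Proof.
have m th : measurable_fun D (fun x => cos (dotk k x + th)).
  by apply: measurable_funTS; exact: measurable_phase.
split; first by have := m 0; under eq_fun do rewrite addr0.
have := m (- (pi / 2)); apply: eq_measurable_fun => x _ /=.
by rewrite cosBpihalf.
Qed.

Lemma Cintegrable_ek k : Cintegrable (ek k).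
Proof.
apply: (@Cintegrable_bounded _ _ _ 1); first exact: Cmeasurable_ek.
by move=> x _; rewrite normc_ek.
Qed.

Lemma Cintegral_ek k : Cintegral (ek k) = ((2 * pi) ^+ d)%:C * (k == 0)%:R.
Proof.
have k0 : [forall i, k 0 i == 0] = (k == 0).
  apply/forallP/eqP => [h|-> i]; last by rewrite mxE.
  by apply/rowP => i; rewrite mxE; exact/eqP.
have I th : Rintegral mu D (fun x => cos (dotk k x + th)) =
    (2 * pi) ^+ d * (k == 0)%:R * cos th.
  by rewrite -k0; exact: Rintegral_cos_phase.
rewrite /Cintegral (_ : Rintegral _ _ _ = (2 * pi) ^+ d * (k == 0)%:R); last first.
  by have := I 0; rewrite cos0 mulr1 => <-; apply: eq_Rintegral => x _; rewrite addr0.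
rewrite (_ : Rintegral _ _ _ = 0); last first.
  have := I (- (pi / 2)); rewrite cosN cos_pihalf mulr0 => <-.
  apply: eq_Rintegral => x _ /=.
  by rewrite cosBpihalf.
by case: eqP => _; simpc; rewrite ?mulr1 ?mulr0.
Qed.

Definition cube_inv : C := ((2 * pi) ^+ d)^-1%:C.

Lemma fourierE f k : fourier f k = cube_inv * Cintegral (fun x => f x * ek (- k) x).
Proof.
rewrite /fourier; congr (_ * _); congr Cintegral; apply/funext => x.
congr (_ * _); rewrite /ek dotkN -cexp_i; congr cexp.
by rewrite rmorphN mulrN.
Qed.

Lemma Cintegrable_shift f k : Cintegrable f -> Cintegrable (fun x => f x * ek k x).
Proof.
move=> fi; rewrite (_ : (fun x => _) = fun x => ek k x * f x).
  apply: (@CintegrableMr _ _ _ _ 1) => //; first exact: Cmeasurable_ek.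
  by move=> x _; rewrite normc_ek.
by apply/funext => x; rewrite mulrC.
Qed.

Lemma fourierD f g k : Cintegrable f -> Cintegrable g ->
  fourier (fun x => f x + g x) k = fourier f k + fourier g k.
Proof.
move=> fi gi; rewrite !fourierE -mulrDr; congr (_ * _).
rewrite -CintegralD; try exact: Cintegrable_shift.
by apply: eq_Cintegral => x _; rewrite mulrDl.
Qed.

Lemma fourierZ z f k : Cintegrable f ->
  fourier (fun x => z * f x) k = z * fourier f k.
Proof.
move=> fi; rewrite !fourierE mulrCA; congr (_ * _).
rewrite -CintegralZ; last exact: Cintegrable_shift.
by apply: eq_Cintegral => x _; rewrite mulrA.
Qed.

Lemma fourierB f g k : Cintegrable f -> Cintegrable g ->
  fourier (fun x => f x - g x) k = fourier f k - fourier g k.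
Proof.
move=> fi gi; rewrite -mulN1r -fourierZ// -fourierD//; last exact: CintegrableZ.
by congr (fourier _ k); apply/funext => x; rewrite mulN1r.
Qed.

Lemma fourier_sum I (s : seq I) (F : I -> torus_fun R d) k :
  (forall i, Cintegrable (F i)) ->
  Cintegrable (fun x => \sum_(i <- s) F i x) /\
  fourier (fun x => \sum_(i <- s) F i x) k = \sum_(i <- s) fourier (F i) k.
Proof.
move=> iF; elim: s => [|i s [ih1 ih2]].
  have Z : @Cintegrable R d (fun=> 0) by apply: (@Cintegrable_bounded _ _ _ 0);
    [exact: Cmeasurable_cst|move=> x _; rewrite Normc.normc0].
  under eq_fun do rewrite big_nil; split=> //.
  rewrite big_nil -[RHS](mul0r (fourier (fun=> 0 : C) k)) -(fourierZ 0 k Z).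
  by congr (fourier _ k); apply/funext => x; rewrite mul0r.
under eq_fun do rewrite big_cons; split; first exact: CintegrableD.
by rewrite fourierD// big_cons ih2.
Qed.

Lemma fourierJ f k : Cintegrable f ->
  fourier (fun x => (f x)^*) k = (fourier f (- k))^*.
Proof.
move=> fi; rewrite !fourierE rmorphM/=; congr (_ * _).
  by rewrite /cube_inv; apply/esym/CrealP; rewrite complex_real.
rewrite -CintegralJ; last exact: Cintegrable_shift.
by apply: eq_Cintegral => x _; rewrite rmorphM/= opprK ekN.
Qed.

Lemma fourier_shift f j k : fourier (fun x => f x * ek j x) k = fourier f (k - j).
Proof.
rewrite !fourierE; congr (_ * _); apply: eq_Cintegral => x _.
by rewrite -mulrA -ekD opprB.
Qed.

Lemma fourier_ek j k : fourier (ek j) k = (j == k)%:R.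
Proof.
rewrite fourierE (_ : (fun x => _) = ek (j - k)).
  rewrite Cintegral_ek subr_eq0 mulrA /cube_inv -rmorphM/= mulVf ?mul1r//.
  by rewrite expf_neq0// mulf_neq0// gt_eqF// pi_gt0.
by apply/funext => x; rewrite -ekD.
Qed.

Lemma fourier_ae f g : Cmeasurable f -> Cmeasurable g ->
  {ae mu, forall x, D x -> f x = g x} -> fourier f = fourier g.
Proof.
move=> mf mg fg; apply/funext => k; rewrite !fourierE; congr (_ * _).
apply: Cintegral_ae.
- exact: CmeasurableM mf (Cmeasurable_ek _).
- exact: CmeasurableM mg (Cmeasurable_ek _).
- by move: fg; apply: filterS => x h Dx; rewrite h.
Qed.

Lemma fourier_dominated_convergence (f_ : nat -> torus_fun R d) f (h : _ -> R) :
  (forall n, Cmeasurable (f_ n)) -> Cmeasurable f ->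
  {ae mu, forall x, D x -> ccvg (f_ ^~ x) (f x)} ->
  mu.-integrable D (EFin \o h) ->
  {ae mu, forall x n, D x -> normc (f_ n x) <= h x} ->
  Cintegrable f /\ forall k, ccvg (fun n => fourier (f_ n) k) (fourier f k).
Proof.
move=> mf_ mf ff ih fh.
have [fi _] := Cdominated_convergence mf_ mf ff ih fh; split=> // k.
rewrite fourierE; under eq_fun do rewrite fourierE.
apply: ccvgZ; apply: (Cdominated_convergence _ _ _ ih _).2.
- by move=> n; exact: CmeasurableM (mf_ n) (Cmeasurable_ek _).
- exact: CmeasurableM mf (Cmeasurable_ek _).
- move: ff; apply: filterS => x hx Dx; under eq_fun do rewrite mulrC.
  by rewrite mulrC; exact/ccvgZ/hx.
- move: fh; apply: filterS => x hx n Dx.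
  by rewrite Normc.normcM normc_ek mulr1; exact: hx.
Qed.

End fourier_coefficients.

(** * Uniqueness of Fourier coefficients *)

Section step_approximation.
Context (R : realType).
Implicit Types (y t u : R).

(* Brosowski--Deutsch polynomials: on [0, 1] they converge to the indicator of
   y < 1/2 away from y = 1/2. *)
Definition step_poly n y : R := (1 - y ^+ n) ^+ (2 ^ n).

Lemma bernoulli (a : R) m : 0 <= a <= 1 -> 1 - m%:R * a <= (1 - a) ^+ m.
Proof.
move=> /andP[a0 a1]; elim: m => [|m ih]; first by rewrite mul0r subr0 expr0.
rewrite exprSr; apply: (@le_trans _ _ ((1 - m%:R * a) * (1 - a))).
  have : 0 <= m%:R * (a * a) by rewrite mulr_ge0// mulr_ge0.
  rewrite -natr1; lra.
by rewrite ler_wpM2r// subr_ge0.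
Qed.

Lemma bernoulli_inv (a : R) m : 0 <= a <= 1 -> (1 - a) ^+ m * (m%:R * a) <= 1.
Proof.
move=> /andP[a0 a1]; have b0 : 0 <= 1 - a by rewrite subr_ge0.
suff : (1 - a) ^+ m * (1 + m%:R * a) <= 1.
  by apply: le_trans; rewrite ler_wpM2l ?exprn_ge0// lerDr.
elim: m => [|m ih]; first by rewrite expr0 mul0r addr0 mul1r.
apply: le_trans ih; rewrite exprSr -mulrA ler_wpM2l ?exprn_ge0//.
have : 0 <= m%:R * (a * a) by rewrite mulr_ge0// mulr_ge0.
have : 0 <= a * a by rewrite mulr_ge0.
rewrite -natr1; lra.
Qed.

Lemma step_poly_bound n y : 0 <= y <= 1 -> 0 <= step_poly n y <= 1.
Proof.
move=> /andP[y0 y1]; have h : 0 <= 1 - y ^+ n by rewrite subr_ge0 exprn_ile1.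
by rewrite exprn_ge0//= exprn_ile1// gerBl exprn_ge0.
Qed.

Lemma cvg_step_poly y : 0 <= y <= 1 -> y != 1 / 2 ->
  step_poly n y @[n --> \oo] --> ((y < 1 / 2)%R%:R : R).
Proof.
move=> y01 yN; have /andP[y0 y1] := y01.
have yn n : 0 <= y ^+ n <= 1 by rewrite exprn_ge0//= exprn_ile1.
case: (boolP (y < 1 / 2)) => [ylt|]; last first.
  rewrite -leNgt le_eqVlt eq_sym (negbTE yN)/= => ygt.
  have h : (1 / (2 * y)) ^+ n @[n --> \oo] --> (0 : R).
    apply: cvg_expr; rewrite ger0_norm ?divr_ge0// ?mulr_ge0//.
    by rewrite ltr_pdivrMr; lra.
  apply: (squeeze_to0 _ h) => n.
  have /andP[-> _] /= := step_poly_bound n y01.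
  have yp : 0 < (2 * y) ^+ n by rewrite exprn_gt0//; lra.
  rewrite expr_div_n expr1n ler_pdivlMr//.
  rewrite exprMn -natrX; exact: bernoulli_inv.
have h : (2 * y) ^+ n @[n --> \oo] --> (0 : R).
  by apply: cvg_expr; rewrite ger0_norm; lra.
apply/cvg_norm_sub; apply: (squeeze_to0 _ h) => n; rewrite normr_ge0/=.
have /andP[_ h1] := step_poly_bound n y01.
rewrite ler0_norm ?subr_le0// opprB.
have := bernoulli (2 ^ n) (yn n); rewrite natrX -exprMn /step_poly; lra.
Qed.

Definition ray t u : R := sin u * cos (t / 2) - (1 + cos u) * sin (t / 2).

Lemma rayE t u : ray t u = 2 * sin ((u - t) / 2) * cos (u / 2).
Proof.
have -> : (u - t) / 2 = u / 2 - t / 2 by field.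
have E : u = u / 2 + u / 2 by field.
rewrite /ray {1 2}E sinD cosD sinD cosN sinN.
have := cos2Dsin2 (u / 2); set c := cos _; set s := sin _.
set c' := cos _; set s' := sin _ => h.
have -> : 1 + (c * c - s * s) = 2 * c * c by lra.
ring.
Qed.

Lemma ray_bound t u : `|ray t u| <= 2.
Proof.
rewrite rayE !normrM (ger0_norm (ler0n R 2))// -[leRHS]mulr1 -mulrA ler_wpM2l//.
by rewrite mulr_ile1// ler_norml ?sin_geN1 ?sin_le1 ?cos_geN1 ?cos_le1.
Qed.

Lemma ray_gt0 t u : - pi <= t < pi -> - pi < u < pi -> u != t ->
  ray t u != 0 /\ (0 < ray t u) = (t < u).
Proof.
move=> /andP[t1 t2] /andP[u1 u2] ut; rewrite rayE.
have c0 : 0 < cos (u / 2) by apply: cos_gt0_pihalf; lra.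
move: ut; rewrite neq_lt => /orP[ut|tu].
  have s0 : 0 < sin ((t - u) / 2) by apply: sin_gt0_pi; lra.
  have E : sin ((u - t) / 2) = - sin ((t - u) / 2).
    by rewrite -sinN; congr sin; field.
  have n0 : 2 * sin ((u - t) / 2) * cos (u / 2) < 0.
    by rewrite E mulrN mulNr oppr_lt0 !mulr_gt0.
  by rewrite lt_eqF// (lt_gtF n0) (lt_gtF ut).
have s0 : 0 < sin ((u - t) / 2) by apply: sin_gt0_pi; lra.
have p0 : 0 < 2 * sin ((u - t) / 2) * cos (u / 2) by rewrite !mulr_gt0.
by rewrite gt_eqF// p0 tu.
Qed.

End step_approximation.
Section fourier_uniqueness.
Context (R : realType) (d : nat).
Local Notation C := R[i].
Local Notation X := (measurableTypeR R).
Local Notation normc := (@Normc.normc R).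
Local Notation mu := (lebesgue_tuple R d).
Local Notation D := (@cube R d).
Implicit Types (f g : torus_fun R d) (phi psi : d.-tuple X -> R).

Definition fourier_null f := Cintegrable f /\ forall k, fourier f k = 0.

Lemma fourier_nullD f g : fourier_null f -> fourier_null g ->
  fourier_null (fun x => f x + g x).
Proof.
move=> [fi f0] [gi g0]; split; first exact: CintegrableD.
by move=> k; rewrite fourierD// f0 g0 addr0.
Qed.

Lemma fourier_nullZ (z : C) f : fourier_null f -> fourier_null (fun x => z * f x).
Proof.
move=> [fi f0]; split; first exact: CintegrableZ.
by move=> k; rewrite fourierZ// f0 mulr0.
Qed.

Lemma fourier_null_shift f k : fourier_null f ->
  fourier_null (fun x => f x * ek k x).
Proof.
move=> [fi f0]; split; first exact: Cintegrable_shift.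
by move=> j; rewrite fourier_shift f0.
Qed.

Definition null_multiplier phi := forall f, fourier_null f ->
  fourier_null (fun x => f x * (phi x)%:C).

Lemma eq_null_multiplier phi psi : phi =1 psi -> null_multiplier phi ->
  null_multiplier psi.
Proof. by move=> /funext ->. Qed.

Lemma null_multiplier_cst (c : R) : null_multiplier (fun=> c).
Proof. by move=> f /(fourier_nullZ c%:C); under eq_fun do rewrite mulrC. Qed.

Lemma null_multiplierD phi psi : null_multiplier phi -> null_multiplier psi ->
  null_multiplier (fun x => phi x + psi x).
Proof.
move=> p q f f0; have := fourier_nullD (p f f0) (q f f0).
by under eq_fun do rewrite -mulrDr -rmorphD.
Qed.

Lemma null_multiplierM phi psi : null_multiplier phi -> null_multiplier psi ->
  null_multiplier (fun x => phi x * psi x).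
Proof.
move=> p q f f0; have := q _ (p f f0).
by under eq_fun do rewrite -mulrA -rmorphM.
Qed.

Lemma null_multiplierX phi n : null_multiplier phi ->
  null_multiplier (fun x => phi x ^+ n).
Proof.
move=> p; elim: n => [|n ih]; first exact: null_multiplier_cst.
by under [X in null_multiplier X]eq_fun do rewrite exprS; exact: null_multiplierM.
Qed.

Lemma null_multiplier1B phi : null_multiplier phi ->
  null_multiplier (fun x => 1 - phi x).
Proof.
move=> p; apply: null_multiplierD; first exact: null_multiplier_cst.
apply: (@eq_null_multiplier (fun x => -1 * phi x)); first by move=> x; rewrite mulN1r.
exact/null_multiplierM/p/null_multiplier_cst.
Qed.

Lemma dotk_delta (i : 'I_d) (x : d.-tuple X) : dotk (delta_mx 0 i) x = tnth x i.
Proof.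
rewrite /dotk (bigD1 i)//= mxE !eqxx mul1r big1 ?addr0// => j ji.
by rewrite mxE (negbTE ji) mul0r.
Qed.

Lemma null_multiplier_cos (i : 'I_d) :
  null_multiplier (fun x => cos (tnth x i)).
Proof.
move=> f f0.
have := fourier_nullZ (2^-1 : R)%:C (fourier_nullD (fourier_null_shift (delta_mx 0 i) f0)
  (fourier_null_shift (- delta_mx 0 i) f0)).
congr fourier_null; apply/funext => x.
rewrite -mulrDr mulrCA ekN /ek dotk_delta; congr (_ * _).
by rewrite /expi; simpc; congr Complex; lra.
Qed.

Lemma null_multiplier_sin (i : 'I_d) :
  null_multiplier (fun x => sin (tnth x i)).
Proof.
move=> f f0.
have := fourier_nullZ (0 +i* (- 2^-1)) (fourier_nullD (fourier_null_shift (delta_mx 0 i) f0)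
  (fourier_nullZ (-1) (fourier_null_shift (- delta_mx 0 i) f0))).
congr fourier_null; apply/funext => x.
rewrite [X in _ + X]mulrCA -mulrDr mulrCA ekN /ek dotk_delta; congr (_ * _).
by rewrite mulN1r /expi; simpc; congr Complex; lra.
Qed.

Lemma null_multiplier_lim (phi_ : nat -> d.-tuple X -> R) phi :
  (forall n, null_multiplier (phi_ n)) -> measurable_fun D phi ->
  (forall n x, `|phi_ n x| <= 1) ->
  (forall n, measurable_fun D (phi_ n)) ->
  {ae mu, forall x, D x -> phi_ n x @[n --> \oo] --> phi x} ->
  null_multiplier phi.
Proof.
move=> p mphi b mp cp f f0; have [fi fk] := f0.
have mC (psi : d.-tuple X -> R) : measurable_fun D psi -> Cmeasurable (fun x => (psi x)%:C).
  by move=> mpsi; split => //; exact: measurable_cst.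
have [|||||iF cF] := @fourier_dominated_convergence R d
  (fun n x => f x * (phi_ n x)%:C) (fun x => f x * (phi x)%:C)
  (fun x => `|complex.Re (f x)| + `|complex.Im (f x)|).
- by move=> n; apply: CmeasurableM (mC _ (mp n)); exact: Cintegrable_measurable.
- by apply: CmeasurableM (mC _ mphi); exact: Cintegrable_measurable.
- move: cp; apply: filterS => x hx Dx; apply: ccvgZ; apply/ccvgP; split => //=.
    exact: hx.
  exact: cvg_cst.
- exact: integrable_ReIm.
- apply: aeW => x n _; rewrite Normc.normcM normc_real -[leRHS]mulr1.
  by rewrite ler_pM ?normc_ge0// normc_le_ReIm.
split=> // k; apply: (@ccvg_unique _ (fun=> 0)); last exact: ccvg_cst.
by have := cF k; under eq_fun do rewrite (p _ f f0).2.
Qed.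

Lemma null_multiplier_cube phi psi : measurable_fun D psi ->
  (forall x, D x -> phi x = psi x) -> (forall x, `|phi x| <= 1) ->
  null_multiplier phi -> null_multiplier psi.
Proof.
move=> mpsi e b p; apply: (@null_multiplier_lim (fun=> phi)) => //.
- move=> _; apply: eq_measurable_fun mpsi => x /set_mem Dx; exact/esym/e.
- by apply: aeW => x Dx; rewrite e//; exact: cvg_cst.
Qed.

Lemma measurable_ray (t : R) (i : 'I_d) :
  measurable [set x : d.-tuple X | t < tnth x i].
Proof.
rewrite -[X in measurable X]setTI.
have -> : [set x : d.-tuple X | t < tnth x i] = (fun x => tnth x i) @^-1` `]t, +oo[.
  by apply/seteqP; split=> x /=; rewrite in_itv/= andbT.
by apply: (measurable_tnth i).
Qed.

Lemma ae_tnth_neq (t : R) (i : 'I_d) : {ae mu, forall x, tnth x i != t}.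
Proof.
exists [set x | tnth x i = t]; split.
- rewrite -[X in measurable X]setTI.
  exact: (measurable_tnth i measurableT (measurable_set1 t)).
- exact: lebesgue_hyperplane.
- by move=> x /= /negP; rewrite negbK => /eqP.
Qed.

Lemma null_multiplier_ray (t : R) (i : 'I_d) :
  null_multiplier \1_[set x : d.-tuple X | t < tnth x i].
Proof.
have mI : measurable_fun D (\1_[set x : d.-tuple X | t < tnth x i] : _ -> R).
  by apply: measurable_indic; exact: measurable_ray.
have [tpi|pit] := leP pi t.
  apply: (@null_multiplier_cube (fun=> 0)) => //; last exact: null_multiplier_cst.
    move=> x /(_ i)/andP[_ xpi]; rewrite indicE memNset//=.
    by apply/negP; rewrite -leNgt (le_trans xpi).
  by move=> _; rewrite normr0.
have [tmpi|mpit] := ltP t (- pi).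
  apply: (@null_multiplier_cube (fun=> 1)) => //; last exact: null_multiplier_cst.
    by move=> x /(_ i)/andP[xpi _]; rewrite indicE mem_set//=; exact: lt_le_trans xpi.
  by move=> _; rewrite normr1.
pose y (x : d.-tuple X) := 1 / 2 + - 4^-1 * ray t (tnth x i).
have y01 x : 0 <= y x <= 1.
  have := ray_bound t (tnth x i); rewrite ler_norml /y => /andP[]; lra.
have my : measurable_fun D y.
  have mt : measurable_fun D (fun x => tnth x i).
    by apply: measurable_funTS; exact: measurable_tnth.
  have mc : measurable_fun D (fun x => cos (tnth x i)).
    by apply: measurableT_comp mt; apply: continuous_measurable_fun; exact: continuous_cos.
  have ms : measurable_fun D (fun x => sin (tnth x i)).
    by apply: measurableT_comp mt; apply: continuous_measurable_fun; exact: continuous_sin.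
  apply: measurable_funD => //; apply: measurable_funM => //.
  apply: measurable_funB; first exact: measurable_funM.
  by apply: measurable_funM => //; exact: measurable_funD.
have ny : null_multiplier y.
  apply: null_multiplierD; first exact: null_multiplier_cst.
  apply: null_multiplierM; first exact: null_multiplier_cst.
  apply: null_multiplierD.
    by apply: null_multiplierM; [exact: null_multiplier_sin|exact: null_multiplier_cst].
  apply: (@eq_null_multiplier (fun x => (1 + cos (tnth x i)) * - sin (t / 2))).
    by move=> x; rewrite mulrN.
  apply: null_multiplierM; last exact: null_multiplier_cst.
  by apply: null_multiplierD; [exact: null_multiplier_cst|exact: null_multiplier_cos].
apply: (@null_multiplier_lim (fun n x => step_poly n (y x))) => //.
- by move=> n; exact/null_multiplierX/null_multiplier1B/null_multiplierX.
- move=> n x; have /andP[h0 h1] := step_poly_bound n (y01 x).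
  by rewrite ger0_norm.
- move=> n; apply: measurable_funX; apply: measurable_funB => //.
  exact: measurable_funX.
- apply: (@filterS3 _ _ (ae_filter_ringOfSetsType mu) _ _ _ _ _
    (ae_tnth_neq (- pi) i) (ae_tnth_neq pi i) (ae_tnth_neq t i)) => x x1 x2 x3 /(_ i)/andP[xl xr].
  have [r0 rp] : ray t (tnth x i) != 0 /\ (0 < ray t (tnth x i)) = (t < tnth x i).
    by apply: ray_gt0 => //; rewrite ?mpit ?pit// !lt_neqAle xl xr x2 eq_sym x1.
  have -> : \1_[set x : d.-tuple X | t < tnth x i] x = (t < tnth x i)%R%:R :> R.
    rewrite indicE; congr (_%:R); congr nat_of_bool.
    by apply/idP/idP => [/set_mem|h]; [|exact: mem_set].
  rewrite -rp.
  have -> : (0 < ray t (tnth x i)) = (y x < 1 / 2) by rewrite /y; apply/idP/idP; lra.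
  apply: cvg_step_poly => //; apply: contra r0 => /eqP; rewrite /y => h; apply/eqP; lra.
Qed.

Lemma null_multiplierC (A : set (d.-tuple X)) : null_multiplier \1_A ->
  null_multiplier \1_(~` A).
Proof.
move=> /null_multiplier1B; apply: eq_null_multiplier => x.
by rewrite !indicE in_setC; case: (x \in A); rewrite ?subr0 ?subrr.
Qed.

Lemma null_multiplierI (A B : set (d.-tuple X)) : null_multiplier \1_A ->
  null_multiplier \1_B -> null_multiplier \1_(A `&` B).
Proof.
move=> a b; apply: eq_null_multiplier (null_multiplierM a b) => x.
by rewrite !indicE in_setI -natrM mulnb.
Qed.

Lemma null_multiplier_measurable (A : set (d.-tuple X)) :
  measurable A -> null_multiplier \1_A.
Proof.
pose G := [set A : set (d.-tuple X) | measurable A /\ null_multiplier \1_A].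
suff : measurable `<=` G by move=> h /h [].
have G0 : G set0.
  split; first exact: measurable0.
  by rewrite indic0; exact: null_multiplier_cst.
have GC B : G B -> G (~` B).
  by move=> [mB nB]; split; [exact: measurableC|exact: null_multiplierC].
have GU (B : nat -> set (d.-tuple X)) : (forall n, G (B n)) -> G (\bigcup_k B k).
  move=> GB; rewrite -[X in G X]setCK; apply: (GC).
  rewrite setC_bigcup.
  pose I n := \bigcap_(k < n) ~` B k.
  have GI n : G (I n).
    elim: n => [|n [mI nI]]; first by rewrite /I bigcap_mkord big_ord0 -setC0; exact: GC.
    have [mC nC] := GC _ (GB n).
    have -> : I n.+1 = I n `&` ~` B n by rewrite /I !bigcap_mkord big_ord_recr.
    by split; [exact: measurableI|exact: null_multiplierI].
  have mB : measurable (\bigcap_k ~` B k).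
    by apply: bigcapT_measurable => k; exact: (GC _ (GB k)).1.
  split=> //; apply: (@null_multiplier_lim (fun n => \1_(I n))).
  - by move=> n; exact: (GI n).2.
  - exact: measurable_indic.
  - by move=> n x; rewrite indicE; case: (_ \in _); rewrite ?normr1 ?normr0.
  - by move=> n; apply: measurable_indic; exact: (GI n).1.
  - apply: aeW => x _; rewrite indicE.
    have [xB|xB] := boolP (x \in \bigcap_k ~` B k).
      apply: cvg_near_cst; apply: nearW => n; rewrite indicE mem_set//.
      by move=> k _; move/set_mem : xB; exact.
    move: xB; rewrite notin_setE => /existsNP[k /not_implyP[_ xBk]].
    apply: cvg_near_cst; exists k.+1 => // n /= kn; rewrite indicE memNset//.
    by apply: contra_not xBk; apply.
apply: smallest_sub.
  by split => //= B /GC; rewrite setTD.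
elim/big_ind : _ => //.
- by move=> P Q PG QG B [/PG|/QG].
- move=> i _ _ [B mB <-]; rewrite setTI.
  suff : measurable `<=` [set B : set X | G ((fun x => tnth x i) @^-1` B)].
    exact.
  apply: smallest_sub.
    split => /=.
    + by rewrite preimage_set0.
    + by move=> E /GC; rewrite setTD preimage_setC.
    + by move=> E /GU; rewrite preimage_bigcup.
  move=> _ [[a b] _ <-] /=.
  rewrite (_ : _ @^-1` _ = [set x | a < tnth x i] `&` ~` [set x | b < tnth x i]).
    split.
      apply: measurableI; first exact: measurable_ray.
      by apply: measurableC; exact: measurable_ray.
    apply: null_multiplierI; first exact: null_multiplier_ray.
    by apply: null_multiplierC; exact: null_multiplier_ray.
  apply/seteqP; split => x /=; rewrite in_itv/=.
    by move=> /andP[-> h]; split => //; apply/negP; rewrite -leNgt.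
  by move=> [-> /negP]; rewrite -leNgt.
Qed.

Lemma fourier_null_ae0 f : fourier_null f -> {ae mu, forall x, D x -> f x = 0}.
Proof.
move=> f0; have [fi _] := f0; have mD := @measurable_cube R d.
have [[rf mf] [mrf mmf]] := (fi, Cintegrable_measurable fi).
have I0 (A : set (d.-tuple X)) : measurable A ->
    Rintegral mu D (fun x => complex.Re (f x) * \1_A x) = 0 /\
    Rintegral mu D (fun x => complex.Im (f x) * \1_A x) = 0.
  move=> mA; have [_ /(_ 0)] := null_multiplier_measurable mA f0.
  rewrite fourierE => /eqP; rewrite mulf_eq0 => /orP[|].
    have pn : (2 * pi) ^+ d != 0 :> R by rewrite expf_neq0// mulf_neq0// gt_eqF// pi_gt0.
    by rewrite /cube_inv -[0]/(0%:C) (inj_eq (@complexI R)) invr_eq0 (negbTE pn).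
  rewrite /Cintegral => /eqP[re im]; split.
    rewrite -[RHS]re; apply: eq_Rintegral => x _.
    by rewrite oppr0 ek0 mulr1; case: (f x) => a b /=; rewrite mulr0 subr0.
  rewrite -[RHS]im; apply: eq_Rintegral => x _.
  by rewrite oppr0 ek0 mulr1; case: (f x) => a b /=; rewrite mulr0 add0r.
have key (h : d.-tuple X -> R) : measurable_fun D h ->
    mu.-integrable D (EFin \o h) ->
    (forall A, measurable A -> Rintegral mu D (fun x => h x * \1_A x) = 0) ->
    {ae mu, forall x, D x -> h x = 0}.
  move=> mh ih h0.
  pose P := D `&` h @^-1` `]0, +oo[.
  have mP : measurable P by exact: mh.
  have E x : D x -> `|h x| = h x * \1_P x - h x * \1_(~` P) x.
    move=> Dx; rewrite !indicE in_setC; have [h1|h1] := ltP 0 (h x).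
      rewrite mem_set/= ?mulr1 ?mulr0 ?subr0 ?gtr0_norm//.
      by split => //=; rewrite in_itv/= h1.
    rewrite memNset/= ?mulr1 ?mulr0 ?sub0r ?ler0_norm// => -[_].
    by rewrite /= in_itv/= andbT ltNge h1.
  have ihI (A : set (d.-tuple X)) : measurable A ->
      mu.-integrable D (EFin \o (fun x => h x * \1_A x)).
    move=> mA; apply: (le_integrable mD _ _ ih).
      by apply/measurable_EFinP; apply: measurable_funM => //; exact: measurable_indic.
    move=> x Dx /=; rewrite lee_fin normrM indicE ler_piMr//.
    by case: (_ \in _); rewrite ?normr1 ?normr0.
  have nz : Rintegral mu D (fun x => `|h x|) = 0.
    transitivity (Rintegral mu D (fun x => h x * \1_P x - h x * \1_(~` P) x)).
      by apply: eq_Rintegral => x /set_mem; exact: E.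
    rewrite RintegralB//; first by rewrite !h0 ?subr0//; exact: measurableC.
    - exact: ihI.
    - by apply: ihI; exact: measurableC.
  have : (\int[mu]_(x in D) `|(h x)%:E| = 0)%E.
    rewrite -[LHS]fineK; first exact: congr1 nz.
    by apply: integrable_fin_num => //; exact: integrable_norm.
  have mhE : measurable_fun D (EFin \o h) by exact/measurable_EFinP.
  move=> /(ae_eq_integral_abs mu mD mhE).
  by apply: filterS => x hx Dx; have [] := hx Dx.
have re0 := key _ mrf rf (fun A mA => (I0 A mA).1).
have im0 := key _ mmf mf (fun A mA => (I0 A mA).2).
apply: (@filterS2 _ _ (ae_filter_ringOfSetsType mu) _ _ _ _ re0 im0) => x hr hi Dx.
by move: (hr Dx) (hi Dx); case: (f x) => a b /= -> ->.
Qed.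

Lemma fourier_inj_ae f g : Cintegrable f -> Cintegrable g ->
  fourier f = fourier g -> {ae mu, forall x, D x -> f x = g x}.
Proof.
move=> fi gi fg.
have : fourier_null (fun x => f x + -1 * g x).
  split; first exact/CintegrableD/CintegrableZ.
  move=> k; rewrite fourierD ?fourierZ//; last exact: CintegrableZ.
  by rewrite fg mulN1r subrr.
move=> /fourier_null_ae0; apply: filterS => x h Dx.
by apply/eqP; rewrite -subr_eq0 -mulN1r; apply/eqP/h.
Qed.

End fourier_uniqueness.

(** * Absolutely summable Fourier series *)

Section summation.
Context (R : realType).

Lemma le_sum_subset (I : eqType) (F G : seq I) (a : I -> R) :
  uniq F -> uniq G -> {subset F <= G} -> (forall i, 0 <= a i) ->
  \sum_(i <- F) a i <= \sum_(i <- G) a i.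
Proof.
move=> uF uG FG a0.
have FG' : perm_eq [seq i <- G | i \in F] F.
  apply: uniq_perm => //; first exact: filter_uniq.
  by move=> i; rewrite mem_filter; case: (boolP (i \in F)) => //= /FG ->.
by rewrite -(perm_big _ FG')/= big_filter [leRHS](bigID (mem F))/= lerDl sumr_ge0.
Qed.

Lemma sum_cauchy_schwarz (I : Type) (s : seq I) (a b : I -> R) :
  (\sum_(i <- s) a i * b i) ^+ 2 <=
  (\sum_(i <- s) a i ^+ 2) * (\sum_(i <- s) b i ^+ 2).
Proof.
set P := \sum_(i <- s) _; set A := \sum_(i <- s) _; set B := \sum_(i <- s) _.
have B0 : 0 <= B by apply: sumr_ge0 => i _; exact: sqr_ge0.
have h t u : 0 <= t ^+ 2 * A - 2 * t * u * P + u ^+ 2 * B.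
  have -> : t ^+ 2 * A - 2 * t * u * P + u ^+ 2 * B =
      \sum_(i <- s) (t * a i - u * b i) ^+ 2.
    rewrite /A /P /B !mulr_sumr -sumrB -big_split/=; apply: eq_bigr => i _; ring.
  by apply: sumr_ge0 => i _; exact: sqr_ge0.
move: B0; rewrite le_eqVlt => /orP[/eqP B0|B0].
  have P0 : P ^+ 2 <= 0.
    have := h P (A + 1); rewrite -B0.
    have A0 : 0 <= A by apply: sumr_ge0 => i _; exact: sqr_ge0.
    have := mulr_ge0 A0 (sqr_ge0 P); lra.
  by rewrite -B0 mulr0.
have := h B P; rewrite (_ : _ + _ = B * (A * B - P ^+ 2)); last by ring.
by rewrite pmulr_rge0// subr_ge0.
Qed.

Lemma sum_cauchy_schwarz_le (I : Type) (s : seq I) (a b : I -> R) (A B : R) :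
  0 <= A -> 0 <= B -> \sum_(i <- s) a i ^+ 2 <= A ^+ 2 ->
  \sum_(i <- s) b i ^+ 2 <= B ^+ 2 -> \sum_(i <- s) a i * b i <= A * B.
Proof.
move=> A0 B0 hA hB; rewrite (le_trans (ler_norm _))//.
rewrite -ler_sqr ?nnegrE ?mulr_ge0// real_normK ?num_real// exprMn.
rewrite (le_trans (sum_cauchy_schwarz s a b))// ler_pM//;
  by apply: sumr_ge0 => i _; exact: sqr_ge0.
Qed.

Lemma cvg_le_bound (u : nat -> R) (l b : R) : u n @[n --> \oo] --> l ->
  (forall n, u n <= b) -> l <= b.
Proof.
move=> ul ub; rewrite -(cvg_lim (@Rhausdorff R) ul).
by apply: limr_le; [exact: cvgP ul|exact: nearW].
Qed.

Section countable.
Context (K : countType).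
Implicit Types (F : seq K) (a : K -> R).

Definition enumK n : seq K := pmap (@pickle_inv K) (iota 0 n).

Lemma enumK_uniq n : uniq (enumK n).
Proof. exact: (pmap_uniq (@pickle_invK K)) (iota_uniq 0 n). Qed.

Lemma mem_enumK n k : (k \in enumK n) = (pickle k < n)%N.
Proof.
rewrite mem_pmap; apply/mapP/idP => [[m]|kn]; last first.
  by exists (pickle k); [rewrite mem_iota|rewrite pickleK_inv].
rewrite mem_iota/= add0n => mn mk.
by move: (@pickle_invK K m) mk; case: (pickle_inv m) => //= j jm [->]; rewrite jm.
Qed.

Lemma subset_enumK F : exists N, forall n, (N <= n)%N -> {subset F <= enumK n}.
Proof.
exists (\max_(k <- F) (pickle k).+1)%N => n Nn k kF.
rewrite mem_enumK; apply: leq_trans Nn.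
by rewrite (@leq_bigmax_seq _ _ xpredT (fun k => (pickle k).+1)).
Qed.

Definition l1_bound (B : R) a := forall F, uniq F -> \sum_(k <- F) `|a k| <= B.

Lemma esum_ge_seq a F : (forall k, 0 <= a k) -> uniq F ->
  ((\sum_(k <- F) a k)%:E <= \esum_(k in setT) (a k)%:E)%E.
Proof.
move=> a0 uF; apply: ereal_sup_ubound; exists [set` F] => //.
  by split => //; exact: finite_seq.
rewrite fsbig_finite//=.
rewrite -sumEFin; apply: perm_big; apply: uniq_perm; [exact: finmap.fset_uniq|by []|].
by move=> k; rewrite in_fset_set ?mem_setE//; exact: finite_seq.
Qed.

Lemma esum_le_seq a (B : R) : (forall F, uniq F -> \sum_(k <- F) a k <= B) ->
  (\esum_(k in setT) (a k)%:E <= B%:E)%E.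
Proof.
move=> aB; rewrite /esum; apply: ge_ereal_sup => _ [A [fA _] <-].
by rewrite fsbig_finite//= sumEFin lee_fin aB// finmap.fset_uniq.
Qed.

Lemma cvg_sum_enumK_ge0 a (B : R) : (forall k, 0 <= a k) ->
  (forall F, uniq F -> \sum_(k <- F) a k <= B) ->
  \sum_(k <- enumK n) a k @[n --> \oo] --> fine (\esum_(k in setT) (a k)%:E).
Proof.
move=> a0 aB.
have fin : (\esum_(k in setT) (a k)%:E \is a fin_num)%E.
  rewrite ge0_fin_numE; first exact: le_lt_trans (esum_le_seq aB) (ltry _).
  by apply: esum_ge0 => k _; rewrite lee_fin.
set S := fine _.
have le_S F : uniq F -> \sum_(k <- F) a k <= S.
  by move=> uF; rewrite -lee_fin fineK//; exact: esum_ge_seq.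
apply/cvgrPdist_le => e e0.
have [_ [A [fA _] <-]] := ub_ereal_sup_adherent e0 fin.
rewrite -[ereal_sup _]/(\esum_(k in setT) (a k)%:E)%E -(fineK fin) -/S.
rewrite fsbig_finite//= sumEFin -EFinB lte_fin => hA.
have [N hN] := subset_enumK (finmap.enum_fset (fset_set A)).
exists N => // n /= Nn.
have h1 := le_S _ (enumK_uniq n).
have h2 := le_sum_subset (finmap.fset_uniq (fset_set A)) (enumK_uniq n) (hN n Nn) a0.
by rewrite ger0_norm ?subr_ge0// lerBlDr -lerBlDl; lra.
Qed.

Lemma sum_maxr0_le a (F : seq K) : \sum_(k <- F) Num.max (a k) 0 <= \sum_(k <- F) `|a k|.
Proof. by apply: ler_sum => k _; rewrite ge_max normr_ge0 ler_norm. Qed.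

End countable.
End summation.

Section torus_series.
Context (R : realType) (d : nat).
Local Notation C := R[i].
Local Notation K := ('rV[int]_d).
Local Notation normc := (@Normc.normc R).
Local Notation enumK := (@enumK K).
Implicit Types (a b : torus_distr R d) (x : d.-tuple (measurableTypeR R)).

Lemma cvg_Rsum (u : K -> R) (B : R) : l1_bound B u ->
  \sum_(k <- enumK n) u k @[n --> \oo] --> Rsum u.
Proof.
move=> uB.
have pos (v : K -> R) : l1_bound B v -> \sum_(k <- enumK n) Num.max (v k) 0 @[n --> \oo] -->
    fine (\esum_(k in setT) (Num.max (v k) 0)%:E).
  move=> vB; apply: (@cvg_sum_enumK_ge0 _ _ _ B) => [k|F uF].
    by rewrite le_max lexx orbT.
  exact: le_trans (sum_maxr0_le _ _) (vB F uF).
have uBN : l1_bound B (fun k => - u k).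
  by move=> F /uB; under eq_bigr do rewrite -normrN.
rewrite (_ : (fun n => _) = fun n => \sum_(k <- enumK n) Num.max (u k) 0 -
    \sum_(k <- enumK n) Num.max (- u k) 0); first exact: cvgB (pos _ uB) (pos _ uBN).
apply/funext => n; rewrite -sumrB; apply: eq_bigr => k _.
have [u0|] := boolP (0 <= u k).
  by rewrite (max_idPl u0) (max_idPr _) ?subr0// oppr_le0.
rewrite -ltNge => u0.
have nu0 : 0 <= - u k by rewrite oppr_ge0 ltW.
by rewrite (max_idPr (ltW u0)) (max_idPl nu0) sub0r opprK.
Qed.

Definition summable_by (B : R) a := forall F : seq K, uniq F ->
  \sum_(k <- F) normc (a k) <= B.

Lemma ccvg_Csum a (B : R) : summable_by B a ->
  ccvg (fun n => \sum_(k <- enumK n) a k) (Csum a).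
Proof.
move=> aB; apply/ccvgP; split.
  under eq_fun do rewrite (raddf_sum (@complex.Re R : Rcomplex R -> R)).
  apply: (@cvg_Rsum _ B) => F /aB; apply: le_trans.
  by apply: ler_sum => k _; exact: le_Re_normc.
under eq_fun do rewrite (raddf_sum (@complex.Im R : Rcomplex R -> R)).
apply: (@cvg_Rsum _ B) => F /aB; apply: le_trans.
by apply: ler_sum => k _; exact: le_Im_normc.
Qed.

Definition partial_synth a n : torus_fun R d := fun x =>
  \sum_(k <- enumK n) a k * ek k x.

Lemma ccvg_synth a (B : R) x : summable_by B a ->
  ccvg (fun n => partial_synth a n x) (synth a x).
Proof.
move=> aB; rewrite /synth /partial_synth.
have E k : a k * cexp ('i * (dotk k x)%:C) = a k * ek k x by rewrite cexp_i.
rewrite (_ : (fun k => _) = fun k => a k * ek k x); last exact/funext.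
apply: (@ccvg_Csum _ B) => F /aB; apply: le_trans.
by apply: ler_sum => k _; rewrite Normc.normcM normc_ek mulr1.
Qed.

Lemma partial_synth_le a (B : R) n x : summable_by B a ->
  normc (partial_synth a n x) <= B.
Proof.
move=> aB; apply: le_trans (aB _ (enumK_uniq _ n)).
apply: le_trans (normc_sum _ _ _) _.
by apply: ler_sum => k _; rewrite Normc.normcM normc_ek mulr1.
Qed.

Lemma synth_le a (B : R) x : summable_by B a -> normc (synth a x) <= B.
Proof.
move=> aB; have /ccvg_normc h := ccvg_synth x aB.
by apply: cvg_le_bound h _ => n; exact: partial_synth_le.
Qed.

Lemma Cmeasurable_partial_synth a n : Cmeasurable (partial_synth a n).
Proof.
rewrite /partial_synth; elim: (enumK n) => [|k s ih].
  by under eq_fun do rewrite big_nil; exact: Cmeasurable_cst.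
under eq_fun do rewrite big_cons; apply: CmeasurableD => //.
by apply: CmeasurableM; [exact: Cmeasurable_cst|exact: Cmeasurable_ek].
Qed.

Lemma Cmeasurable_lim (f_ : nat -> torus_fun R d) (f : torus_fun R d) :
  (forall n, Cmeasurable (f_ n)) -> (forall x, ccvg (f_ ^~ x) (f x)) -> Cmeasurable f.
Proof.
move=> mf cf; split.
  apply: (@measurable_fun_cvg _ _ R (@cube R d) (fun n x => complex.Re (f_ n x))).
    by move=> n; exact: (mf n).1.
  by move=> x _; have /ccvgP[] := cf x.
apply: (@measurable_fun_cvg _ _ R (@cube R d) (fun n x => complex.Im (f_ n x))).
  by move=> n; exact: (mf n).2.
by move=> x _; have /ccvgP[] := cf x.
Qed.

Lemma Cintegrable_synth a (B : R) : summable_by B a -> Cintegrable (synth a).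
Proof.
move=> aB; apply: (@Cintegrable_bounded _ _ _ B); last by move=> x _; exact: synth_le.
apply: (Cmeasurable_lim (Cmeasurable_partial_synth a)) => x.
exact: ccvg_synth aB.
Qed.

Lemma ccvg_fourier_synthM a (B : R) (g : torus_fun R d) k : summable_by B a ->
  Cintegrable g ->
  ccvg (fun n => \sum_(j <- enumK n) a j * fourier g (k - j))
       (fourier (fun x => synth a x * g x) k).
Proof.
move=> aB gi.
have sm : Cmeasurable (synth a) := Cintegrable_measurable (Cintegrable_synth aB).
have gm := Cintegrable_measurable gi.
have [|||||_ cF] := @fourier_dominated_convergence R d
  (fun n x => partial_synth a n x * g x) (fun x => synth a x * g x)
  (fun x => `|B| * (`|complex.Re (g x)| + `|complex.Im (g x)|)).
- by move=> n; exact/CmeasurableM/gm/Cmeasurable_partial_synth.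
- exact: CmeasurableM.
- apply: aeW => x Dx; under eq_fun do rewrite mulrC.
  by rewrite mulrC; exact/ccvgZ/(ccvg_synth x aB).
- exact: (integrableZl (@measurable_cube R d) `|B| (integrable_ReIm gi)).
- apply: aeW => x n Dx; rewrite Normc.normcM ler_pM ?normc_ge0 ?normc_le_ReIm//.
  exact: le_trans (partial_synth_le n x aB) (ler_norm _).
have := cF k; congr ccvg; apply/funext => n.
have iF (j : K) : Cintegrable (fun x => a j * (g x * ek j x)).
  exact/CintegrableZ/Cintegrable_shift.
rewrite (_ : (fun x => _) = fun x => \sum_(j <- enumK n) a j * (g x * ek j x)).
  rewrite (fourier_sum (enumK n) k iF).2; apply: eq_bigr => j _.
  by rewrite fourierZ ?fourier_shift//; exact: Cintegrable_shift.
apply/funext => x; rewrite mulr_suml; apply: eq_bigr => j _.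
by rewrite -mulrA (mulrC (ek j x)).
Qed.

Lemma fourier_synth a (B : R) : summable_by B a -> fourier (synth a) = a.
Proof.
move=> aB; apply/funext => k.
have E : synth a = (fun x => synth a x * ek 0 x).
  by apply/funext => x; rewrite ek0 mulr1.
rewrite E; apply: (@ccvg_unique _ _ _ _ (ccvg_fourier_synthM k aB (Cintegrable_ek R 0))).
have [N hN] := subset_enumK [:: k].
rewrite /ccvg; apply: cvg_near_cst; exists N => // n /= /hN kn.
rewrite (bigD1_seq k) ?enumK_uniq//=; last by apply: kn; rewrite inE.
rewrite subrr fourier_ek eqxx mulr1 big1 ?addr0 ?subrr ?Normc.normc0// => j jk.
by rewrite fourier_ek eq_sym subr_eq0 eq_sym (negbTE jk) mulr0.
Qed.

End torus_series.

(** * Sobolev balls *)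

Section weight_sum.
Context (R : realType).

Lemma powR_inv_telescope (a x : R) : 0 < a -> 0 < x ->
  a * (x + 1) `^ (- a - 1) <= x `^ (- a) - (x + 1) `^ (- a).
Proof.
move=> a0 x0; have x1 : 0 < x + 1 by rewrite addr_gt0.
have y0 : 0 < x / (x + 1) by rewrite divr_gt0.
have -> : x `^ (- a) = (x + 1) `^ (- a) * (x / (x + 1)) `^ (- a).
  by rewrite -powRM ?(ltW x1) ?(ltW y0)//; congr (_ `^ _); rewrite mulrC divfK// gt_eqF.
have -> : (x + 1) `^ (- a - 1) = (x + 1) `^ (- a) * (x + 1)^-1.
  by rewrite powRD ?(gt_eqF x1) ?implybT// powR_inv1// ltW.
have h : 1 + a * (x + 1)^-1 <= (x / (x + 1)) `^ (- a).
  rewrite /powR (gt_eqF y0); apply: le_trans (expR_ge1Dx _).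
  have := @le_ln1Dx R (- (x + 1)^-1).
  have -> : 1 + - (x + 1)^-1 = x / (x + 1) by field; rewrite gt_eqF.
  have i1 : -1 < - (x + 1)^-1 by rewrite ltrN2 invf_lt1// ltrDr.
  move=> /(_ i1) l; rewrite lerD2l mulNr -mulrN ler_wpM2l ?(ltW a0)//; lra.
have := ler_wpM2l (powR_ge0 (x + 1) (- a)) h; lra.
Qed.

Lemma sum_powR_le (a : R) N : 0 < a ->
  \sum_(m < N.+1) (m%:R + 1) `^ (- a - 1) <= 1 + (1 - N.+1%:R `^ (- a)) / a.
Proof.
move=> a0; elim: N => [|N ih].
  by rewrite big_ord1 add0r !powR1 subrr mul0r addr0.
rewrite big_ord_recr/=; have := powR_inv_telescope a0 (ltr0Sn R N).
rewrite natr1 => h.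
have : N.+2%:R `^ (- a - 1) <= (N.+1%:R `^ (- a) - N.+2%:R `^ (- a)) / a.
  by rewrite ler_pdivlMr// mulrC.
rewrite !mulrBl in ih *; lra.
Qed.

Lemma sum_japanese_nat (p : R) : 1 / 2 < p -> exists Q : R, forall F : seq nat,
  uniq F -> \sum_(m <- F) (1 + m%:R ^+ 2) `^ (- p) <= Q.
Proof.
move=> p12; pose a := 2 * p - 1; have a0 : 0 < a by rewrite /a; lra.
exists (2 `^ p * (1 + 1 / a)) => F uF.
have le1 m : (1 + m%:R ^+ 2) `^ (- p) <= 2 `^ p * ((m%:R + 1) `^ (- a - 1)) :> R.
  have m0 : 0 <= m%:R :> R by [].
  have m1 : 0 < m%:R + 1 :> R by rewrite ltr_wpDl.
  have m2 : 0 < 1 + m%:R ^+ 2 :> R by rewrite ltr_pwDl// sqr_ge0.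
  have -> : - a - 1 = 2 * - p by rewrite /a; lra.
  rewrite powRrM (_ : _ `^ 2 = (m%:R + 1) ^+ 2); last by rewrite -powR_mulrn// ltW.
  rewrite !powRN ler_pdivlMr ?powR_gt0 ?exprn_gt0// mulrC ler_pdivrMr ?powR_gt0//.
  rewrite -powRM ?(ltW m2)//; apply: ge0_ler_powR.
  - lra.
  - by rewrite nnegrE sqr_ge0.
  - by rewrite nnegrE mulr_ge0// ltW.
  - have := sqr_ge0 (m%:R - 1 : R); nra.
apply: (@le_trans _ _ (\sum_(m <- F) 2 `^ p * ((m%:R + 1) `^ (- a - 1)))).
  exact: ler_sum.
rewrite -mulr_sumr ler_wpM2l ?powR_ge0//.
pose N := (\max_(m <- F) m)%N.
apply: (@le_trans _ _ (\sum_(m <- iota 0 N.+1) (m%:R + 1) `^ (- a - 1))).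
  apply: (le_sum_subset uF (iota_uniq 0 N.+1)).
    by move=> m mF; rewrite mem_iota/= add0n ltnS (@leq_bigmax_seq _ _ xpredT id).
  by move=> m; exact: powR_ge0.
have -> : iota 0 N.+1 = index_iota 0 N.+1 by rewrite /index_iota subn0.
rewrite big_mkord (le_trans (sum_powR_le _ a0))// lerD2l ler_wpM2r//.
  by rewrite invr_ge0 ltW.
Qed.

Lemma sum_japanese_int (p : R) : 1 / 2 < p -> exists Q : R, forall F : seq int,
  uniq F -> \sum_(m <- F) (1 + m%:~R ^+ 2) `^ (- p) <= Q.
Proof.
move=> /sum_japanese_nat[Q hQ]; exists (Q + Q) => F uF.
have absE (m : int) : m%:~R ^+ 2 = `|m|%N%:R ^+ 2 :> R.
  by rewrite natr_absz intr_norm real_normK ?num_real.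
under eq_bigr do rewrite absE.
rewrite (bigID (fun m => 0 <= m))/=; apply: lerD; rewrite -big_filter.
  rewrite -(big_map absz predT (fun m : nat => (1 + m%:R ^+ 2 : R) `^ (- p))).
  apply: hQ; rewrite map_inj_in_uniq ?filter_uniq// => x y.
  rewrite !mem_filter => /andP[x0 _] /andP[y0 _] xy.
  by rewrite -(gez0_abs x0) -(gez0_abs y0) xy.
rewrite -(big_map absz predT (fun m : nat => (1 + m%:R ^+ 2 : R) `^ (- p))).
apply: hQ; rewrite map_inj_in_uniq ?filter_uniq// => x y.
rewrite !mem_filter -!ltNge => /andP[x0 _] /andP[y0 _] xy.
by apply: oppr_inj; rewrite -(ltz0_abs x0) -(ltz0_abs y0) xy.
Qed.

Lemma sum_prod_coordinates d (q : int -> R) (Q : R) : (forall m, 0 <= q m) ->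
  (forall F : seq int, uniq F -> \sum_(m <- F) q m <= Q) ->
  forall F : seq 'rV[int]_d, uniq F ->
    \sum_(k <- F) \prod_(i < d) q (k 0 i) <= Q ^+ d.
Proof.
move=> q0 hQ F uF.
pose E := undup (0 :: [seq (k : 'rV[int]_d) 0 i | k <- F, i <- enum 'I_d]).
have uE : uniq E by exact: undup_uniq.
pose n := size E.
have n0 : (0 < n)%N.
  by have : 0 \in E; [rewrite mem_undup inE eqxx|rewrite /n; case: (E)].
pose row (f : {ffun 'I_d -> 'I_n}) : 'rV[int]_d := \row_i nth 0 E (f i).
pose phi (k : 'rV[int]_d) : {ffun 'I_d -> 'I_n} :=
  [ffun i => insubd (Ordinal n0) (index (k 0 i) E)].
have rowK k : k \in F -> row (phi k) = k.
  move=> kF; apply/rowP => i; rewrite mxE ffunE val_insubd.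
  have kE : k 0 i \in E.
    rewrite mem_undup inE; apply/orP; right; apply/allpairsP; exists (k, i) => /=.
    by rewrite kF mem_enum.
  by rewrite index_mem kE nth_index.
have -> : \sum_(k <- F) \prod_(i < d) q (k 0 i) =
    \sum_(f <- [seq phi k | k <- F]) \prod_(i < d) q (nth 0 E (f i)).
  rewrite big_map !big_seq; apply: eq_bigr => k kF; apply: eq_bigr => i _.
  by rewrite -{1}(rowK k kF) mxE.
apply: (@le_trans _ _ (\sum_(f : {ffun 'I_d -> 'I_n}) \prod_(i < d) q (nth 0 E (f i)))).
  apply: le_sum_subset.
  - by rewrite map_inj_in_uniq// => x y /rowK xK /rowK yK xy; rewrite -xK -yK xy.
  - exact: index_enum_uniq.
  - by move=> f _; rewrite mem_index_enum.
  - by move=> f; exact: prodr_ge0.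
rewrite -(bigA_distr_bigA (fun _ (j : 'I_n) => q (nth 0 E j))) prodr_const card_ord.
have h : \sum_(j < n) q (nth 0 E j) <= Q.
  by rewrite -(big_mkord predT (fun j => q (nth 0 E j))) -(big_nth 0 predT q); exact: hQ.
by rewrite lerXn2r// nnegrE ?(le_trans _ h) ?sumr_ge0.
Qed.

End weight_sum.

Section sobolev_ball.
Context (R : realType) (d : nat).
Local Notation C := R[i].
Local Notation K := ('rV[int]_d).
Local Notation normc := (@Normc.normc R).
Implicit Types (a b : torus_distr R d) (s r B : R) (F G : seq K) (k : K).

Definition weight s k : R := (1 + sqk R k) `^ s.

Lemma sqk_ge0 k : 0 <= sqk R k.
Proof. by apply: sumr_ge0 => i _; exact: sqr_ge0. Qed.

Lemma sqkN k : sqk R (- k) = sqk R k.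
Proof. by apply: eq_bigr => i _; rewrite mxE intrN sqrrN. Qed.

Lemma sqk1_ge1 k : 1 <= 1 + sqk R k.
Proof. by rewrite lerDl sqk_ge0. Qed.

Lemma sqk1_gt0 k : 0 < 1 + sqk R k.
Proof. by rewrite (lt_le_trans ltr01)// sqk1_ge1. Qed.

Lemma weight_gt0 s k : 0 < weight s k.
Proof. exact/powR_gt0/sqk1_gt0. Qed.

Lemma weightD s r k : weight (s + r) k = weight s k * weight r k.
Proof. by rewrite /weight powRD// (gt_eqF (sqk1_gt0 k)) implybT. Qed.

Lemma weight_half s k : weight s k = weight (s / 2) k ^+ 2.
Proof. by rewrite expr2 -weightD -splitr. Qed.

Lemma weight_sum s : d%:R / 2 < s -> exists2 S : R, 0 <= S &
  forall F, uniq F -> \sum_(k <- F) weight (- s) k <= S.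
Proof.
move=> ds; have s0 : 0 < s by apply: le_lt_trans ds; rewrite divr_ge0.
have [d0|d0] := posnP d.
  exists 1 => // F uF.
  have : (size F <= 1)%N.
    case: F uF => [|k [|j F]]//= /andP[].
    rewrite inE negb_or => /andP[/eqP]; case; apply/rowP => i.
    by have := ltn_ord i; rewrite [X in (_ < X)%N]d0.
  case: F {uF} => [|k [|j F]]//= _; first by rewrite big_nil.
  rewrite big_seq1 /weight powRN invf_le1 ?powR_gt0 ?sqk1_gt0//.
  by have := ler_powR (sqk1_ge1 k) (ltW s0); rewrite powRr0.
have dR : 0 < d%:R :> R by rewrite ltr0n.
have p12 : 1 / 2 < s / d%:R.
  by rewrite ltr_pdivlMr// mulrC mulrA mulr1.
have [Q hQ] := sum_japanese_int p12.
have h := sum_prod_coordinates (fun m => powR_ge0 _ _) hQ.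
exists (Q ^+ d); first by have := h d [::]; rewrite big_nil; exact.
move=> F /h; apply: le_trans; apply: ler_sum => k _.
have E (I : Type) (l : seq I) (f : I -> R) (p : R) : (forall i, 0 <= f i) ->
    (\prod_(i <- l) f i) `^ p = \prod_(i <- l) f i `^ p.
  move=> f0; elim: l => [|i l ih]; first by rewrite !big_nil powR1.
  by rewrite !big_cons powRM ?ih// prodr_ge0.
rewrite -E; last by move=> i; rewrite addr_ge0// sqr_ge0.
have -> : weight (- s) k = ((1 + sqk R k) ^+ d) `^ (- (s / d%:R)).
  rewrite -powR_mulrn ?(ltW (sqk1_gt0 k))// -powRrM; congr (_ `^ _).
  by field; rewrite gt_eqF.
rewrite !powRN lef_pV2 ?posrE ?powR_gt0 ?exprn_gt0 ?sqk1_gt0//; last first.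
  by apply: prodr_gt0 => i _; rewrite ltr_pwDl// sqr_ge0.
apply: ge0_ler_powR; rewrite ?nnegrE ?exprn_ge0 ?(ltW (sqk1_gt0 _))//.
- by rewrite divr_ge0// ltW.
- by apply: prodr_ge0 => i _; rewrite addr_ge0// sqr_ge0.
rewrite -[X in _ ^+ X](card_ord d) -prodr_const; apply: ler_prod => i _.
rewrite addr_ge0 ?sqr_ge0//= lerD2l /sqk (bigD1 i)//= lerDl.
by apply: sumr_ge0 => j _; exact: sqr_ge0.
Qed.

Definition sobolev_ball s B a := 0 <= B /\ forall F, uniq F ->
  \sum_(k <- F) weight s k * normc (a k) ^+ 2 <= B ^+ 2.

Lemma sobolev_normP s B a : 0 <= B ->
  (sobolev_norm s a <= B%:E)%E <-> sobolev_ball s B a.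
Proof.
move=> B0; have t0 k : 0 <= weight s k * normc (a k) ^+ 2.
  by rewrite mulr_ge0 ?sqr_ge0// ltW// weight_gt0.
have sqrteP (x : \bar R) : (0 <= x)%E -> (sqrte x <= B%:E)%E = (x <= (B ^+ 2)%:E)%E.
  case: x => [x||]// _; rewrite /= !lee_fin.
  by rewrite -{1}(ger0_norm B0) -sqrtr_sqr ler_sqrt ?sqr_ge0.
rewrite /sobolev_norm sqrteP; last by apply: esum_ge0 => k _; rewrite lee_fin; exact: t0.
split=> [h|[_ h]]; last exact: esum_le_seq.
split=> // F uF; rewrite -lee_fin; apply: le_trans h.
exact: (esum_ge_seq t0 uF).
Qed.

Lemma sobolev_ball_ge0 s B a : sobolev_ball s B a -> 0 <= B.
Proof. by case. Qed.

Lemma sobolev_ballW s r B B' a : r <= s -> B <= B' -> sobolev_ball s B a ->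
  sobolev_ball r B' a.
Proof.
move=> rs BB [B0 h]; split; first exact: le_trans BB.
move=> F /h hF; apply: (@le_trans _ _ (B ^+ 2)).
  apply: le_trans hF; apply: ler_sum => k _; rewrite ler_wpM2r ?sqr_ge0//.
  by apply: ler_powR => //; exact: sqk1_ge1.
by rewrite lerXn2r// nnegrE// (le_trans B0).
Qed.

Lemma sobolev_ball_multiplier s r B M (m : K -> C) a : 0 <= M ->
  (forall k, weight r k * normc (m k) ^+ 2 <= M ^+ 2 * weight s k) ->
  sobolev_ball s B a -> sobolev_ball r (M * B) (fun k => m k * a k).
Proof.
move=> M0 hm [B0 h]; split; first exact: mulr_ge0.
move=> F /h hF; rewrite exprMn; apply: (@le_trans _ _ (M ^+ 2 *
    \sum_(k <- F) weight s k * normc (a k) ^+ 2)); last by rewrite ler_wpM2l ?sqr_ge0.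
rewrite mulr_sumr; apply: ler_sum => k _.
by rewrite Normc.normcM exprMn mulrA [leRHS]mulrA ler_wpM2r ?sqr_ge0 ?hm.
Qed.

Lemma sobolev_ballM s B M (m : K -> C) a : 0 <= M ->
  (forall k, normc (m k) <= M) ->
  sobolev_ball s B a -> sobolev_ball s (M * B) (fun k => m k * a k).
Proof.
move=> M0 hm; apply: sobolev_ball_multiplier => // k.
rewrite mulrC ler_wpM2r ?(ltW (weight_gt0 _ _))//.
by rewrite lerXn2r// nnegrE normc_ge0.
Qed.

Lemma sobolev_ballZ s B (z : C) a : sobolev_ball s B a ->
  sobolev_ball s (normc z * B) (fun k => z * a k).
Proof. by apply: sobolev_ballM => //; exact: normc_ge0. Qed.

Lemma sobolev_ballN s B a : sobolev_ball s B a -> sobolev_ball s B (fun k => - a k).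
Proof.
move=> [B0 h]; split=> // F /h; under [X in _ -> X <= _]eq_bigr do rewrite normcN.
exact.
Qed.

Lemma weight_normc_sq s k (z : C) :
  weight s k * normc z ^+ 2 = (weight (s / 2) k * normc z) ^+ 2.
Proof. by rewrite exprMn -weight_half. Qed.

Lemma sobolev_ballD s B B' a b : sobolev_ball s B a -> sobolev_ball s B' b ->
  sobolev_ball s (B + B') (fun k => a k + b k).
Proof.
move=> [B0 ha] [B'0 hb]; split=> [|F uF]; first exact: addr_ge0.
move/(_ F uF) : ha => ha; move/(_ F uF) : hb => hb.
pose p k := weight (s / 2) k * normc (a k); pose q k := weight (s / 2) k * normc (b k).
apply: (@le_trans _ _ (\sum_(k <- F) (p k ^+ 2 + 2 * (p k * q k) + q k ^+ 2))).
  apply: ler_sum => k _; rewrite weight_normc_sq.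
  have -> : p k ^+ 2 + 2 * (p k * q k) + q k ^+ 2 = (p k + q k) ^+ 2 by ring.
  rewrite /p /q -mulrDr lerXn2r ?nnegrE ?mulr_ge0 ?addr_ge0 ?normc_ge0 ?(ltW (weight_gt0 _ _))//.
  by rewrite ler_wpM2l ?(ltW (weight_gt0 _ _))// le_normcD.
rewrite !big_split/= -mulr_sumr.
have cs : \sum_(k <- F) p k * q k <= B * B'.
  apply: sum_cauchy_schwarz_le => //.
    by apply: le_trans ha; apply: ler_sum => k _; rewrite weight_normc_sq.
  by apply: le_trans hb; apply: ler_sum => k _; rewrite weight_normc_sq.
have hp : \sum_(k <- F) p k ^+ 2 <= B ^+ 2.
  by apply: le_trans ha; apply: ler_sum => k _; rewrite weight_normc_sq.
have hq : \sum_(k <- F) q k ^+ 2 <= B' ^+ 2.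
  by apply: le_trans hb; apply: ler_sum => k _; rewrite weight_normc_sq.
rewrite sqrrD; lra.
Qed.

Lemma sobolev_ballB s B B' a b : sobolev_ball s B a -> sobolev_ball s B' b ->
  sobolev_ball s (B + B') (fun k => a k - b k).
Proof. by move=> ha /sobolev_ballN; exact: sobolev_ballD. Qed.

Lemma sobolev_ballJ s B a : sobolev_ball s B a -> sobolev_ball s B (conj_distr a).
Proof.
move=> [B0 h]; split=> // F uF; have := h [seq - k | k <- F].
rewrite (map_inj_uniq oppr_inj) big_map => /(_ uF); apply: le_trans.
apply: ler_sum => k _; rewrite /weight sqkN.
by have -> : normc (conj_distr a k) = normc (a (- k)) by exact: normc_conj.
Qed.

Lemma sobolev_ball_lim s B (a_ : nat -> torus_distr R d) a :
  (forall n, sobolev_ball s B (a_ n)) -> (forall k, ccvg (a_ ^~ k) (a k)) ->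
  sobolev_ball s B a.
Proof.
move=> h c; split=> [|F uF]; first exact: (h 0%N).1.
apply: (@cvg_le_bound _ (fun n => \sum_(k <- F) weight s k * normc (a_ n k) ^+ 2)).
  elim: F {uF} => [|k F ih].
    by under eq_fun do rewrite big_nil; rewrite big_nil; exact: cvg_cst.
  under eq_fun do rewrite big_cons; rewrite big_cons; apply: cvgD => //.
  apply: cvgM; first exact: cvg_cst.
  by rewrite expr2; apply: cvgM; exact: ccvg_normc.
by move=> n; exact: (h n).2.
Qed.

Lemma summable_by_ball s : d%:R / 2 < s -> exists2 W : R, 0 <= W &
  forall B a, sobolev_ball s B a -> summable_by (W * B) a.
Proof.
move=> /weight_sum[S S0 hS]; exists (Num.sqrt S); first exact: sqrtr_ge0.
move=> B a [B0 h] F uF.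
apply: (@le_trans _ _ (\sum_(k <- F) weight (- s / 2) k * (weight (s / 2) k * normc (a k)))).
  apply: ler_sum => k _; rewrite mulrA -weightD mulNr addNr.
  by rewrite /weight powRr0 mul1r.
apply: sum_cauchy_schwarz_le => //.
  by rewrite sqr_sqrtr//; under eq_bigr do rewrite -weight_half; exact: hS.
by under eq_bigr do rewrite -weight_normc_sq; exact: h.
Qed.

End sobolev_ball.

Section sobolev_algebra.
Context (R : realType) (d : nat).
Local Notation C := R[i].
Local Notation K := ('rV[int]_d).
Local Notation normc := (@Normc.normc R).
Implicit Types (a b : torus_distr R d) (s r B L : R) (F G : seq K) (k : K).

Lemma sum_weighted_cauchy_schwarz (I : Type) (l : seq I) (u v : I -> R) :
  (forall i, 0 <= u i) ->
  (\sum_(i <- l) u i * v i) ^+ 2 <=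
  (\sum_(i <- l) u i) * \sum_(i <- l) u i * v i ^+ 2.
Proof.
move=> u0; have := sum_cauchy_schwarz l (fun i => Num.sqrt (u i))
  (fun i => Num.sqrt (u i) * v i).
under [X in X ^+ 2 <= _ -> _]eq_bigr do rewrite mulrA -expr2 sqr_sqrtr//.
under [X in _ <= X * _ -> _]eq_bigr do rewrite sqr_sqrtr//.
by under [X in _ <= _ * X -> _]eq_bigr do rewrite exprMn sqr_sqrtr//.
Qed.

Lemma uniq_subr F j : uniq F -> uniq [seq k - j | k <- F].
Proof. by move=> uF; rewrite map_inj_uniq//; exact: addIr. Qed.

Lemma uniq_rsub G k : uniq G -> uniq [seq k - j | j <- G].
Proof. by move=> uG; rewrite map_inj_uniq// => x y /addrI/oppr_inj. Qed.

Section young.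
Variables (p q : K -> R) (B L : R).
Hypotheses (q0 : forall k, 0 <= q k)
  (pB : forall F, uniq F -> \sum_(k <- F) p k ^+ 2 <= B ^+ 2)
  (qL : forall F, uniq F -> \sum_(k <- F) q k <= L).

Lemma young_l2_l1 F G : uniq F -> uniq G ->
  \sum_(k <- F) (\sum_(j <- G) p j * q (k - j)) ^+ 2 <= (L * B) ^+ 2.
Proof.
move=> uF uG; have L0 : 0 <= L by have := qL (isT : uniq [::]); rewrite big_nil.
apply: (@le_trans _ _ (\sum_(k <- F) L * \sum_(j <- G) q (k - j) * p j ^+ 2)).
  apply: ler_sum => k _; under eq_bigr do rewrite mulrC.
  apply: le_trans (sum_weighted_cauchy_schwarz _ _ _) _ => //.
  apply: ler_wpM2r; first by apply: sumr_ge0 => j _; rewrite mulr_ge0// sqr_ge0.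
  by have := qL (uniq_rsub k uG); rewrite big_map.
rewrite -mulr_sumr exprMn expr2 -mulrA ler_wpM2l// exchange_big/=.
apply: (@le_trans _ _ (\sum_(j <- G) L * p j ^+ 2)).
  apply: ler_sum => j _; rewrite -mulr_suml ler_wpM2r ?sqr_ge0//.
  by have := qL (uniq_subr j uF); rewrite big_map.
by rewrite -mulr_sumr ler_wpM2l// pB.
Qed.

Lemma young_l1_l2 F G : uniq F -> uniq G ->
  \sum_(k <- F) (\sum_(j <- G) q j * p (k - j)) ^+ 2 <= (L * B) ^+ 2.
Proof.
move=> uF uG; have L0 : 0 <= L by have := qL (isT : uniq [::]); rewrite big_nil.
apply: (@le_trans _ _ (\sum_(k <- F) L * \sum_(j <- G) q j * p (k - j) ^+ 2)).
  apply: ler_sum => k _.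
  apply: le_trans (sum_weighted_cauchy_schwarz _ _ _) _ => //.
  apply: ler_wpM2r; last exact: qL.
  by apply: sumr_ge0 => j _; rewrite mulr_ge0// sqr_ge0.
rewrite -mulr_sumr exprMn expr2 -mulrA ler_wpM2l// exchange_big/=.
apply: (@le_trans _ _ (\sum_(j <- G) q j * B ^+ 2)).
  apply: ler_sum => j _; rewrite -mulr_sumr ler_wpM2l//.
  by have := pB (uniq_subr j uF); rewrite big_map.
by rewrite -mulr_suml ler_wpM2r ?sqr_ge0// qL.
Qed.

End young.

Lemma weight_subadditive s j k : 0 <= s ->
  weight s k <= 4 `^ s * (weight s j + weight s (k - j)) :> R.
Proof.
move=> s0; set x := 1 + sqk R j; set y := 1 + sqk R (k - j).
have x1 : 1 <= x by exact: sqk1_ge1.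
have y1 : 1 <= y by exact: sqk1_ge1.
have h : 1 + sqk R k <= 4 * Num.max x y.
  have : sqk R k <= 2 * sqk R j + 2 * sqk R (k - j).
    rewrite /sqk !mulr_sumr -big_split/=; apply: ler_sum => i _.
    rewrite !mxE intrD intrN; set u := (k 0 i)%:~R; set v := (j 0 i)%:~R.
    have := sqr_ge0 (u - 2 * v : R); nra.
  have : x <= Num.max x y by rewrite le_max lexx.
  have : y <= Num.max x y by rewrite le_max lexx orbT.
  rewrite /x /y; lra.
have m1 : 1 <= Num.max x y by rewrite le_max x1.
apply: (@le_trans _ _ ((4 * Num.max x y) `^ s)).
  apply: ge0_ler_powR => //; rewrite nnegrE; first exact/ltW/sqk1_gt0.
  by rewrite mulr_ge0// (le_trans ler01).
rewrite powRM//; last by rewrite (le_trans ler01).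
rewrite ler_wpM2l ?powR_ge0// /weight -/x -/y maxEle.
by case: ifP => _; rewrite ?lerDl ?lerDr powR_ge0.
Qed.

Lemma sobolev_ball_conv s : d%:R / 2 < s -> exists2 A : R, 1 <= A &
  forall B B' a b G, uniq G -> sobolev_ball s B a -> sobolev_ball s B' b ->
  sobolev_ball s (A * B * B') (fun k => \sum_(j <- G) a j * b (k - j)).
Proof.
move=> ds; have s0 : 0 <= s / 2.
  by rewrite divr_ge0// ltW// (le_lt_trans _ ds)// divr_ge0.
have [W W0 hW] := summable_by_ball ds.
pose P : R := 4 `^ (s / 2); have P0 : 0 <= P by exact: powR_ge0.
exists (2 * P * W + 1); first by rewrite lerDr !mulr_ge0.
move=> B B' a b G uG ha hb.
have B0 := sobolev_ball_ge0 ha; have B'0 := sobolev_ball_ge0 hb.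
apply: (@sobolev_ballW _ _ s s (2 * P * W * B * B')) => //.
  by rewrite ler_wpM2r// ler_wpM2r// lerDl.
split=> [|F uF]; first by rewrite !mulr_ge0.
pose h k : R := weight (s / 2) k.
have h0 k : 0 <= h k by exact/ltW/weight_gt0.
pose T1 k := \sum_(j <- G) (h j * normc (a j)) * normc (b (k - j)).
pose T2 k := \sum_(j <- G) normc (a j) * (h (k - j) * normc (b (k - j))).
have t10 k : 0 <= T1 k by apply: sumr_ge0 => j _; rewrite !mulr_ge0 ?normc_ge0.
have t20 k : 0 <= T2 k by apply: sumr_ge0 => j _; rewrite !mulr_ge0 ?normc_ge0.
have le k : h k * normc (\sum_(j <- G) a j * b (k - j)) <= P * (T1 k + T2 k).
  apply: (@le_trans _ _ (h k * \sum_(j <- G) normc (a j) * normc (b (k - j)))).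
    rewrite ler_wpM2l// (le_trans (normc_sum _ _ _))//.
    by apply: ler_sum => j _; rewrite Normc.normcM.
  rewrite /T1 /T2 -big_split/= !mulr_sumr; apply: ler_sum => j _.
  have w := weight_subadditive j k s0.
  have n0 : 0 <= normc (a j) * normc (b (k - j)) by rewrite mulr_ge0 ?normc_ge0.
  have := ler_wpM2r n0 w; rewrite -/P -!/(h _); lra.
have y1 : \sum_(k <- F) T1 k ^+ 2 <= (W * B' * B) ^+ 2.
  apply: (young_l2_l1 (q := fun k => normc (b k))
    (p := fun j => h j * normc (a j))) => //.
  - by move=> k; exact: normc_ge0.
  - by move=> F' uF'; under eq_bigr do rewrite -weight_normc_sq; exact: ha.2.
  - exact: hW hb.
have y2 : \sum_(k <- F) T2 k ^+ 2 <= (W * B * B') ^+ 2.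
  apply: (young_l1_l2 (q := fun k => normc (a k))
    (p := fun j => h j * normc (b j))) => //.
  - by move=> k; exact: normc_ge0.
  - by move=> F' uF'; under eq_bigr do rewrite -weight_normc_sq; exact: hb.2.
  - exact: hW ha.
apply: (@le_trans _ _ (\sum_(k <- F) P ^+ 2 * (2 * T1 k ^+ 2 + 2 * T2 k ^+ 2))).
  apply: ler_sum => k _; rewrite weight_normc_sq.
  apply: (@le_trans _ _ ((P * (T1 k + T2 k)) ^+ 2)).
    by rewrite lerXn2r// nnegrE !mulr_ge0 ?addr_ge0 ?normc_ge0.
  rewrite exprMn ler_wpM2l ?sqr_ge0//.
  have := sqr_ge0 (T1 k - T2 k); nra.
rewrite -mulr_sumr big_split/= -!mulr_sumr.
apply: (@le_trans _ _ (P ^+ 2 * (2 * (W * B' * B) ^+ 2 + 2 * (W * B * B') ^+ 2))).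
  rewrite ler_wpM2l ?sqr_ge0// lerD// ler_wpM2l//.
rewrite le_eqVlt; apply/orP; left; apply/eqP; ring.
Qed.

End sobolev_algebra.

(** * Sobolev functions *)

Section imaginary_exponential.
Context (R : realType).
Local Notation C := R[i].
Local Notation normc := (@Normc.normc R).

Definition iexp_coeff (y : R) (m : nat) : C := (m`!%:R)^-1%:C * ((0 +i* y) ^+ m).

Lemma imag_expr (y : R) m : (0 +i* y) ^+ m =
  ((~~ odd m)%:R * (-1) ^+ m./2 * y ^+ m) +i*
  ((odd m)%:R * (-1) ^+ m.-1./2 * y ^+ m) :> C.
Proof.
have sq : (0 +i* y) ^+ 2 = (- y ^+ 2)%:C :> C.
  by rewrite expr2; simpc; rewrite expr2.
have ev h : (0 +i* y) ^+ h.*2 = ((-1) ^+ h * y ^+ h.*2)%:C :> C.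
  by rewrite -mul2n !exprM sq -rmorphXn; congr (_%:C); rewrite [LHS]exprNn.
rewrite -(odd_double_half m); case: (odd m); move: m./2 => h.
  rewrite add1n /= odd_double doubleK exprS ev exprS; simpc.
  by congr Complex; ring.
by rewrite add0n odd_double doubleK ev /=; congr Complex; rewrite ?mul1r ?mul0r ?mul0r.
Qed.

Lemma ccvg_iexp (y : R) :
  ccvg (fun n => \sum_(m < n) iexp_coeff y m) (expi y).
Proof.
have coef m : iexp_coeff y m = cos_coeff y m +i* sin_coeff y m.
  rewrite /iexp_coeff imag_expr /cos_coeff /sin_coeff/=; simpc.
  by congr Complex; rewrite mulrC.
apply/ccvgP; split.
  rewrite /expi/= (_ : cos y = lim (series (cos_coeff y) @ \oo)); last by rewrite unlock.
  have -> : (fun n => complex.Re (\sum_(m < n) iexp_coeff y m)) = series (cos_coeff y).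
    apply/funext => n; rewrite (raddf_sum (@complex.Re R : Rcomplex R -> R)).
    by rewrite /series/= big_mkord; apply: eq_bigr => m _; rewrite coef.
  exact: is_cvg_series_cos_coeff.
rewrite /expi/= (_ : sin y = lim (series (sin_coeff y) @ \oo)); last by rewrite unlock.
have -> : (fun n => complex.Im (\sum_(m < n) iexp_coeff y m)) = series (sin_coeff y).
  apply/funext => n; rewrite (raddf_sum (@complex.Im R : Rcomplex R -> R)).
  by rewrite /series/= big_mkord; apply: eq_bigr => m _; rewrite coef.
exact: is_cvg_series_sin_coeff.
Qed.

Lemma sum_exp_coeff_le (y : R) n : 0 <= y ->
  \sum_(m < n) (m`!%:R)^-1 * y ^+ m <= expR y.
Proof.
move=> y0; have -> : \sum_(m < n) (m`!%:R)^-1 * y ^+ m = series (exp_coeff y) n.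
  by rewrite /series/= big_mkord; apply: eq_bigr => m _; rewrite mulrC.
rewrite /expR; apply: nondecreasing_cvgn_le.
  by apply: nondecreasing_series => m _ _; exact: exp_coeff_ge0.
exact: is_cvg_series_exp_coeff.
Qed.

End imaginary_exponential.

Section sobolev_functions.
Context (R : realType) (d : nat).
Local Notation C := R[i].
Local Notation normc := (@Normc.normc R).
Local Notation mu := (lebesgue_tuple R d).
Local Notation D := (@cube R d).
Implicit Types (f g : torus_fun R d) (s r B : R).

Definition sobolev_fun s B f := Cintegrable f /\ sobolev_ball s B (fourier f).

Lemma sobolev_fun_ge0 s B f : sobolev_fun s B f -> 0 <= B.
Proof. by move=> [_ /sobolev_ball_ge0]. Qed.

Lemma sobolev_fun_measurable s B f : sobolev_fun s B f -> Cmeasurable f.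
Proof. by move=> [/Cintegrable_measurable]. Qed.

Lemma sobolev_funW s r B B' f : r <= s -> B <= B' ->
  sobolev_fun s B f -> sobolev_fun r B' f.
Proof. by move=> rs BB [fi fB]; split=> //; exact: sobolev_ballW fB. Qed.

Lemma sobolev_funD s B B' f g : sobolev_fun s B f -> sobolev_fun s B' g ->
  sobolev_fun s (B + B') (fun x => f x + g x).
Proof.
move=> [fi fB] [gi gB]; split; first exact: CintegrableD.
by rewrite (_ : fourier _ = fun k => fourier f k + fourier g k);
  [exact: sobolev_ballD|apply/funext => k; exact: fourierD].
Qed.

Lemma sobolev_funZ s B (z : C) f : sobolev_fun s B f ->
  sobolev_fun s (normc z * B) (fun x => z * f x).
Proof.
move=> [fi fB]; split; first exact: CintegrableZ.
by rewrite (_ : fourier _ = fun k => z * fourier f k);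
  [exact: sobolev_ballZ|apply/funext => k; exact: fourierZ].
Qed.

Lemma sobolev_funB s B B' f g : sobolev_fun s B f -> sobolev_fun s B' g ->
  sobolev_fun s (B + B') (fun x => f x - g x).
Proof.
move=> fB /(sobolev_funZ (-1)); rewrite normcN Normc.normc1 mul1r.
by move=> /(sobolev_funD fB); under eq_fun do rewrite mulN1r.
Qed.

Lemma sobolev_funJ s B f : sobolev_fun s B f -> sobolev_fun s B (fun x => (f x)^*).
Proof.
move=> [fi fB]; split; first exact: CintegrableJ.
by rewrite (_ : fourier _ = conj_distr (fourier f));
  [exact: sobolev_ballJ|apply/funext => k; exact: fourierJ].
Qed.

Section supercritical.
Variable s : R.
Hypothesis ds : d%:R / 2 < s.

Lemma summable_sobolev_ball B a : sobolev_ball s B a ->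
  exists B', @summable_by R d B' a.
Proof. by have [W _ hW] := summable_by_ball ds; move=> /hW; exists (W * B). Qed.

Lemma sobolev_fun_synth B a : sobolev_ball s B a ->
  sobolev_fun s B (synth a) /\ fourier (synth a) = a.
Proof.
move=> aB; have [B' sa] := summable_sobolev_ball aB.
by rewrite /sobolev_fun (fourier_synth sa); split=> //; split=> //; exact: Cintegrable_synth sa.
Qed.

Lemma sobolev_fun_ae B f : sobolev_fun s B f ->
  {ae mu, forall x, D x -> f x = synth (fourier f) x}.
Proof.
move=> [fi fB]; have [[si _] e] := sobolev_fun_synth fB.
exact: fourier_inj_ae.
Qed.

Lemma sobolev_fun_fmult B M (m : 'rV[int]_d -> C) f : 0 <= M ->
  (forall k, normc (m k) <= M) -> sobolev_fun s B f ->
  sobolev_fun s (M * B) (fmult m f) /\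
  fourier (fmult m f) = multiplier m (fourier f).
Proof. by move=> M0 hm [fi fB]; apply: sobolev_fun_synth; exact: sobolev_ballM. Qed.

Lemma sobolev_fun_bounded : exists2 W : R, 0 <= W & forall B f, sobolev_fun s B f ->
  {ae mu, forall x, D x -> normc (f x) <= W * B}.
Proof.
have [W W0 hW] := summable_by_ball ds; exists W => // B f fB.
have := sobolev_fun_ae fB; apply: filterS => x fx Dx; rewrite fx//.
exact/synth_le/hW/fB.2.
Qed.

Lemma sobolev_funM : exists2 A : R, 1 <= A & forall B B' f g,
  sobolev_fun s B f -> sobolev_fun s B' g ->
  sobolev_fun s (A * B * B') (fun x => f x * g x).
Proof.
have [A A1 hA] := sobolev_ball_conv ds; exists A => // B B' f g fB gB.
have [W sa] := summable_sobolev_ball fB.2.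
have fm := sobolev_fun_measurable fB; have gm := sobolev_fun_measurable gB.
have e : {ae mu, forall x, D x -> f x * g x = synth (fourier f) x * g x}.
  by have := sobolev_fun_ae fB; apply: filterS => x fx Dx; rewrite fx.
have si := Cintegrable_synth sa.
have sgi : Cintegrable (fun x => synth (fourier f) x * g x).
  apply: (CintegrableMr (Cintegrable_measurable si) _ gB.1) => x _.
  exact: synth_le sa.
have fgm := CmeasurableM fm gm.
split; first exact: Cintegrable_ae fgm sgi e.
rewrite (fourier_ae fgm (Cintegrable_measurable sgi) e).
apply: (sobolev_ball_lim _ (fun k => ccvg_fourier_synthM k sa gB.1)) => n.
exact: hA (enumK_uniq _ n) fB.2 gB.2.
Qed.

Variable A : R.
Hypotheses (A1 : 1 <= A) (hA : forall B B' f g,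
  sobolev_fun s B f -> sobolev_fun s B' g ->
  sobolev_fun s (A * B * B') (fun x => f x * g x)).

Lemma sobolev_funX B f m : sobolev_fun s B f ->
  sobolev_fun s (A ^+ m * B ^+ m.+1) (fun x => f x ^+ m.+1).
Proof.
move=> fB; elim: m => [|m ih].
  by rewrite mul1r expr1; under eq_fun do rewrite expr1.
have -> : A ^+ m.+1 * B ^+ m.+2 = A * B * (A ^+ m * B ^+ m.+1).
  by rewrite !exprS; ring.
by under eq_fun do rewrite exprS; exact: hA.
Qed.

(* The exponential series loses a factor A at each multiplication but its first
   term is exact, hence the bound linear in B. *)
Lemma sobolev_fun_expiB1 B (g : _ -> R) :
  sobolev_fun s B (fun x => (g x)%:C) ->
  sobolev_fun s (B * expR (A * B)) (fun x => expi (g x) - 1).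
Proof.
move=> gB; have B0 := sobolev_fun_ge0 gB.
have A0 : 0 <= A by rewrite (le_trans ler01).
have AB0 : 0 <= A * B by rewrite mulr_ge0.
have iB : sobolev_fun s B (fun x => 0 +i* g x).
  have := sobolev_funZ (0 +i* 1) gB; rewrite /= expr0n expr1n add0r sqrtr1 mul1r.
  by under eq_fun do (simpc; rewrite ?mulr0 ?mul0r ?mul1r ?subr0 ?add0r ?addr0).
pose P n : torus_fun R d := fun x => \sum_(m < n) iexp_coeff (g x) m.+1.
have PB n : sobolev_fun s (B * expR (A * B)) (P n).
  apply: (@sobolev_funW s s (\sum_(m < n) (m.+1`!%:R)^-1 * (A ^+ m * B ^+ m.+1))) => //.
    apply: (@le_trans _ _ (B * \sum_(m < n) (m`!%:R)^-1 * (A * B) ^+ m)).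
      rewrite mulr_sumr; apply: ler_sum => m _.
      have -> : B * ((m`!%:R)^-1 * (A * B) ^+ m) = (m`!%:R)^-1 * (A ^+ m * B ^+ m.+1).
        by rewrite exprMn exprS; ring.
      rewrite ler_wpM2r ?mulr_ge0 ?exprn_ge0// lef_pV2 ?posrE ?ltr0n ?fact_gt0//.
      by rewrite ler_nat factS leq_pmull.
    by rewrite ler_wpM2l// sum_exp_coeff_le.
  elim: n => [|n ih].
    rewrite big_ord0 /P; under eq_fun do rewrite big_ord0.
    have := sobolev_funZ 0 gB; rewrite Normc.normc0 mul0r.
    by under eq_fun do rewrite mul0r.
  have -> : P n.+1 = (fun x => P n x + iexp_coeff (g x) n.+1).
    by apply/funext => x; rewrite /P big_ord_recr.
  rewrite big_ord_recr; apply: sobolev_funD => //.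
  have := sobolev_funZ ((n.+1`!%:R)^-1)%:C (sobolev_funX n iB).
  by rewrite normc_real ger0_norm.
have cP x : ccvg (P ^~ x) (expi (g x) - 1).
  pose u n := normc (\sum_(m < n) iexp_coeff (g x) m - expi (g x)).
  have u0 : u n.+1 @[n --> \oo] --> (0 : R) by rewrite (cvg_shiftS u); exact: ccvg_iexp.
  rewrite /ccvg (_ : (fun n => _) = fun n => u n.+1)//.
  apply/funext => n; rewrite /u /P; congr normc.
  rewrite big_ord_recl {2}/iexp_coeff fact0 expr0 invr1 mulr1.
  by rewrite opprB addrA [1%:C + _]addrC.
have mE : Cmeasurable (fun x => expi (g x) - 1).
  by apply: (Cmeasurable_lim _ cP) => n; exact: sobolev_fun_measurable (PB n).
have [W W0 hW] := sobolev_fun_bounded.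
have [|||||fi fc] := @fourier_dominated_convergence R d P (fun x => expi (g x) - 1)
  (fun=> expR (W * B) * (W * B)).
- by move=> n; exact: sobolev_fun_measurable (PB n).
- exact: mE.
- by apply: aeW => x _; exact: cP.
- apply: (@integrable_cube_bounded _ _ _ (expR (W * B) * (W * B))) => //.
  by move=> x _; rewrite ger0_norm// !mulr_ge0// expR_ge0.
- have := hW _ _ gB; apply: filterS => x gx n Dx.
  have {}gx : `|g x| <= W * B by rewrite -normc_real; exact: gx.
  apply: le_trans (normc_sum _ _ _) _.
  apply: (@le_trans _ _ (\sum_(m < n) (m`!%:R)^-1 * (W * B) ^+ m * (W * B))).
    apply: ler_sum => m _; rewrite /iexp_coeff Normc.normcM normcX normc_real.
    rewrite ger0_norm// /= expr0n add0r sqrtr_sqr -mulrA -exprSr.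
    rewrite ler_pM ?exprn_ge0// ?lerXn2r ?nnegrE ?mulr_ge0//.
    by rewrite lef_pV2 ?posrE ?ltr0n ?fact_gt0// ler_nat factS leq_pmull.
  by rewrite -mulr_suml ler_wpM2r ?mulr_ge0// sum_exp_coeff_le// mulr_ge0.
split=> //; apply: (sobolev_ball_lim _ fc) => n; exact: (PB n).2.
Qed.

End supercritical.
End sobolev_functions.

(** * Nonlinear estimates *)

Section nonlinear_estimates.
Context (R : realType) (d : nat).
Local Notation C := R[i].
Local Notation normc := (@Normc.normc R).
Variables (s A : R).
Hypotheses (ds : d%:R / 2 < s) (A1 : 1 <= A) (hA : forall B B' (f g : torus_fun R d),
  sobolev_fun s B f -> sobolev_fun s B' g ->
  sobolev_fun s (A * B * B') (fun x => f x * g x)).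
Implicit Types (u v U V f g : torus_fun R d) (B E e tau : R).
Local Notation sf := (sobolev_fun s).

Definition density u v : d.-tuple (measurableTypeR R) -> R :=
  fun x => normc (u x) ^+ 2 + 2 * normc (v x) ^+ 2.

Lemma normC_sq (z : C) : `|z| ^+ 2 = z * z^*.
Proof. exact: normCK. Qed.

Lemma densityE u v x : (density u v x)%:C = `|u x| ^+ 2 + 2 * `|v x| ^+ 2.
Proof.
have -> : 2 = (2 : R)%:C :> C by rewrite rmorph_nat.
by rewrite -!normc_normr -!rmorphXn -rmorphM -rmorphD.
Qed.

Lemma nl_flowE tau u v x : nl_flow tau u v x = expi (- (tau / 8) * density u v x) * u x.
Proof.
rewrite /nl_flow -densityE; congr (_ * _); rewrite -cexp_i; congr cexp.
rewrite !rmorphM rmorphN rmorphM/= fmorphV rmorph_nat; ring.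
Qed.

Lemma A_ge0 : 0 <= A. Proof. exact: le_trans A1. Qed.

Lemma sobolev_fun_eq B f g : (forall x, f x = g x) -> sf B f -> sf B g.
Proof. by move=> /funext ->. Qed.

Lemma sobolev_fun_le B B' f : B <= B' -> sf B f -> sf B' f.
Proof. exact: sobolev_funW. Qed.

Lemma sobolev_fun_density B u v : sf B u -> sf B v ->
  sf (3 * A * B ^+ 2) (fun x => (density u v x)%:C).
Proof.
move=> hu hv.
have h := sobolev_funD (hA hu (sobolev_funJ hu))
  (sobolev_funZ 2 (hA hv (sobolev_funJ hv))).
apply: (sobolev_fun_eq _ (sobolev_fun_le _ h)) => [x|]; first by rewrite densityE !normC_sq.
rewrite -[2 : C](rmorph_nat (real_complex R)) normc_real ger0_norm//.
rewrite le_eqVlt; apply/orP; left; apply/eqP; ring.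
Qed.

Lemma sobolev_fun_density_diff B e u v U V : sf B u -> sf B v -> sf B U -> sf B V ->
  sf e (fun x => u x - U x) -> sf e (fun x => v x - V x) ->
  sf (6 * A * B * e) (fun x => (density u v x - density U V x)%:C).
Proof.
move=> hu hv hU hV du dv.
have sq f g : sf B f -> sf B g -> sf e (fun x => f x - g x) ->
    sf (A * e * B + A * B * e) (fun x => f x * (f x)^* - g x * (g x)^*).
  move=> hf hg df.
  apply: sobolev_fun_eq (sobolev_funD (hA df (sobolev_funJ hf)) (hA hg (sobolev_funJ df))) => x.
  by rewrite rmorphB; ring.
have h := sobolev_funD (sq _ _ hu hU du) (sobolev_funZ 2 (sq _ _ hv hV dv)).
apply: (sobolev_fun_eq _ (sobolev_fun_le _ h)) => [x|].
  by rewrite rmorphB/= !densityE !normC_sq; ring.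
rewrite -[2 : C](rmorph_nat (real_complex R)) normc_real ger0_norm//.
rewrite le_eqVlt; apply/orP; left; apply/eqP; ring.
Qed.

Lemma sobolev_fun_phase B tau (g : d.-tuple (measurableTypeR R) -> R) :
  0 <= tau <= 1 -> sf B (fun x => (g x)%:C) ->
  sf (tau * (B * expR (A * B))) (fun x => expi (- (tau / 8) * g x) - 1).
Proof.
move=> /andP[t0 t1] hg; have B0 := sobolev_fun_ge0 hg.
have tB : tau / 8 * B <= tau * B by rewrite ler_wpM2r//; lra.
have h : sf (tau / 8 * B) (fun x => (- (tau / 8) * g x)%:C).
  have := sobolev_funZ (- (tau / 8))%:C hg.
  rewrite normc_real normrN ger0_norm ?divr_ge0//.
  by apply: sobolev_fun_eq => x; rewrite rmorphM.
apply: sobolev_fun_le (sobolev_fun_expiB1 ds A1 hA h).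
rewrite [leRHS]mulrA; apply: ler_pM => //; rewrite ?expR_ge0 ?mulr_ge0 ?divr_ge0//.
by rewrite ler_expR ler_wpM2l ?A_ge0// (le_trans tB)// ler_piMl.
Qed.

Definition phase_bound B : R := 3 * A * B ^+ 2 * expR (A * (3 * A * B ^+ 2)).

Definition flow_bound B : R := A * phase_bound B * B.

Lemma phase_bound_ge0 B : 0 <= phase_bound B.
Proof.
by rewrite /phase_bound mulr_ge0 ?expR_ge0// mulr_ge0 ?sqr_ge0// mulr_ge0 ?A_ge0.
Qed.

Lemma sobolev_fun_density_phase B tau u v : 0 <= tau <= 1 -> sf B u -> sf B v ->
  sf (tau * phase_bound B) (fun x => expi (- (tau / 8) * density u v x) - 1).
Proof. by move=> t01 hu hv; exact: sobolev_fun_phase (sobolev_fun_density hu hv). Qed.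

Lemma sobolev_fun_flow B tau u v : 0 <= tau <= 1 -> sf B u -> sf B v ->
  sf (tau * flow_bound B) (fun x => nl_flow tau u v x - u x).
Proof.
move=> t01 hu hv; apply: (sobolev_fun_eq _
  (sobolev_fun_le _ (hA (sobolev_fun_density_phase t01 hu hv) hu))).
  by move=> x; rewrite nl_flowE; ring.
rewrite le_eqVlt; apply/orP; left; apply/eqP; rewrite /flow_bound; ring.
Qed.

Definition flow_lip B E : R := A * phase_bound B +
  A * B * (6 * A * B * expR (A * (6 * A * B * E))) * (1 + A * phase_bound B).

Lemma sobolev_fun_flow_diff B E e tau u v U V : 0 <= tau <= 1 -> e <= E ->
  sf B u -> sf B v -> sf B U -> sf B V ->
  sf e (fun x => u x - U x) -> sf e (fun x => v x - V x) ->
  sf (tau * flow_lip B E * e)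
    (fun x => (nl_flow tau u v x - u x) - (nl_flow tau U V x - U x)).
Proof.
move=> t01 eE hu hv hU hV du dv; have /andP[t0 t1] := t01.
have B0 := sobolev_fun_ge0 hu; have e0 := sobolev_fun_ge0 du; have A0 := A_ge0.
have p1 := sobolev_fun_density_phase t01 hu hv.
have p2 : sf (phase_bound B) (fun x => expi (- (tau / 8) * density U V x) - 1).
  apply: sobolev_fun_le (sobolev_fun_density_phase t01 hU hV).
  by rewrite ler_piMl// phase_bound_ge0.
pose M2 := 6 * A * B * expR (A * (6 * A * B * E)).
have p3 : sf (tau * e * M2)
    (fun x => expi (- (tau / 8) * (density u v x - density U V x)) - 1).
  apply: sobolev_fun_le (sobolev_fun_phase t01 (sobolev_fun_density_diff hu hv hU hV du dv)).
  have -> : tau * e * M2 = tau * (6 * A * B * e * expR (A * (6 * A * B * E))).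
    by rewrite /M2; ring.
  have AB0 : 0 <= 6 * A * B by rewrite mulr_ge0// mulr_ge0.
  rewrite ler_wpM2l// ler_wpM2l//; first exact: mulr_ge0.
  by rewrite ler_expR ler_wpM2l// ler_wpM2l.
have h := sobolev_funD (hA p1 du) (hA (sobolev_funD p3 (hA p2 p3)) hU).
apply: (sobolev_fun_eq _ (sobolev_fun_le _ h)) => [x|].
  rewrite !nl_flowE; set a := - (tau / 8).
  have -> : expi (a * density u v x) =
      expi (a * density U V x) * expi (a * (density u v x - density U V x)).
    by rewrite -expiD; congr expi; ring.
  ring.
rewrite le_eqVlt; apply/orP; left; apply/eqP; rewrite /flow_lip -/M2; ring.
Qed.

Lemma sobolev_fun_cubic B u v : sf B u -> sf B v -> sf (3 * A ^+ 2 * B ^+ 3) (cubic u v).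
Proof.
move=> hu hv; apply: (sobolev_fun_eq _ (sobolev_fun_le _ (hA (sobolev_fun_density hu hv) hu))).
  by move=> x; rewrite densityE.
rewrite le_eqVlt; apply/orP; left; apply/eqP; ring.
Qed.

Lemma sobolev_fun_cubic_diff B e u v U V : sf B u -> sf B v -> sf B U -> sf B V ->
  sf e (fun x => u x - U x) -> sf e (fun x => v x - V x) ->
  sf (9 * A ^+ 2 * B ^+ 2 * e) (fun x => cubic u v x - cubic U V x).
Proof.
move=> hu hv hU hV du dv.
have h := sobolev_funD (hA (sobolev_fun_density hu hv) du)
  (hA (sobolev_fun_density_diff hu hv hU hV du dv) hU).
apply: (sobolev_fun_eq _ (sobolev_fun_le _ h)) => [x|].
  by rewrite rmorphB/= !densityE /cubic; ring.
rewrite le_eqVlt; apply/orP; left; apply/eqP; ring.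
Qed.

Lemma sobolev_fun_trilinear B (eta : R) (z1 z2 z3 : C) u v :
  normc z1 <= eta -> normc z2 <= eta -> normc z3 <= eta -> sf B u -> sf B v ->
  sf (eta * (5 * A ^+ 2 * B ^+ 3)) (fun x => z1 * (u x ^+ 2 * v x)
    + z2 * ((2 * `|u x| ^+ 2 + `|v x| ^+ 2) * (v x)^*)
    + z3 * ((v x)^* ^+ 2 * (u x)^*)).
Proof.
move=> n1 n2 n3 hu hv; have B0 := sobolev_fun_ge0 hu.
have A0 := A_ge0; have vJ := sobolev_funJ hv; have uJ := sobolev_funJ hu.
have h1 := sobolev_funZ z1 (hA (hA hu hu) hv).
have h2 := sobolev_funZ z2 (hA (sobolev_fun_density hv hu) vJ).
have h3 := sobolev_funZ z3 (hA (hA vJ vJ) uJ).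
apply: (sobolev_fun_eq _ (sobolev_fun_le _ (sobolev_funD (sobolev_funD h1 h2) h3))) => [x|].
  by rewrite densityE (addrC (`|v x| ^+ 2)) !expr2.
have t0 : 0 <= A ^+ 2 * B ^+ 3 by rewrite mulr_ge0 ?exprn_ge0.
have -> : eta * (5 * A ^+ 2 * B ^+ 3) = eta * (A * (A * B * B) * B) +
  eta * (A * (3 * A * B ^+ 2) * B) + eta * (A * (A * B * B) * B) by ring.
by rewrite !lerD// ler_wpM2r// !mulr_ge0// ?sqr_ge0.
Qed.

End nonlinear_estimates.

(** * Symbols *)

Section symbols.
Context (R : realType) (d : nat).
Local Notation C := R[i].
Local Notation normc := (@Normc.normc R).
Implicit Types (k : 'rV[int]_d) (c delta t tau th : R).

Lemma min1_le_powR (X p : R) : 0 < X -> 0 <= p <= 1 -> Num.min 1 X <= X `^ p.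
Proof.
move=> X0 /andP[p0 p1]; have [X1|/ltW X1] := leP 1 X.
  by rewrite -(powRr0 X) ler_powR.
by rewrite ger1_powR// X0.
Qed.

Lemma jap_sq c k : jap c k ^+ 2 = sqk R k + c ^+ 2.
Proof. by rewrite sqr_sqrtr// addr_ge0 ?sqk_ge0 ?sqr_ge0. Qed.

Lemma jap_ge c k : 0 < c -> c <= jap c k.
Proof.
move=> c0; rewrite -(ler_sqr (ltW c0) (sqrtr_ge0 _)) jap_sq lerDr.
exact: sqk_ge0.
Qed.

Lemma jap_subr c k : 0 < c -> 0 <= jap c k - c <= sqk R k / (2 * c).
Proof.
move=> c0; have jc := jap_ge k c0; rewrite subr_ge0 jc/= ler_pdivlMr ?mulr_gt0//.
have := jap_sq c k; have := sqr_ge0 (jap c k - c); nra.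
Qed.

(* A_c - |k|^2/2 is exactly -(jap - c)^2/2, of size |k|^4/(8 c^2). *)
Lemma Acal_half c k : 0 < c ->
  `|Acal c k - sqk R k / 2| <= (1 + sqk R k) ^+ 2 / c ^+ 2.
Proof.
move=> c0; have /andP[j0 j1] := jap_subr k c0.
have -> : Acal c k - sqk R k / 2 = - ((jap c k - c) ^+ 2 / 2).
  have -> : sqk R k = jap c k ^+ 2 - c ^+ 2 by rewrite jap_sq addrK.
  by rewrite /Acal; field.
rewrite normrN ger0_norm ?divr_ge0 ?sqr_ge0//.
have s0 := sqk_ge0 R k.
apply: (@le_trans _ _ ((sqk R k / (2 * c)) ^+ 2 / 2)).
  by rewrite ler_wpM2r// lerXn2r// nnegrE// divr_ge0// mulr_ge0// ltW.
have -> : (sqk R k / (2 * c)) ^+ 2 / 2 = (sqk R k ^+ 2 / 8) / c ^+ 2.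
  by field; rewrite gt_eqF.
rewrite ler_wpM2r ?invr_ge0 ?sqr_ge0//; nra.
Qed.

Definition phase_defect c t k : C := expi (t * (Acal c k - sqk R k / 2)).

Lemma normc_phase_defect c delta t k : 0 < c -> 0 <= delta <= 2 -> 0 <= t <= 1 ->
  normc (phase_defect c t k - 1) <= 2 * c `^ (- delta) * (1 + sqk R k) `^ delta.
Proof.
move=> c0 /andP[d0 d2] /andP[t0 t1].
have s1 := sqk1_gt0 R k.
pose X := (1 + sqk R k) ^+ 2 / c ^+ 2.
have X0 : 0 < X by rewrite divr_gt0 ?exprn_gt0.
have -> : 2 * c `^ (- delta) * (1 + sqk R k) `^ delta = 2 * X `^ (delta / 2).
  have E x : 0 < x -> (x ^+ 2) `^ (delta / 2) = x `^ delta.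
    by move=> /ltW x0; rewrite -powR_mulrn// -powRrM; congr (_ `^ _); field.
  rewrite /X powRM ?sqr_ge0 ?invr_ge0 ?sqr_ge0// E//.
  rewrite -[(c ^+ 2)^-1]powR_inv1 ?sqr_ge0// powRAC E// powR_inv1 ?powR_ge0//.
  by rewrite powRN; ring.
apply: (@le_trans _ _ (2 * Num.min 1 X)); last first.
  by rewrite ler_wpM2l// min1_le_powR//; apply/andP; split; lra.
have h1 : normc (phase_defect c t k - 1) <= 2 by exact: normc_expiB1_le2.
have h2 : normc (phase_defect c t k - 1) <= X.
  apply: le_trans (normc_expiB1_le _) _; rewrite normrM (ger0_norm t0).
  apply: le_trans (Acal_half k c0); rewrite ler_piMl//.
by case: (leP 1 X) => _; lra.
Qed.

Lemma normc_jap_defect c delta k : 0 < c -> 0 <= delta <= 2 ->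
  normc (c / jap c k - 1)%:C <= c `^ (- delta) * (1 + sqk R k) `^ delta.
Proof.
move=> c0 /andP[d0 d2]; have s1 := sqk1_gt0 R k.
have /andP[j0 j1] := jap_subr k c0; have jc := jap_ge k c0.
have jp : 0 < jap c k := lt_le_trans c0 jc.
pose X := (1 + sqk R k) / c ^+ 2.
have X0 : 0 < X by rewrite divr_gt0 ?exprn_gt0.
apply: (@le_trans _ _ (X `^ (delta / 2))); last first.
  rewrite /X powRM ?invr_ge0 ?sqr_ge0 ?(ltW s1)// mulrC.
  have -> : (c ^+ 2)^-1 `^ (delta / 2) = c `^ (- delta).
    rewrite -powR_invn; last exact: ltW.
    by rewrite -powRrM; congr (_ `^ _); field.
  rewrite ler_wpM2l ?powR_ge0// ler_powR ?sqk1_ge1//; lra.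
apply: le_trans (min1_le_powR X0 _); last by apply/andP; split; lra.
rewrite normc_real.
have -> : c / jap c k - 1 = - ((jap c k - c) / jap c k) by field; rewrite gt_eqF.
rewrite normrN ger0_norm ?divr_ge0 ?(ltW jp)// le_min; apply/andP; split.
  rewrite ler_pdivrMr//; lra.
rewrite /X; apply: (@le_trans _ _ ((sqk R k / (2 * c)) / c)).
  by rewrite ler_pM ?invr_ge0 ?(ltW jp)// lef_pV2.
have -> : sqk R k / (2 * c) / c = (sqk R k / 2) / c ^+ 2 by field; rewrite gt_eqF.
rewrite ler_wpM2r ?invr_ge0 ?sqr_ge0//; have := sqk_ge0 R k; lra.
Qed.

Lemma normc_jap_ratio c k : 0 < c -> normc (c / jap c k)%:C <= 1.
Proof.
move=> c0; have jc := jap_ge k c0; have jp : 0 < jap c k := lt_le_trans c0 jc.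
by rewrite normc_real ger0_norm ?divr_ge0 ?(ltW jp) ?(ltW c0)// ler_pdivrMr// mul1r.
Qed.

Lemma normc_jap_defect1 c k : 0 < c -> normc (c / jap c k - 1)%:C <= 1.
Proof.
move=> c0; have := @normc_jap_defect c 0 k c0; rewrite oppr0 !powRr0 mulr1.
by apply; rewrite lexx/= ler0n.
Qed.

Lemma normc_phi1 th : th != 0 -> normc (phi1 ('i * th%:C)) <= 2 / `|th|.
Proof.
move=> th0; rewrite /phi1.
have -> : ('i * th%:C == 0 :> C) = false.
  apply/negP; rewrite mulf_eq0 => /orP[/eqP[]/eqP|/eqP[]/eqP]; first by rewrite oner_eq0.
  by rewrite (negbTE th0).
rewrite cexp_i Normc.normcM Normc.normcV Normc.normcM normc_real.
rewrite /= expr0n expr1n add0r sqrtr1 mul1r ler_wpM2r ?invr_ge0//.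
exact: normc_expiB1_le2.
Qed.

Lemma normc_osc_coeff c delta tau t (m : R) : 0 < c -> 0 < tau ->
  1 <= tau * c `^ (2 - delta) -> 2 <= `|m| ->
  normc (expi t * phi1 ('i * (m * (c ^+ 2 * tau))%:C)) <= c `^ (- delta).
Proof.
move=> c0 t0 ct m2; rewrite Normc.normcM normc_expi mul1r.
have p0 : 0 < c ^+ 2 * tau by rewrite mulr_gt0 ?exprn_gt0.
have m0 : 0 < `|m| by lra.
have mN : m * (c ^+ 2 * tau) != 0.
  by apply: mulf_neq0; [rewrite -normr_gt0|rewrite gt_eqF].
apply: le_trans (normc_phi1 mN) _; rewrite normrM (gtr0_norm p0).
rewrite ler_pdivrMr ?mulr_gt0//.
have E : c `^ (2 - delta) = c ^+ 2 * c `^ (- delta).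
  by rewrite powRD ?(gt_eqF c0) ?implybT// powR_mulrn// ltW.
have q : 1 <= c `^ (- delta) * (c ^+ 2 * tau) by move: ct; rewrite E; lra.
rewrite mulrCA; nra.
Qed.

End symbols.

(** * Error recursion *)

Section scheme_steps.
Context (R : realType) (d : nat).
Local Notation C := R[i].
Local Notation normc := (@Normc.normc R).
Variables (s A : R).
Hypotheses (ds : d%:R / 2 < s) (A1 : 1 <= A) (hA : forall B B' (f g : torus_fun R d),
  sobolev_fun s B f -> sobolev_fun s B' g ->
  sobolev_fun s (A * B * B') (fun x => f x * g x)).
Implicit Types (u v : torus_fun R d) (B c tau t delta : R) (k : 'rV[int]_d).
Local Notation sf := (sobolev_fun s).

Lemma imag_arg (m c t : R) (z : C) : z = m%:C ->
  z * ('i * (c ^+ 2)%:C) * t%:C = 'i * (m * (c ^+ 2 * t))%:C.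
Proof. by move=> ->; rewrite !rmorphM; ring. Qed.

Lemma sobolev_fun_oscillatory B c delta tau t u v : 0 < c -> 0 < tau ->
  1 <= tau * c `^ (2 - delta) -> sf B u -> sf B v ->
  sf (c `^ (- delta) * (5 * A ^+ 2 * B ^+ 3)) (oscillatory c tau t u v).
Proof.
move=> c0 t0 ct hu hv.
have e2 : 2 = (2 : R)%:C :> C by rewrite rmorph_nat.
have eN2 : - 2 = (- 2 : R)%:C :> C by rewrite rmorphN rmorph_nat.
have eN4 : - 4 = (- 4 : R)%:C :> C by rewrite rmorphN rmorph_nat.
have N2 : 2 <= `|2 : R| by rewrite ger0_norm.
have NN2 : 2 <= `|- 2 : R| by rewrite normrN ger0_norm.
have NN4 : 2 <= `|- 4 : R| by rewrite normrN ger0_norm//; lra.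
apply: (sobolev_fun_trilinear A1 hA _ _ _ hu hv).
- by rewrite !(imag_arg _ _ e2) cexp_i; exact: normc_osc_coeff.
- by rewrite !(imag_arg _ _ eN2) cexp_i; exact: normc_osc_coeff.
- by rewrite !(imag_arg _ _ eN4) cexp_i; exact: normc_osc_coeff.
Qed.

Definition flow_increment tau u v : torus_fun R d :=
  fun x => nl_flow tau u v x - u x.

Lemma sobolev_fun_nl_flow M B tau u v : 0 <= tau <= 1 -> sf M u -> sf B u -> sf B v ->
  sf (M + tau * flow_bound A B) (nl_flow tau u v) /\
  forall k, fourier (nl_flow tau u v) k =
    fourier u k + fourier (flow_increment tau u v) k.
Proof.
move=> t01 uM uB vB; have fB := sobolev_fun_flow ds A1 hA t01 uB vB.
have -> : nl_flow tau u v = (fun x => u x + flow_increment tau u v x).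
  by apply/funext => x; rewrite /flow_increment addrC subrK.
split; first exact: sobolev_funD.
by move=> k; rewrite fourierD//; [exact: uM.1|exact: fB.1].
Qed.

Lemma sobolev_fun_nls_step M B tau u v : 0 <= tau <= 1 -> sf M u -> sf B u -> sf B v ->
  sf (M + tau * flow_bound A B) (nls_step tau u v) /\
  forall k, fourier (nls_step tau u v) k = expi (tau * (sqk R k / 2)) *
    (fourier u k + fourier (flow_increment tau u v) k).
Proof.
move=> t01 uM uB vB; have [fB fE] := sobolev_fun_nl_flow t01 uM uB vB.
have n1 k : normc (cexp ('i * (tau * (sqk R k / 2))%:C)) <= 1.
  by rewrite cexp_i normc_expi.
have [hB hE] := sobolev_fun_fmult ds ler01 n1 fB.
split; first by rewrite -[X in sf X]mul1r.
by move=> k; rewrite hE /multiplier fE cexp_i.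
Qed.

Lemma sobolev_fun_kg_step B c delta tau t u v : 0 < c -> 0 < tau <= 1 ->
  1 <= tau * c `^ (2 - delta) -> sf B u -> sf B v ->
  (exists B', sf B' (kg_step c tau t u v)) /\
  forall k, fourier (kg_step c tau t u v) k = expi (tau * Acal c k) *
    (fourier u k + fourier (flow_increment tau u v) k
     - tau%:C * ('i / 8) * ((c / jap c k - 1)%:C * fourier (cubic u v) k)
     - tau%:C * ('i / 8) * ((c / jap c k)%:C * fourier (oscillatory c tau t u v) k)).
Proof.
move=> c0 /andP[t0 t1] ct uB vB.
have t01 : 0 <= tau <= 1 by rewrite ltW.
have [fB fE] := sobolev_fun_nl_flow t01 uB uB vB.
have cB := sobolev_fun_cubic hA uB vB.
have oB := sobolev_fun_oscillatory t c0 t0 ct uB vB.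
pose eA k : C := cexp ('i * (tau * Acal c k)%:C).
have n1 k : normc (eA k) <= 1 by rewrite /eA cexp_i normc_expi.
have n2 k : normc ((c / jap c k - 1)%:C * eA k) <= 1.
  by rewrite Normc.normcM /eA cexp_i normc_expi mulr1 normc_jap_defect1.
have n3 k : normc ((c / jap c k)%:C * eA k) <= 1.
  by rewrite Normc.normcM /eA cexp_i normc_expi mulr1 normc_jap_ratio.
have [h1 e1] := sobolev_fun_fmult ds ler01 n1 fB.
have [h2 e2] := sobolev_fun_fmult ds ler01 n2 cB.
have [h3 e3] := sobolev_fun_fmult ds ler01 n3 oB.
have [z zE] : exists z : C, z = tau%:C * ('i / 8) by eexists.
have h2' := sobolev_funZ z h2.
have h3' := sobolev_funZ z h3.
have h12 := sobolev_funB h1 h2'.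
rewrite /kg_step -zE; split; first by eexists; exact: sobolev_funB h12 h3'.
move=> k.
have F1 := congr1 (fun a => a k) e1.
have F2 := etrans (fourierZ z k h2.1) (congr1 (fun a => z * a k) e2).
have F3 := etrans (fourierZ z k h3.1) (congr1 (fun a => z * a k) e3).
have F12 := etrans (fourierB k h1.1 h2'.1) (congr2 (fun a b => a - b) F1 F2).
have F := etrans (fourierB k h12.1 h3'.1) (congr2 (fun a b => a - b) F12 F3).
have eAE : eA k = expi (tau * Acal c k) by exact: cexp_i.
apply: (etrans F); rewrite /multiplier eAE fE; ring.
Qed.

End scheme_steps.

Section error_recursion.
Context (R : realType) (d : nat).
Local Notation C := R[i].
Local Notation normc := (@Normc.normc R).
Variables (r delta A : R).
Hypotheses (dr : d%:R / 2 < r) (dd : 0 < delta <= 2) (A1 : 1 <= A).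
Local Notation s := (r + 2 * delta).
Hypotheses (hAr : forall B B' (f g : torus_fun R d),
  sobolev_fun r B f -> sobolev_fun r B' g ->
  sobolev_fun r (A * B * B') (fun x => f x * g x)).
Hypotheses (hAs : forall B B' (f g : torus_fun R d),
  sobolev_fun s B f -> sobolev_fun s B' g ->
  sobolev_fun s (A * B * B') (fun x => f x * g x)).
Implicit Types (u v U V : torus_fun R d) (B c tau t : R) (k : 'rV[int]_d).

Lemma le_smooth : r <= s.
Proof. by have /andP[] := dd; lra. Qed.

Lemma half_dim_lt_smooth : d%:R / 2 < s.
Proof. exact: lt_le_trans dr le_smooth. Qed.

Lemma sobolev_ball_gain M B (m : 'rV[int]_d -> C) (a : torus_distr R d) : 0 <= M ->
  (forall k, normc (m k) <= M * (1 + sqk R k) `^ delta) ->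
  sobolev_ball s B a -> sobolev_ball r (M * B) (fun k => m k * a k).
Proof.
move=> M0 hm; apply: sobolev_ball_multiplier => // k.
have -> : weight s k = weight r k * ((1 + sqk R k) `^ delta) ^+ 2 :> R.
  by rewrite weightD; congr (_ * _); rewrite -powR_mulrn ?powR_ge0// -powRrM mulrC.
rewrite [leRHS]mulrCA -[in leRHS]exprMn ler_wpM2l ?(ltW (weight_gt0 _ _))//.
by rewrite lerXn2r// nnegrE ?normc_ge0// mulr_ge0 ?powR_ge0.
Qed.

Definition step_constant B E : R := flow_lip A (B + E) E * E + 2 * flow_bound A B +
  9 * A ^+ 2 * (B + E) ^+ 2 * E + 3 * A ^+ 2 * B ^+ 3 + 5 * A ^+ 2 * (B + E) ^+ 3.

Lemma error_step B E e b c tau t t' u v U V :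
  0 < c -> c `^ (- delta) <= 1 -> 0 < tau <= 1 -> 0 <= t <= 1 ->
  1 <= tau * c `^ (2 - delta) -> 0 <= E -> e = c `^ (- delta) * E ->
  sobolev_fun s B U -> sobolev_fun s B V ->
  sobolev_fun r (B + E) u -> sobolev_fun r (B + E) v ->
  sobolev_fun r e (fun x => u x - U x) -> sobolev_fun r e (fun x => v x - V x) ->
  sobolev_ball r b (fun k => fourier u k - phase_defect c t k * fourier U k) ->
  sobolev_ball r (b + tau * (c `^ (- delta) * step_constant B E)) (fun k =>
    fourier (kg_step c tau t' u v) k -
    phase_defect c (t + tau) k * fourier (nls_step tau U V) k).
Proof.
move=> c0 c1 t01' tt ct E0 eE hU hV hu hv du dv hb.
have /andP[t0 t1] := t01'.
have t01 : 0 <= tau <= 1 by rewrite ltW.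
have cd0 : 0 <= c `^ (- delta) by exact: powR_ge0.
have B0 := sobolev_fun_ge0 hU.
have eE' : e <= E by rewrite eE ler_piMl.
have BE : B <= B + E by rewrite lerDl.
have hUr : sobolev_fun r (B + E) U := sobolev_funW le_smooth BE hU.
have hVr : sobolev_fun r (B + E) V := sobolev_funW le_smooth BE hV.
have [[B' hk] kE] := sobolev_fun_kg_step dr A1 hAr t' c0 t01' ct hu hv.
have [hn nE] := sobolev_fun_nls_step half_dim_lt_smooth A1 hAs t01 hU hU hV.
have dfl := sobolev_fun_flow_diff dr A1 hAr t01 eE' hu hv hUr hVr du dv.
have fl := sobolev_fun_flow half_dim_lt_smooth A1 hAs t01 hU hV.
have dcu := sobolev_fun_cubic_diff hAr hu hv hUr hVr du dv.
have cu := sobolev_fun_cubic hAs hU hV.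
have os := sobolev_fun_oscillatory A1 hAr t' c0 t0 ct hu hv.
have dde : 0 <= delta <= 2 by case/andP: dd => /ltW -> ->.
have hq := sobolev_ball_gain (mulr_ge0 (ler0n R 2) cd0)
  (fun k => normc_phase_defect k c0 dde tt) fl.2.
have hcu := sobolev_ball_gain cd0 (fun k => normc_jap_defect k c0 dde) cu.2.
have hdcu := sobolev_ballM ler01 (fun k => normc_jap_defect1 k c0) dcu.2.
have hos := sobolev_ballM ler01 (fun k => normc_jap_ratio k c0) os.2.
pose z : C := tau%:C * ('i / 8).
have nz : normc z <= tau.
  have e8 : 8 = (8 : R)%:C :> C by rewrite rmorph_nat.
  rewrite /z e8 !Normc.normcM Normc.normcV !normc_real (ger0_norm (ltW t0)).
  rewrite /= expr0n expr1n add0r sqrtr1 mul1r ger0_norm//; lra.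
have zB b' (a : torus_distr R d) : sobolev_ball r b' a ->
    sobolev_ball r (tau * b') (fun k => z * a k).
  move=> ha; have b'0 := sobolev_ball_ge0 ha.
  by apply: sobolev_ballW (sobolev_ballZ z ha) => //; rewrite ler_wpM2r.
have h := sobolev_ballB (sobolev_ballB (sobolev_ballB (sobolev_ballB (sobolev_ballD hb dfl.2) hq)
  (zB _ _ hdcu)) (zB _ _ hcu)) (zB _ _ hos).
have ne k : normc (expi (tau * Acal c k)) <= 1 by rewrite normc_expi.
have := sobolev_ballM ler01 ne h; rewrite mul1r => hh.
have hle : b + tau * flow_lip A (B + E) E * e + 2 * c `^ (- delta) * (tau * flow_bound A B) +
    tau * (1 * (9 * A ^+ 2 * (B + E) ^+ 2 * e)) +
    tau * (c `^ (- delta) * (3 * A ^+ 2 * B ^+ 3)) +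
    tau * (1 * (c `^ (- delta) * (5 * A ^+ 2 * (B + E) ^+ 3))) =
    b + tau * (c `^ (- delta) * step_constant B E).
  by rewrite eE /step_constant; ring.
rewrite -hle; move: hh; congr (sobolev_ball _ _ _); apply/funext => k.
have cfl : Cintegrable (flow_increment tau u v) := (sobolev_fun_flow dr A1 hAr t01 hu hv).1.
have cfL : Cintegrable (flow_increment tau U V) := fl.1.
have cc := (sobolev_fun_cubic hAr hu hv).1.
rewrite kE nE (fourierB k cfl cfL) (fourierB k cc cu.1).
have -> : phase_defect c (t + tau) k * (expi (tau * (sqk R k / 2)) *
    (fourier U k + fourier (flow_increment tau U V) k)) =
    expi (tau * Acal c k) * (phase_defect c t k *
    (fourier U k + fourier (flow_increment tau U V) k)).
  rewrite /phase_defect !mulrA -!expiD; congr (_ * _ ); congr expi; ring.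
rewrite -/z; ring.
Qed.

End error_recursion.

Section scheme_error.
Context (R : realType) (d : nat).
Local Notation C := R[i].
Local Notation normc := (@Normc.normc R).
Variables (r delta A : R).
Hypotheses (dr : d%:R / 2 < r) (dd : 0 < delta <= 2) (A1 : 1 <= A).
Local Notation s := (r + 2 * delta).
Hypotheses (hAr : forall B B' (f g : torus_fun R d),
  sobolev_fun r B f -> sobolev_fun r B' g ->
  sobolev_fun r (A * B * B') (fun x => f x * g x)).
Hypotheses (hAs : forall B B' (f g : torus_fun R d),
  sobolev_fun s B f -> sobolev_fun s B' g ->
  sobolev_fun s (A * B * B') (fun x => f x * g x)).
Implicit Types (u v U V : torus_fun R d) (B c tau t : R) (k : 'rV[int]_d).

Lemma defect_error B b c t u U : 0 < c -> 0 <= t <= 1 ->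
  Cintegrable u -> sobolev_fun s B U ->
  sobolev_ball r b (fun k => fourier u k - phase_defect c t k * fourier U k) ->
  sobolev_fun r (b + 2 * c `^ (- delta) * B) (fun x => u x - U x).
Proof.
move=> c0 tt ui hU hb; have dde : 0 <= delta <= 2 by case/andP: dd => /ltW -> ->.
split.
  under eq_fun do rewrite -mulN1r; apply: CintegrableD => //.
  exact: CintegrableZ hU.1.
have M0 : 0 <= 2 * c `^ (- delta) by rewrite mulr_ge0 ?powR_ge0.
have hq := sobolev_ball_gain M0 (fun k => normc_phase_defect k c0 dde tt) hU.2.
have := sobolev_ballD hb hq; congr (sobolev_ball _ _ _); apply/funext => k.
by rewrite fourierB//; [ring|exact: hU.1].
Qed.

Variables (M kr c tau T : R) (z0 : torus_fun R d) (z1 : torus_distr R d)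
  (phi gamma : torus_fun R d).
Local Notation u n := (kg_scheme c tau z0 z1 n).1.
Local Notation v n := (kg_scheme c tau z0 z1 n).2.
Local Notation U n := (nls_splitting tau phi gamma n).1.
Local Notation V n := (nls_splitting tau phi gamma n).2.
Local Notation B := (M + 1).
Local Notation E := (kr + 1 + 2 * B).
Local Notation F := (flow_bound A B).
Local Notation L := (step_constant A B E).
Hypotheses (c0 : 0 < c) (c1 : c `^ (- delta) <= 1) (t01 : 0 < tau <= 1)
  (ct : 1 <= tau * c `^ (2 - delta)) (kr0 : 0 <= kr) (T1 : T <= 1)
  (TF : T * F <= 1) (TL : T * L <= 1).
Hypotheses (U0 : sobolev_fun s M (U 0%N)) (V0 : sobolev_fun s M (V 0%N))
  (u0 : Cintegrable (u 0%N)) (v0 : Cintegrable (v 0%N))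
  (du0 : sobolev_ball r (kr * c `^ (- delta)) (fun k => fourier (u 0%N) k - fourier (U 0%N) k))
  (dv0 : sobolev_ball r (kr * c `^ (- delta)) (fun k => fourier (v 0%N) k - fourier (V 0%N) k)).

Lemma kg_schemeS n : u n.+1 = kg_step c tau (n%:R * tau) (u n) (v n) /\
  v n.+1 = kg_step c tau (n%:R * tau) (v n) (u n).
Proof. by rewrite /=; case: (kg_scheme _ _ _ _ n). Qed.

Lemma nls_splittingS n : U n.+1 = nls_step tau (U n) (V n) /\
  V n.+1 = nls_step tau (V n) (U n).
Proof. by rewrite /=; case: (nls_splitting _ _ _ n). Qed.

Let M0 : 0 <= M := sobolev_fun_ge0 U0.
Let A0 : 0 <= A := A_ge0 A1.
Let B0 : 0 <= B. Proof. by rewrite addr_ge0. Qed.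
Let E0 : 0 <= E. Proof. by rewrite !addr_ge0// mulr_ge0. Qed.
Let cd0 : 0 <= c `^ (- delta). Proof. exact: powR_ge0. Qed.

Let F0 : 0 <= F.
Proof. by rewrite /flow_bound mulr_ge0// mulr_ge0// phase_bound_ge0. Qed.

Let L0 : 0 <= L.
Proof.
have BE0 : 0 <= B + E by exact: (addr_ge0 B0 E0).
rewrite /step_constant; apply: addr_ge0;
  [apply: addr_ge0; [apply: addr_ge0; [apply: addr_ge0|]|]|].
- apply: mulr_ge0 => //; rewrite /flow_lip; apply: addr_ge0.
    by rewrite mulr_ge0// phase_bound_ge0.
  apply: mulr_ge0; last by rewrite addr_ge0// mulr_ge0// phase_bound_ge0.
  apply: mulr_ge0; first exact: mulr_ge0.
  by rewrite mulr_ge0 ?expR_ge0// mulr_ge0// mulr_ge0.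
- by rewrite mulr_ge0.
- by rewrite mulr_ge0// mulr_ge0 ?exprn_ge0// mulr_ge0 ?exprn_ge0.
- by rewrite mulr_ge0 ?exprn_ge0// mulr_ge0 ?exprn_ge0.
- by rewrite mulr_ge0 ?exprn_ge0// mulr_ge0 ?exprn_ge0.
Qed.

Let le_error n : n%:R * tau <= T ->
  c `^ (- delta) * (kr + n%:R * tau * L) + 2 * c `^ (- delta) * B <=
  c `^ (- delta) * E.
Proof.
move=> nT; have h : n%:R * tau * L <= 1 by rewrite (le_trans _ TL)// ler_wpM2r.
have := ler_wpM2l cd0 h; lra.
Qed.

Lemma nls_splitting_bounded n : n%:R * tau <= T ->
  sobolev_fun s (M + n%:R * tau * F) (U n) /\ sobolev_fun s (M + n%:R * tau * F) (V n).
Proof.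
have /andP[t0 t1] := t01; have t01' : 0 <= tau <= 1 by rewrite ltW.
elim: n => [|n ih] nT; first by rewrite !mul0r addr0.
have nT' : n%:R * tau <= T by apply: le_trans nT; rewrite ler_wpM2r ?(ltW t0)// ler_nat.
have [hU hV] := ih nT'.
have leB : M + n%:R * tau * F <= B.
  by rewrite lerD2l (le_trans _ TF)// ler_wpM2r.
have hUB := sobolev_funW (lexx s) leB hU; have hVB := sobolev_funW (lexx s) leB hV.
have dss := half_dim_lt_smooth dr dd.
have [-> ->] := nls_splittingS n.
have -> : M + n.+1%:R * tau * F = M + n%:R * tau * F + tau * F.
  by rewrite -natr1; ring.
split; first exact: (sobolev_fun_nls_step dss A1 hAs t01' hU hUB hVB).1.
exact: (sobolev_fun_nls_step dss A1 hAs t01' hV hVB hUB).1.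
Qed.

Lemma nls_splitting_ball n : n%:R * tau <= T ->
  sobolev_fun s B (U n) /\ sobolev_fun s B (V n).
Proof.
move=> nT; have [hU hV] := nls_splitting_bounded nT.
have leB : M + n%:R * tau * F <= B.
  by rewrite lerD2l (le_trans _ TF)// ler_wpM2r.
by split; apply: sobolev_funW leB _.
Qed.

Lemma scheme_defect n : n%:R * tau <= T ->
  [/\ Cintegrable (u n), Cintegrable (v n),
  sobolev_ball r (c `^ (- delta) * (kr + n%:R * tau * L)) (fun k =>
    fourier (u n) k - phase_defect c (n%:R * tau) k * fourier (U n) k) &
  sobolev_ball r (c `^ (- delta) * (kr + n%:R * tau * L)) (fun k =>
    fourier (v n) k - phase_defect c (n%:R * tau) k * fourier (V n) k)].
Proof.
have /andP[t0 t1] := t01.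
elim: n => [|n ih] nT.
  have q0 k : phase_defect c 0 k = 1.
    by rewrite /phase_defect mul0r expi0.
  rewrite !mul0r addr0 mulrC; split=> //.
    by under eq_fun do rewrite q0 mul1r.
  by under eq_fun do rewrite q0 mul1r.
have nT' : n%:R * tau <= T by apply: le_trans nT; rewrite ler_wpM2r ?(ltW t0)// ler_nat.
have nt : 0 <= n%:R * tau <= 1 by rewrite mulr_ge0 ?(ltW t0)//= (le_trans nT').
have [ui vi hu hv] := ih nT'; have [hU hV] := nls_splitting_ball nT'.
pose e := c `^ (- delta) * E.
have le_e := le_error nT'.
have du := sobolev_funW (lexx r) le_e (defect_error c0 nt ui hU hu).
have dv := sobolev_funW (lexx r) le_e (defect_error c0 nt vi hV hv).
have eE : e <= E by rewrite /e ler_piMl.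
have bound (f g : torus_fun R d) : sobolev_fun s B g -> sobolev_fun r e (fun x => f x - g x) ->
    sobolev_fun r (B + E) f.
  move=> hg df; have hgr := sobolev_funW (le_smooth r dd) (lexx B) hg.
  have := sobolev_funD hgr df; under eq_fun do rewrite addrC subrK.
  by apply: sobolev_funW; rewrite ?lerD2l.
have hub := bound _ _ hU du; have hvb := bound _ _ hV dv.
have [-> ->] := kg_schemeS n; have [-> ->] := nls_splittingS n.
have -> : c `^ (- delta) * (kr + n.+1%:R * tau * L) =
    c `^ (- delta) * (kr + n%:R * tau * L) + tau * (c `^ (- delta) * L).
  by rewrite -natr1; ring.
have -> : n.+1%:R * tau = n%:R * tau + tau by rewrite -natr1; ring.
split.
- by have [[B' []]] := sobolev_fun_kg_step dr A1 hAr (n%:R * tau) c0 t01 ct hub hvb.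
- by have [[B' []]] := sobolev_fun_kg_step dr A1 hAr (n%:R * tau) c0 t01 ct hvb hub.
- exact: (error_step (e := e) dr dd A1 hAr hAs _ c0 c1 t01 nt ct E0).
- exact: (error_step (e := e) dr dd A1 hAr hAs _ c0 c1 t01 nt ct E0).
Qed.

Lemma scheme_error n : n%:R * tau <= T ->
  sobolev_ball r (c `^ (- delta) * E) (fourier (fun x => u n x - U n x)) /\
  sobolev_ball r (c `^ (- delta) * E) (fourier (fun x => v n x - V n x)).
Proof.
move=> nT; have [ui vi hu hv] := scheme_defect nT.
have [hU hV] := nls_splitting_ball nT.
have /andP[t0 t1] := t01; have le_e := le_error nT.
have nt : 0 <= n%:R * tau <= 1 by rewrite mulr_ge0 ?(ltW t0)//= (le_trans nT).
split; first exact: (sobolev_funW (lexx r) le_e (defect_error c0 nt ui hU hu)).2.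
exact: (sobolev_funW (lexx r) le_e (defect_error c0 nt vi hV hv)).2.
Qed.

End scheme_error.

(** * Initial data and conclusion *)

Section initial_data.
Context (R : realType) (d : nat).
Local Notation C := R[i].
Local Notation normc := (@Normc.normc R).
Implicit Types (f : torus_fun R d) (a b : torus_distr R d) (s r B c : R).

Lemma torus_L2_Cintegrable f : torus_L2 f -> Cintegrable f.
Proof.
move=> [mr mi foo]; have mD := @measurable_cube R d.
have mn : measurable_fun (@cube R d) (fun x => normc (f x) ^+ 2).
  apply: (eq_measurable_fun (fun x => complex.Re (f x) ^+ 2 + complex.Im (f x) ^+ 2)).
    by move=> x _; rewrite normc_sq.
  by apply: measurable_funD; exact: measurable_funX.
have i1 : (lebesgue_tuple R d).-integrable (@cube R d) (EFin \o cst (1 : R)).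
  by apply: (@integrable_cube_bounded _ _ _ 1) => // x _; rewrite normr1.
have i2 : (lebesgue_tuple R d).-integrable (@cube R d)
    (EFin \o (fun x => normc (f x) ^+ 2)).
  apply/integrableP; split; first exact/measurable_EFinP.
  by under eq_integral do rewrite /= ger0_norm ?sqr_ge0//.
apply: (@Cintegrable_le _ _ _ (fun x => 1 + normc (f x) ^+ 2)) => //.
  exact: (integrableD mD i1 i2).
by move=> x _; have := sqr_ge0 (normc (f x) - 1); nra.
Qed.

Lemma sobolev_norm_ge0 s a : (0 <= sobolev_norm s a)%E.
Proof. exact: sqrte_ge0. Qed.

Lemma sobolev_norm_sumP s M a b :
  (sobolev_norm s a + sobolev_norm s b <= M%:E)%E ->
  exists M1 M2 : R, [/\ sobolev_ball s M1 a, sobolev_ball s M2 b & M1 + M2 <= M].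
Proof.
have := sobolev_norm_ge0 s a; have := sobolev_norm_ge0 s b.
case Ea : (sobolev_norm s a) => [x||]//; case Eb : (sobolev_norm s b) => [y||]//.
rewrite !lee_fin => y0 x0 xy; exists x, y; split=> //; apply/sobolev_normP => //.
  by rewrite Ea.
by rewrite Eb.
Qed.

Lemma sobolev_ball_sub_i s M1 M2 M a b : M1 + M2 <= M ->
  sobolev_ball s M1 a -> sobolev_ball s M2 b ->
  sobolev_ball s M (fun k => a k - 'i * b k).
Proof.
move=> M12 ha hb; apply: (sobolev_ballW (lexx s) M12); apply: sobolev_ballB => //.
have := sobolev_ballZ 'i hb.
by rewrite (_ : normc 'i = 1) ?mul1r// /= expr0n expr1n add0r sqrtr1.
Qed.

Lemma sobolev_ball_coef s B a k : sobolev_ball s B a ->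
  normc (a k) <= B * weight (- (s / 2)) k.
Proof.
move=> [B0 /(_ [:: k] isT)]; rewrite big_seq1 weight_normc_sq => h.
have h' : weight (s / 2) k * normc (a k) <= B.
  by rewrite -ler_sqr ?nnegrE// mulr_ge0 ?normc_ge0 ?(ltW (weight_gt0 _ _)).
have := ler_wpM2r (ltW (weight_gt0 (- (s / 2)) k)) h'.
by rewrite mulrAC -weightD subrr /weight powRr0 mul1r.
Qed.

(* The bound passes to the limit c -> oo because r-convergence at rate c^-delta
   forces convergence of each Fourier coefficient. *)
Lemma sobolev_ball_limit s r delta B kr (a_ : R -> torus_distr R d) a : 0 < delta ->
  (forall c, 0 < c -> sobolev_ball s B (a_ c)) ->
  (forall c, 0 < c -> sobolev_ball r (kr * c `^ (- delta)) (fun k => a_ c k - a k)) ->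
  sobolev_ball s B a.
Proof.
move=> d0 ha hd; pose c n : R := n.+1%:R `^ (delta^-1).
have c0 n : 0 < c n by rewrite powR_gt0.
have cE n : c n `^ (- delta) = n.+1%:R^-1.
  by rewrite /c -powRrM mulrN mulVf ?gt_eqF// powR_inv1.
apply: (@sobolev_ball_lim _ _ _ _ (fun n => a_ (c n))) => [n|k]; first exact: ha.
have h n : 0 <= normc (a_ (c n) k - a k) <= kr * weight (- (r / 2)) k * harmonic n.
  rewrite normc_ge0/=; have := sobolev_ball_coef k (hd _ (c0 n)).
  by rewrite cE mulrAC.
apply: (squeeze_to0 h); rewrite -(mulr0 (kr * weight (- (r / 2)) k)).
by apply: cvgM; [exact: cvg_cst|exact: cvg_harmonic].
Qed.

Lemma multiplier_inv_cjapJ c (z1 : torus_distr R d) :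
  multiplier (inv_cjap c) (conj_distr z1) = conj_distr (multiplier (inv_cjap c) z1).
Proof.
apply/funext => k; rewrite /multiplier /conj_distr rmorphM/=; congr (_ * _).
rewrite /inv_cjap /jap sqkN; apply/esym/CrealP; rewrite complex_real//.
Qed.

End initial_data.

Theorem lemma15 (R : realType) (d : nat) (r delta eps kr : R) :
  (0 < d)%N -> d%:R / 2 < r -> 0 < delta <= 2 -> 0 < eps ->
  exists K : R -> R -> R,
  forall (M : R) (z0 : R -> torus_fun R d) (z1 : R -> torus_distr R d)
    (phi gamma : torus_fun R d),
  (forall c, 0 < c -> torus_L2 (z0 c)) -> torus_L2 phi -> torus_L2 gamma ->
  (forall c, 0 < c ->
    (sobolev_norm (r + 2 * delta + eps) (fourier (z0 c)) +
     sobolev_norm (r + 2 * delta + eps) (multiplier (inv_cjap c) (z1 c))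
       <= M%:E)%E) ->
  (forall c, 0 < c ->
    (sobolev_norm r (fourier (fun x => z0 c x - phi x)%R) +
     sobolev_norm r
       (fun k => multiplier (inv_cjap c) (z1 c) k - fourier gamma k)%R
       <= (kr * c `^ (- delta))%:E)%E) ->
  exists T tau0 : R, [/\ 0 < T, 0 < tau0 &
    forall (tau : R) (n : nat) (c : R),
      0 < tau -> tau <= tau0 -> n%:R * tau <= T -> 0 < c ->
      1 <= tau * c `^ (2 - delta) ->
      let u  := (kg_scheme c tau (z0 c) (z1 c) n).1 in
      let v  := (kg_scheme c tau (z0 c) (z1 c) n).2 in
      let uoo := (nls_splitting tau phi gamma n).1 in
      let voo := (nls_splitting tau phi gamma n).2 in
      (sobolev_norm r (fourier (fun x => u x - uoo x)%R) +
       sobolev_norm r (fourier (fun x => v x - voo x)%R)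
         <= (K M T * c `^ (- delta))%:E)%E].
Proof.
move=> _ dr dd eps0; pose s := r + 2 * delta.
have /andP[d0 d2] := dd.
have dss : d%:R / 2 < s := half_dim_lt_smooth dr dd.
have [Ar Ar1 hAr] := sobolev_funM dr; have [As As1 hAs] := sobolev_funM dss.
pose A := Ar + As; have A1 : 1 <= A by rewrite /A; lra.
have weaken q A' : 0 <= A' -> A' <= A -> (forall B B' (f g : torus_fun R d),
    sobolev_fun q B f -> sobolev_fun q B' g ->
    sobolev_fun q (A' * B * B') (fun x => f x * g x)) ->
    forall B B' (f g : torus_fun R d), sobolev_fun q B f -> sobolev_fun q B' g ->
    sobolev_fun q (A * B * B') (fun x => f x * g x).
  move=> A'0 A'A h B B' f g hf hg; apply: sobolev_funW (h _ _ _ _ hf hg) => //.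
  have B0 := sobolev_fun_ge0 hf; have B'0 := sobolev_fun_ge0 hg.
  by rewrite ler_wpM2r// ler_wpM2r.
have Ar' : 0 <= Ar by lra.
have As' : 0 <= As by lra.
have {}hAr := weaken r Ar Ar' (ltac:(rewrite /A; lra)) hAr.
have {}hAs := weaken s As As' (ltac:(rewrite /A; lra)) hAs.
pose E M := kr + 1 + 2 * (M + 1).
exists (fun M _ => 2 * E M) => M z0 z1 phi gamma Lz Lphi Lgamma HM Hk.
have ss : s <= s + eps by lra.
pose b c := multiplier (inv_cjap c) (z1 c).
have zi c : 0 < c -> Cintegrable (z0 c) by move=> /Lz; exact: torus_L2_Cintegrable.
have phi_i := torus_L2_Cintegrable Lphi; have gamma_i := torus_L2_Cintegrable Lgamma.
have kr0 : 0 <= kr.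
  have [M1 [M2 [/sobolev_ball_ge0 h1 /sobolev_ball_ge0 h2]]] := sobolev_norm_sumP (Hk 1 ltr01).
  rewrite powR1 mulr1; lra.
have zb c : 0 < c -> exists M1 M2 : R, [/\ sobolev_ball s M1 (fourier (z0 c)),
    sobolev_ball s M2 (b c) & M1 + M2 <= M].
  move=> /HM /sobolev_norm_sumP[M1 [M2 [h1 h2 h12]]]; exists M1, M2.
  by split=> //; [exact: sobolev_ballW h1|exact: sobolev_ballW h2].
have zd c : 0 < c -> exists M1 M2 : R, [/\
    sobolev_ball r M1 (fun k => fourier (z0 c) k - fourier phi k),
    sobolev_ball r M2 (fun k => b c k - fourier gamma k) &
    M1 + M2 <= kr * c `^ (- delta)].
  move=> c0; have [M1 [M2 [h1 h2 h12]]] := sobolev_norm_sumP (Hk c c0).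
  exists M1, M2; split=> //; move: h1; congr (sobolev_ball _ _ _).
  by apply/funext => k; rewrite fourierB//; exact: zi.
have initE (f : torus_fun R d) (a : torus_distr R d) B' : Cintegrable f ->
    sobolev_ball s B' a -> Cintegrable (fun x => f x - 'i * synth a x) /\
    fourier (fun x => f x - 'i * synth a x) = (fun k => fourier f k - 'i * a k).
  move=> fi ha; have [[si _] e] := sobolev_fun_synth dss ha.
  have isi := CintegrableZ 'i si; split.
    by under eq_fun do rewrite -mulN1r; apply: CintegrableD => //; exact: CintegrableZ.
  by apply/funext => k; rewrite fourierB// fourierZ// e.
have limE (f g : torus_fun R d) : Cintegrable f -> Cintegrable g ->
    Cintegrable (fun x => f x - 'i * g x) /\
    fourier (fun x => f x - 'i * g x) = (fun k => fourier f k - 'i * fourier g k).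
  move=> fi gi; have igi := CintegrableZ 'i gi; split.
    by under eq_fun do rewrite -mulN1r; apply: CintegrableD => //; exact: CintegrableZ.
  by apply/funext => k; rewrite fourierB// fourierZ.
have fJ (f : torus_fun R d) : Cintegrable f ->
    fourier (fun x => (f x)^*) = conj_distr (fourier f).
  by move=> fi; apply/funext => k; exact: fourierJ.
have [ui uE] : (forall c, 0 < c -> Cintegrable (kg_scheme c 1 (z0 c) (z1 c) 0).1) /\
    (forall c, 0 < c -> fourier (kg_scheme c 1 (z0 c) (z1 c) 0).1 =
      fun k => fourier (z0 c) k - 'i * b c k).
  by split => c c0; have [M1 [M2 [h1 h2 _]]] := zb c c0; have [] := initE _ _ _ (zi c c0) h2.
have [vi vE] : (forall c, 0 < c -> Cintegrable (kg_scheme c 1 (z0 c) (z1 c) 0).2) /\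
    (forall c, 0 < c -> fourier (kg_scheme c 1 (z0 c) (z1 c) 0).2 =
      fun k => conj_distr (fourier (z0 c)) k - 'i * conj_distr (b c) k).
  split => c c0; have [M1 [M2 [h1 h2 _]]] := zb c c0;
  have [i e] := initE _ _ _ (CintegrableJ (zi c c0)) (sobolev_ballJ h2).
    by rewrite /= multiplier_inv_cjapJ.
  by rewrite /= multiplier_inv_cjapJ e (fJ _ (zi c c0)).
have [Ui UE] := limE _ _ phi_i gamma_i.
have [Vi VE] := limE _ _ (CintegrableJ phi_i) (CintegrableJ gamma_i).
rewrite !fJ// in VE.
have du c : 0 < c -> sobolev_ball r (kr * c `^ (- delta)) (fun k =>
    fourier (kg_scheme c 1 (z0 c) (z1 c) 0).1 k - fourier (fun x => phi x - 'i * gamma x) k).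
  move=> c0; have [M1 [M2 [h1 h2 h12]]] := zd c c0.
  have := sobolev_ball_sub_i h12 h1 h2; congr (sobolev_ball _ _ _).
  by apply/funext => k; rewrite uE// UE; ring.
have dv c : 0 < c -> sobolev_ball r (kr * c `^ (- delta)) (fun k =>
    fourier (kg_scheme c 1 (z0 c) (z1 c) 0).2 k -
    fourier (fun x => (phi x)^* - 'i * (gamma x)^*) k).
  move=> c0; have [M1 [M2 [h1 h2 h12]]] := zd c c0.
  have := sobolev_ball_sub_i h12 (sobolev_ballJ h1) (sobolev_ballJ h2).
  congr (sobolev_ball _ _ _).
  by apply/funext => k; rewrite vE// VE /conj_distr !rmorphB; ring.
have U0 : sobolev_fun s M (fun x => phi x - 'i * gamma x).
  split=> //; apply: (sobolev_ball_limit d0 _ du) => c c0.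
  have [M1 [M2 [h1 h2 h12]]] := zb c c0.
  by rewrite uE//; exact: sobolev_ball_sub_i h12 h1 h2.
have V0 : sobolev_fun s M (fun x => (phi x)^* - 'i * (gamma x)^*).
  split=> //; apply: (sobolev_ball_limit d0 _ dv) => c c0.
  have [M1 [M2 [h1 h2 h12]]] := zb c c0.
  by rewrite vE//; exact: sobolev_ball_sub_i h12 (sobolev_ballJ h1) (sobolev_ballJ h2).
pose F := flow_bound A (M + 1); pose L := step_constant A (M + 1) (E M).
pose T := (1 + `|F| + `|L|)^-1.
have D0 : 0 < 1 + `|F| + `|L| by rewrite -addrA ltr_pwDl// addr_ge0.
have T0 : 0 < T by rewrite invr_gt0.
have le1 x : x <= 1 + `|F| + `|L| -> T * x <= 1.
  by move=> h; rewrite /T mulrC ler_pdivrMr// mul1r.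
have F0 := normr_ge0 F; have L0 := normr_ge0 L.
have T1 : T <= 1 by have := le1 1; rewrite mulr1; apply; lra.
have TF : T * F <= 1 by apply: le1; have := ler_norm F; lra.
have TL : T * L <= 1 by apply: le1; have := ler_norm L; lra.
exists T, (1 / 2); split => //.
move=> tau n c t0 t12 nT c0 ct.
have t01 : 0 < tau <= 1 by rewrite t0/=; lra.
have c1 : 1 <= c.
  rewrite leNgt; apply/negP => c1.
  have c01 : 0 < c <= 1 by rewrite c0 ltW.
  have d2' : 0 <= 2 - delta by rewrite subr_ge0.
  have := ger_powR c01 d2'; rewrite powRr0 => h.
  have := ler_wpM2l (ltW t0) h; lra.
have cd1 : c `^ (- delta) <= 1.
  have dN : - delta <= 0 by rewrite oppr_le0 ltW.
  by have := ler_powR c1 dN; rewrite powRr0.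
have [hu hv] := scheme_error dr dd A1 hAr hAs c0 cd1 t01 ct kr0 T1 TF TL
  (z0 := z0 c) (z1 := z1 c) (phi := phi) (gamma := gamma) U0 V0
  (ui c c0) (vi c c0) (du c c0) (dv c c0) nT.
move=> /=.
have -> : (2 * E M * c `^ (- delta))%:E = ((c `^ (- delta) * E M)%:E +
    (c `^ (- delta) * E M)%:E)%E by rewrite -EFinD; congr EFin; ring.
by apply: leeD; apply/sobolev_normP => //; exact: sobolev_ball_ge0 hu.
Qed.
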